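(* Let $\mathcal M$ be a timelike surface in $\mathbb R^4_1$ with parallel normalized mean curvature vector field, free of inflection points, and satisfying $K-H^2=0$ at every point. Then $\mathcal M$ locally admits canonical parameters; that is, every point of $\mathcal M$ has a neighbourhood which can be parametrized by canonical isotropic parameters.
   Context: $\mathbb R^4_1$ is $\mathbb R^4$ with the metric $\langle\cdot,\cdot\rangle=dx_1^2+dx_2^2+dx_3^2-dx_4^2$ and flat Levi-Civita connection $\widetilde\nabla$. A surface is given by a smooth immersion $z$ of a domain (open connected set) of $\mathbb R^2$ into $\mathbb R^4_1$; it is timelike if the induced metric is Lorentzian. $\sigma$ is the second fundamental tensor (normal part of $\widetilde\nabla_xy$ for tangent $x,y$), $D$ the normal connection (normal part of $\widetilde\nabla_x\xi$ for normal $\xi$), $H=\tfrac12\mathrm{tr}\,\sigma$ the mean curvature vector field, $K$ the Gauss curvature of the induced metric, and $H^2=\langle H,H\rangle$. A normal field $\xi$ is parallel if $D\xi=0$. $\mathcal M$ has parallel normalized mean curvature vector field if $H$ is nowhere zero, $H$ is not parallel, and there is a unit normal vector field in the direction of $H$ which is parallel. An inflection point is a point $p$ at which the first normal space $\mathrm{span}\{\sigma(x,y):x,y\in T_p\mathcal M\}$ has dimension at most one (equivalently, with $c_{ij}^k$ the components of $\sigma(z_u,z_u),\sigma(z_u,z_v),\sigma(z_v,z_v)$ in an orthonormal normal frame, all three $2\times2$ determinants formed from pairs of these vectors vanish). Parameters $(u,v)$ are isotropic if $\langle z_u,z_u\rangle=\langle z_v,z_v\rangle=0$ and $\langle z_u,z_v\rangle=-f^2$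 for a smooth function $f>0$ (the metric function). Put $x=z_u/f$, $y=z_v/f$, let $n_1$ be a unit normal field collinear with $H$, and let $n_2$ be a unit normal field orthogonal to $n_1$ ($n_2$ is determined up to sign). The labelling of the two isotropic parameters as $u$ and $v$ may be chosen freely (they may be interchanged). For a surface as in the claim, isotropic parameters $(u,v)$ are canonical if $$\sigma(x,x)=\lambda n_1+\mu n_2,\quad \sigma(x,y)=-\nu n_1,\quad \sigma(y,y)=0$$ for smooth functions $\lambda,\mu,\nu$ with $\mu\neq0$, and the metric function is $$f(u,v)=\frac{1}{\sqrt{|\mu|}}.$$ *)

(* Defs.v *)
From Stdlib Require Import Reals.
From Coquelicot Require Import Coquelicot.
Open Scope R_scope.

Definition plane : Type := (R * R)%type.
Definition E4 : Type := (R * R * R * R)%type.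

Definition x1 (w : E4) : R := fst (fst (fst w)).
Definition x2 (w : E4) : R := snd (fst (fst w)).
Definition x3 (w : E4) : R := snd (fst w).
Definition x4 (w : E4) : R := snd w.

Definition lor (a b : E4) : R :=
  x1 a * x1 b + x2 a * x2 b + x3 a * x3 b - x4 a * x4 b.

(** Indices of the two parameters of a surface. *)
Inductive ix : Type := I1 | I2.

Definition sum_ix {G : AbelianMonoid} (F : ix -> G) : G := plus (F I1) (F I2).

(** ** Domains and smooth maps *)

Definition connected (D : plane -> Prop) : Prop :=
  forall A B : plane -> Prop, open A -> open B ->
    (forall p, D p -> A p \/ B p) ->
    (exists p, D p /\ A p) -> (exists p, D p /\ B p) ->
    exists p, D p /\ A p /\ B p.

Definition domain (D : plane -> Prop) : Prop := open D /\ connected D.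

Definition ex_dpar (i : ix) (f : plane -> R) (p : plane) : Prop :=
  match i with
  | I1 => ex_derive (fun t : R => f (t, snd p)) (fst p)
  | I2 => ex_derive (fun t : R => f (fst p, t)) (snd p)
  end.

Definition dpar (i : ix) (f : plane -> R) (p : plane) : R :=
  match i with
  | I1 => Derive (fun t : R => f (t, snd p)) (fst p)
  | I2 => Derive (fun t : R => f (fst p, t)) (snd p)
  end.

(** Class C^n on [D]; meant for open [D]. *)
Fixpoint Cn (n : nat) (D : plane -> Prop) (f : plane -> R) : Prop :=
  (forall p, D p -> continuous f p) /\
  match n with
  | O => True
  | S m => forall i, (forall p, D p -> ex_dpar i f p) /\ Cn m D (dpar i f)
  end.

Definition smooth (D : plane -> Prop) (f : plane -> R) : Prop :=
  forall n, Cn n D f.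

Definition smooth2 (D : plane -> Prop) (phi : plane -> plane) : Prop :=
  smooth D (fun p => fst (phi p)) /\ smooth D (fun p => snd (phi p)).

Definition smooth4 (D : plane -> Prop) (w : plane -> E4) : Prop :=
  smooth D (fun p => x1 (w p)) /\ smooth D (fun p => x2 (w p)) /\
  smooth D (fun p => x3 (w p)) /\ smooth D (fun p => x4 (w p)).

(** Componentwise derivative, i.e. the flat connection along a coordinate
    direction. *)
Definition dvec (i : ix) (w : plane -> E4) (p : plane) : E4 :=
  (dpar i (fun q => x1 (w q)) p, dpar i (fun q => x2 (w q)) p,
   dpar i (fun q => x3 (w q)) p, dpar i (fun q => x4 (w q)) p).

Definition diffeomorphism (U W : plane -> Prop) (phi : plane -> plane) : Prop :=
  exists psi : plane -> plane,
    smooth2 U phi /\ smooth2 W psi /\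
    (forall q, U q -> W (phi q) /\ psi (phi q) = q) /\
    (forall p, W p -> U (psi p) /\ phi (psi p) = p).

(** ** Extrinsic geometry of a parametrized surface [z]

    A tangent vector at the point of parameter [p] is given by its components
    [a : ix -> R] in the basis of the partial derivatives of [z]. *)

Definition tangent (z : plane -> E4) (p : plane) (a : ix -> R) : E4 :=
  sum_ix (fun i => scal (a i) (dvec i z p)).

Definition immersion (D : plane -> Prop) (z : plane -> E4) : Prop :=
  forall p a, D p -> tangent z p a = zero -> forall i, a i = 0.

Definition metric (z : plane -> E4) (p : plane) (a b : ix -> R) : R :=
  lor (tangent z p a) (tangent z p b).

(** The induced metric has signature (1,1) at [p]. *)
Definition lorentzian_at (z : plane -> E4) (p : plane) : Prop :=
  exists a b : ix -> R,
    metric z p a a = 1 /\ metric z p b b = -1 /\ metric z p a b = 0.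

Definition timelike_surface (D : plane -> Prop) (z : plane -> E4) : Prop :=
  domain D /\ smooth4 D z /\ immersion D z /\
  (forall p, D p -> lorentzian_at z p).

Definition g (z : plane -> E4) (i j : ix) (p : plane) : R :=
  lor (dvec i z p) (dvec j z p).

Definition detg (z : plane -> E4) (p : plane) : R :=
  g z I1 I1 p * g z I2 I2 p - g z I1 I2 p * g z I2 I1 p.

Definition ginv (z : plane -> E4) (i j : ix) (p : plane) : R :=
  match i, j with
  | I1, I1 => g z I2 I2 p / detg z p
  | I2, I2 => g z I1 I1 p / detg z p
  | _, _ => - g z I1 I2 p / detg z p
  end.

(** Orthogonal projections onto the tangent and normal planes
    (for a nondegenerate induced metric). *)
Definition tangential_part (z : plane -> E4) (p : plane) (w : E4) : E4 :=
  sum_ix (fun i => sum_ix (fun j =>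
    scal (ginv z i j p * lor w (dvec i z p)) (dvec j z p))).

Definition normal_part (z : plane -> E4) (p : plane) (w : E4) : E4 :=
  minus w (tangential_part z p w).

(** The second fundamental tensor: normal part of the derivative along [a] of
    the tangent field with constant components [b]; another extension of [b]
    changes this derivative only by a tangent vector. *)
Definition sigma (z : plane -> E4) (p : plane) (a b : ix -> R) : E4 :=
  normal_part z p
    (sum_ix (fun i => sum_ix (fun j => scal (a i * b j) (dvec i (dvec j z) p)))).

Definition basis (i : ix) : ix -> R :=
  fun j => match i, j with I1, I1 | I2, I2 => 1 | _, _ => 0 end.

Definition mean_curvature (z : plane -> E4) (p : plane) : E4 :=
  scal (1 / 2) (sum_ix (fun i => sum_ix (fun j =>
    scal (ginv z i j p) (sigma z p (basis i) (basis j))))).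

Definition normal_connection (z xi : plane -> E4) (p : plane) (a : ix -> R) : E4 :=
  normal_part z p (sum_ix (fun i => scal (a i) (dvec i xi p))).

Definition parallel (D : plane -> Prop) (z xi : plane -> E4) : Prop :=
  forall p a, D p -> normal_connection z xi p a = zero.

(** The normal planes of a timelike surface are positive definite, so the
    square of a unit normal vector is [1]. *)
Definition unit_normal_field (D : plane -> Prop) (z n : plane -> E4) : Prop :=
  smooth4 D n /\
  forall p, D p ->
    (forall a, lor (n p) (tangent z p a) = 0) /\ lor (n p) (n p) = 1.

(** The sign of the factor is left free: if [H] has no zero, replacing [n] by
    [- n] on a connected domain makes it positive. *)
Definition collinear_with_H (D : plane -> Prop) (z n : plane -> E4) : Prop :=
  forall p, D p -> exists h : R, mean_curvature z p = scal h (n p).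

Definition parallel_normalized_mean_curvature
    (D : plane -> Prop) (z : plane -> E4) : Prop :=
  (forall p, D p -> mean_curvature z p <> zero) /\
  ~ parallel D z (mean_curvature z) /\
  exists n : plane -> E4,
    unit_normal_field D z n /\ collinear_with_H D z n /\ parallel D z n.

Inductive span (S : E4 -> Prop) : E4 -> Prop :=
| span_zero : span S zero
| span_add (c : R) (s w : E4) : S s -> span S w -> span S (plus (scal c s) w).

Definition first_normal_space (z : plane -> E4) (p : plane) : E4 -> Prop :=
  span (fun w => exists a b, w = sigma z p a b).

Definition dim_le_one (V : E4 -> Prop) : Prop :=
  exists e : E4, forall w, V w -> exists c : R, w = scal c e.

Definition inflection_point (z : plane -> E4) (p : plane) : Prop :=
  dim_le_one (first_normal_space z p).

(** ** Gauss curvature of the induced metric *)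

Definition christoffel (z : plane -> E4) (k i j : ix) (p : plane) : R :=
  1 / 2 * sum_ix (fun l => ginv z k l p *
    (dpar i (g z j l) p + dpar j (g z i l) p - dpar l (g z i j) p)).

(** Component [l] of R(X,Y)Y for the coordinate fields X, Y of indices [I1],
    [I2], with R(X,Y) = nabla_X nabla_Y - nabla_Y nabla_X - nabla_[X,Y], so that
    K = <R(X,Y)Y,X> / (<X,X><Y,Y> - <X,Y>^2). *)
Definition riemann_122 (z : plane -> E4) (l : ix) (p : plane) : R :=
  dpar I1 (christoffel z l I2 I2) p - dpar I2 (christoffel z l I1 I2) p
  + sum_ix (fun m => christoffel z l I1 m p * christoffel z m I2 I2 p
                     - christoffel z l I2 m p * christoffel z m I1 I2 p).

Definition gauss_curvature (z : plane -> E4) (p : plane) : R :=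
  sum_ix (fun l => g z I1 l p * riemann_122 z l p) / detg z p.

(** ** Canonical parameters *)

Definition isotropic_parameters
    (U : plane -> Prop) (z : plane -> E4) (f : plane -> R) : Prop :=
  smooth U f /\
  forall q, U q ->
    0 < f q /\ g z I1 I1 q = 0 /\ g z I2 I2 q = 0 /\ g z I1 I2 q = - (f q) ^ 2.

Definition canonical_parameters (U : plane -> Prop) (z : plane -> E4) : Prop :=
  exists (f lambda mu nu : plane -> R) (n1 n2 : plane -> E4),
    isotropic_parameters U z f /\
    unit_normal_field U z n1 /\ collinear_with_H U z n1 /\
    unit_normal_field U z n2 /\ (forall q, U q -> lor (n1 q) (n2 q) = 0) /\
    smooth U lambda /\ smooth U mu /\ smooth U nu /\
    forall q, U q ->
      let x := fun i => basis I1 i / f q in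
      let y := fun i => basis I2 i / f q in
      sigma z q x x = plus (scal (lambda q) (n1 q)) (scal (mu q) (n2 q)) /\
      sigma z q x y = scal (- nu q) (n1 q) /\
      sigma z q y y = zero /\
      mu q <> 0 /\
      f q = 1 / sqrt (Rabs (mu q)).

(** The reparametrization [phi] may reverse the orientation, so the two isotropic
    parameters can be labelled in either order. *)
Definition locally_admits_canonical_parameters
    (D : plane -> Prop) (z : plane -> E4) : Prop :=
  forall p, D p ->
    exists (U W : plane -> Prop) (phi : plane -> plane),
      domain U /\ open W /\ W p /\ (forall q, W q -> D q) /\
      diffeomorphism U W phi /\
      canonical_parameters U (fun q => z (phi q)).

(* Main.v *)
From Pilot Require Import Defs.
From Stdlib Require Import Reals Lra Lia ClassicalEpsilon.
From Coquelicot Require Import Coquelicot.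
Import Pilot.Defs.
Open Scope R_scope.

(** Let [n] be the parallel unit normal field collinear with [H], and complete it
    to an orthonormal normal frame [n], [m]; then [m] is parallel too. Write [k]
    and [h] for the second fundamental forms in the directions [n] and [m]
    ([sff z n], [sff z m]).

    As [H] is collinear with [n], the form [h] is trace free, and the Ricci
    equation says that the two shape operators commute; hence [k = nu g + c h]
    as soon as [h <> 0] ([commuting_forms]), and [h] vanishes nowhere because
    there are no inflection points. The Gauss equation then turns [K - H^2 = 0]
    into [(1 + c^2) det h = 0] ([rank_one_form]), so [h = eps w (x) w] for a
    one-form [w], which is null because [h] is trace free. Its dual vector [V] is
    null and spans the kernel of [w], on which the quadratic forms [h] and [k]
    both vanish; moreover [dm = - eps w V].

    The Codazzi equation for [h] amounts to [dw = 0] ([null_form_closed]), so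
    locally [w = du] ([poincare]). This [u] is isotropic and normalized: in any
    coordinates [(u, v)], the form [h] is [eps du^2], so [mu = eps / f^2] in
    isotropic ones, which gives [f = 1 / sqrt |mu|].

    It remains to find a function [v] whose gradient is null and independent of
    that of [u]. In general this is a first order partial differential equation,
    but here it is an ordinary one: [m], and therefore [V], depend on [u] only,
    so the curves of constant [u] are straight null lines of the ambient space,
    with affine parameter the time coordinate [s]. Along such a line the squared
    length of the [u]-coordinate field is quadratic in [s], and the null curves
    of the other family solve a Riccati equation in [s]. A fundamental matrix of
    the associated linear system of two equations in [u] acts on [s] by
    fractional linear maps that make these curves the level sets of [v]
    ([transversal_parameter]).

    The passage from functions [(u, s)] or [(u, v)] with independent gradients to
    coordinates is [inverse_function]. Both this theorem and the existence of
    solutions of linear systems ([linear_system]) rest on the same contraction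
    principle ([contraction_fixed_point]). *)

(** * Smooth functions of two variables *)

Arguments dpar : simpl never.

(** Equalities of reals may be typed in an algebraic or topological structure
    carried by the reals, which hides them from [ring] and [field]. *)
Ltac as_R := match goal with |- @eq _ ?a ?b => change (@eq R a b) end.

(** The two partial derivatives are treated at once, as ordinary derivatives
    along [line i p]. *)
Definition line (i : ix) (p : plane) (t : R) : plane :=
  match i with I1 => (t, snd p) | I2 => (fst p, t) end.

Definition coord (i : ix) (p : plane) : R :=
  match i with I1 => fst p | I2 => snd p end.

Definition is_dpar (i : ix) (f : plane -> R) (p : plane) (l : R) : Prop :=
  is_derive (fun t => f (line i p t)) (coord i p) l.

Lemma line_coord (i : ix) (p : plane) : line i p (coord i p) = p.
Proof. destruct p, i; reflexivity. Qed.

Lemma ex_dpar_is_dpar (i : ix) (f : plane -> R) (p : plane) :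
  ex_dpar i f p -> is_dpar i f p (dpar i f p).
Proof. destruct i; intros H; apply Derive_correct; exact H. Qed.

Lemma is_dpar_ex_dpar (i : ix) (f : plane -> R) (p : plane) (l : R) :
  is_dpar i f p l -> ex_dpar i f p.
Proof. destruct i; intros H; exists l; exact H. Qed.

Lemma is_dpar_unique (i : ix) (f : plane -> R) (p : plane) (l : R) :
  is_dpar i f p l -> dpar i f p = l.
Proof. destruct i; intros H; apply is_derive_unique; exact H. Qed.

Lemma ball_plane (p q : plane) (r : R) :
  ball p r q <-> Rabs (fst q - fst p) < r /\ Rabs (snd q - snd p) < r.
Proof. reflexivity. Qed.

Lemma ball_line (i : ix) (p : plane) (r t : R) :
  ball (coord i p) r t -> ball p r (line i p t).
Proof.
  intros H. change (Rabs (t - coord i p) < r) in H.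
  assert (Hr : 0 < r) by (generalize (Rabs_pos (t - coord i p)); lra).
  apply ball_plane. destruct i; simpl; rewrite Rminus_diag, Rabs_R0; auto.
Qed.

Lemma open_line (i : ix) (D : plane -> Prop) (p : plane) :
  open D -> D p -> locally (coord i p) (fun t => D (line i p t)).
Proof.
  intros HD Hp. destruct (HD p Hp) as [r Hr].
  exists r. intros t Ht. apply Hr, ball_line, Ht.
Qed.

Lemma is_dpar_ext (i : ix) (D : plane -> Prop) (f h : plane -> R) (p : plane) (l : R) :
  open D -> D p -> (forall q, D q -> f q = h q) -> is_dpar i f p l -> is_dpar i h p l.
Proof.
  intros HD Hp E. apply is_derive_ext_loc.
  generalize (open_line i D p HD Hp). apply filter_imp. intros t Ht. apply E, Ht.
Qed.

Lemma dpar_ext (i : ix) (D : plane -> Prop) (f h : plane -> R) (p : plane) :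
  open D -> D p -> (forall q, D q -> f q = h q) -> dpar i f p = dpar i h p.
Proof.
  intros HD Hp E. generalize (open_line i D p HD Hp).
  destruct i; intros L; apply Derive_ext_loc; revert L; apply filter_imp;
    intros t Ht; apply E, Ht.
Qed.

Lemma continuous_ext_open (D : plane -> Prop) (f h : plane -> R) (p : plane) :
  open D -> D p -> (forall q, D q -> f q = h q) -> continuous f p -> continuous h p.
Proof.
  intros HD Hp E. apply continuous_ext_loc.
  generalize (HD p Hp). apply filter_imp. exact E.
Qed.

Lemma Cn_cont (n : nat) (D : plane -> Prop) (f : plane -> R) (p : plane) :
  Cn n D f -> D p -> continuous f p.
Proof. destruct n; intros [H _]; apply H. Qed.

Lemma Cn_is_dpar (n : nat) (D : plane -> Prop) (f : plane -> R) (i : ix) (p : plane) :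
  Cn (S n) D f -> D p -> is_dpar i f p (dpar i f p).
Proof. intros [_ H] Hp. apply ex_dpar_is_dpar, H, Hp. Qed.

Lemma Cn_dpar (n : nat) (D : plane -> Prop) (f : plane -> R) (i : ix) :
  Cn (S n) D f -> Cn n D (dpar i f).
Proof. intros [_ H]. apply H. Qed.

Lemma Cn_ext (n : nat) (D : plane -> Prop) (f h : plane -> R) :
  open D -> (forall q, D q -> f q = h q) -> Cn n D f -> Cn n D h.
Proof.
  intros HD. revert f h. induction n as [|n IH]; intros f h E Hf.
  - split; [|exact I]. intros p Hp.
    apply (continuous_ext_open D f); auto. apply Hf, Hp.
  - split.
    + intros p Hp. apply (continuous_ext_open D f); auto. apply Hf, Hp.
    + intros i. split.
      * intros p Hp. eapply is_dpar_ex_dpar, (is_dpar_ext i D f); eauto.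
        apply (Cn_is_dpar n D); assumption.
      * apply (IH (dpar i f)); [|apply (Cn_dpar n D f i Hf)].
        intros q Hq. apply (dpar_ext i D); auto.
Qed.

(** Recognizing the class [C^(n+1)] from any functions that happen to be the
    partial derivatives; this is how closure under the usual operations is obtained. *)
Lemma Cn_intro (n : nat) (D : plane -> Prop) (f : plane -> R) (d : ix -> plane -> R) :
  open D -> (forall p, D p -> continuous f p) ->
  (forall i p, D p -> is_dpar i f p (d i p)) -> (forall i, Cn n D (d i)) ->
  Cn (S n) D f.
Proof.
  intros HD Hc Hd Hn. split; [exact Hc|]. intros i. split.
  - intros p Hp. eapply is_dpar_ex_dpar, Hd, Hp.
  - apply (Cn_ext n D (d i)); auto. intros q Hq. symmetry. apply is_dpar_unique, Hd, Hq.
Qed.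

Lemma Cn_pred (n : nat) (D : plane -> Prop) (f : plane -> R) : Cn (S n) D f -> Cn n D f.
Proof.
  revert f. induction n as [|n IH]; intros f [Hc Hd].
  - split; [exact Hc | exact I].
  - split; [exact Hc|]. intros i. destruct (Hd i) as [He Hn]. split; [exact He|].
    apply IH, Hn.
Qed.

Lemma Cn_sub (n : nat) (D D' : plane -> Prop) (f : plane -> R) :
  (forall p, D' p -> D p) -> Cn n D f -> Cn n D' f.
Proof.
  intros HS. revert f. induction n as [|n IH]; intros f [Hc Hd].
  - split; [|exact I]. auto.
  - split; [auto|]. intros i. destruct (Hd i) as [He Hn]. split; auto.
Qed.

Lemma is_dpar_const (i : ix) (c : R) (p : plane) : is_dpar i (fun _ => c) p 0.
Proof. exact (is_derive_const (V := R_NormedModule) c (coord i p)). Qed.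

Lemma is_dpar_coord (i j : ix) (p : plane) : is_dpar j (coord i) p (basis i j).
Proof.
  destruct i, j; first [exact (is_derive_id (K := R_AbsRing) _)
                       | exact (is_derive_const (V := R_NormedModule) _ _)].
Qed.

Lemma Cn_const (n : nat) (D : plane -> Prop) (c : R) : open D -> Cn n D (fun _ => c).
Proof.
  intros HD. revert c. induction n as [|n IH]; intros c.
  - split; [|exact I]. intros. apply continuous_const.
  - apply (Cn_intro n D _ (fun _ _ => 0)); auto.
    + intros. apply continuous_const.
    + intros i p _. apply is_dpar_const.
Qed.

Lemma Cn_plus (n : nat) (D : plane -> Prop) (f h : plane -> R) :
  open D -> Cn n D f -> Cn n D h -> Cn n D (fun p => f p + h p).
Proof.
  intros HD. revert f h. induction n as [|n IH]; intros f h Hf Hh.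
  - split; [|exact I]. intros p Hp.
    apply (continuous_plus (V := R_NormedModule) f h); [apply Hf | apply Hh]; exact Hp.
  - apply (Cn_intro n D _ (fun i p => dpar i f p + dpar i h p)); auto.
    + intros p Hp.
      apply (continuous_plus (V := R_NormedModule) f h); [apply Hf | apply Hh]; exact Hp.
    + intros i p Hp. apply (is_derive_plus (V := R_NormedModule));
        apply (Cn_is_dpar n D); assumption.
    + intros i. apply IH; apply Cn_dpar; assumption.
Qed.

Lemma is_dpar_mult (i : ix) (f h : plane -> R) (p : plane) (a b : R) :
  is_dpar i f p a -> is_dpar i h p b ->
  is_dpar i (fun q => f q * h q) p (a * h p + f p * b).
Proof.
  intros Ha Hb. unfold is_dpar.
  replace (a * h p + f p * b)
    with (a * h (line i p (coord i p)) + f (line i p (coord i p)) * b)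
    by (rewrite line_coord; reflexivity).
  exact (is_derive_mult (fun t => f (line i p t)) (fun t => h (line i p t))
           (coord i p) a b Ha Hb Rmult_comm).
Qed.

Lemma Cn_mult (n : nat) (D : plane -> Prop) (f h : plane -> R) :
  open D -> Cn n D f -> Cn n D h -> Cn n D (fun p => f p * h p).
Proof.
  intros HD. revert f h. induction n as [|n IH]; intros f h Hf Hh.
  - split; [|exact I]. intros p Hp.
    apply (continuous_mult (K := R_AbsRing) f h); [apply Hf | apply Hh]; exact Hp.
  - apply (Cn_intro n D _ (fun i p => dpar i f p * h p + f p * dpar i h p)); auto.
    + intros p Hp.
      apply (continuous_mult (K := R_AbsRing) f h); [apply Hf | apply Hh]; exact Hp.
    + intros i p Hp. apply is_dpar_mult; apply (Cn_is_dpar n D); assumption.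
    + intros i. apply Cn_plus; auto; apply IH; auto using Cn_dpar, Cn_pred.
Qed.

Lemma is_dpar_comp1 (i : ix) (e : R -> R) (f : plane -> R) (p : plane) (a b : R) :
  is_derive e (f p) b -> is_dpar i f p a -> is_dpar i (fun q => e (f q)) p (a * b).
Proof.
  intros He Hf. unfold is_dpar. apply (is_derive_comp e (fun t => f (line i p t))).
  - rewrite line_coord. exact He.
  - exact Hf.
Qed.

(** The derivative of [1 / f] is a product of [df] and of [1 / f] itself, so the
    class climbs by induction; likewise for the square root. *)
Lemma Cn_inv (n : nat) (D : plane -> Prop) (f : plane -> R) :
  open D -> (forall p, D p -> f p <> 0) -> Cn n D f -> Cn n D (fun p => / f p).
Proof.
  intros HD Hz.
  assert (Hc : Cn n D f -> forall p, D p -> continuous (fun p => / f p) p).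
  { intros Hf p Hp. apply (continuous_comp f Rinv); [exact (Cn_cont n D f p Hf Hp)|].
    apply continuous_Rinv, Hz, Hp. }
  revert Hc. induction n as [|n IH]; intros Hc Hf.
  - split; [|exact I]. exact (Hc Hf).
  - assert (Hi : Cn n D (fun p => / f p)).
    { apply IH; [intros _ ; exact (Hc Hf)|]. apply Cn_pred, Hf. }
    apply (Cn_intro n D _ (fun i p => dpar i f p * (-1 * (/ f p * / f p)))); auto.
    + intros i p Hp. apply is_dpar_comp1; [|apply (Cn_is_dpar n D); assumption].
      replace (-1 * (/ f p * / f p)) with (- / (f p) ^ 2)
        by (field; apply Hz, Hp).
      replace (- / (f p) ^ 2) with (- 1 / (f p) ^ 2) by (field; apply Hz, Hp).
      auto_derive; [apply Hz, Hp | field; apply Hz, Hp].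
    + intros i. apply Cn_mult; auto using Cn_dpar.
      apply Cn_mult; auto using Cn_const, Cn_mult.
Qed.

Lemma Cn_sqrt (n : nat) (D : plane -> Prop) (f : plane -> R) :
  open D -> (forall p, D p -> 0 < f p) -> Cn n D f -> Cn n D (fun p => sqrt (f p)).
Proof.
  intros HD Hz.
  assert (Hc : Cn n D f -> forall p, D p -> continuous (fun p => sqrt (f p)) p).
  { intros Hf p Hp. apply (continuous_comp f sqrt); [exact (Cn_cont n D f p Hf Hp)|].
    apply continuous_sqrt. }
  revert Hc. induction n as [|n IH]; intros Hc Hf.
  - split; [|exact I]. exact (Hc Hf).
  - assert (Hi : Cn n D (fun p => sqrt (f p))).
    { apply IH; [intros _ ; exact (Hc Hf)|]. apply Cn_pred, Hf. }
    apply (Cn_intro n D _ (fun i p => dpar i f p * / (2 * sqrt (f p)))); auto.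
    + intros i p Hp. apply is_dpar_comp1; [|apply (Cn_is_dpar n D); assumption].
      auto_derive; [apply Hz, Hp | ring].
    + intros i. apply Cn_mult; auto using Cn_dpar.
      apply Cn_inv; auto; [|apply Cn_mult; auto using Cn_const].
      intros p Hp. generalize (sqrt_lt_R0 _ (Hz p Hp)). lra.
Qed.

Lemma Cn_1_differentiable (D : plane -> Prop) (f : plane -> R) (p : plane) :
  open D -> Cn 1 D f -> D p ->
  differentiable_pt_lim (fun a b => f (a, b)) (fst p) (snd p) (dpar I1 f p) (dpar I2 f p).
Proof.
  intros HD Hf Hp. apply filterdiff_differentiable_pt_lim.
  apply (is_derive_filterdiff (fun a b => f (a, b)) (fst p) (snd p)
           (fun a b => dpar I1 f (a, b)) (dpar I2 f p)).
  - rewrite <- surjective_pairing. generalize (HD p Hp). apply filter_imp.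
    intros q Hq. generalize (Cn_is_dpar 0 D f I1 q Hf Hq). destruct q. exact (fun H => H).
  - exact (Cn_is_dpar 0 D f I2 p Hf Hp).
  - generalize (Cn_cont 0 D _ p (Cn_dpar 0 D f I1 Hf) Hp). destruct p. simpl.
    apply continuous_ext. intros [a b]. reflexivity.
Qed.

Definition F1 (phi : plane -> plane) : plane -> R := fun p => fst (phi p).
Definition F2 (phi : plane -> plane) : plane -> R := fun p => snd (phi p).

Lemma is_dpar_comp (i : ix) (D : plane -> Prop) (f : plane -> R) (phi : plane -> plane)
    (p : plane) (a b : R) :
  open D -> Cn 1 D f -> D (phi p) ->
  is_dpar i (fun q => fst (phi q)) p a -> is_dpar i (fun q => snd (phi q)) p b ->
  is_dpar i (fun q => f (phi q)) p
    (dpar I1 f (phi p) * a + dpar I2 f (phi p) * b).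
Proof.
  intros HD Hf Hp Ha Hb.
  generalize (Cn_1_differentiable D f (phi p) HD Hf Hp). intros Hd.
  unfold is_dpar.
  apply (is_derive_ext (fun t => f (fst (phi (line i p t)), snd (phi (line i p t))))).
  { intros t. rewrite <- surjective_pairing. reflexivity. }
  apply is_derive_Reals.
  apply (derivable_pt_lim_comp_2d (fun a b => f (a, b))
    (fun t => fst (phi (line i p t))) (fun t => snd (phi (line i p t)))).
  - rewrite line_coord. exact Hd.
  - apply is_derive_Reals, Ha.
  - apply is_derive_Reals, Hb.
Qed.

Lemma continuous_pair (U : UniformSpace) (f h : U -> R) (p : U) :
  continuous f p -> continuous h p -> continuous (fun q => (f q, h q)) p.
Proof.
  intros Hf Hh. apply (continuous_comp_2 f h (fun a b => (a, b))); auto.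
  apply (continuous_ext (fun x : R * R => x)); [intros [? ?]; reflexivity|].
  apply continuous_id.
Qed.

Lemma continuous_plane_map (U : UniformSpace) (phi : U -> plane) (p : U) :
  continuous (fun q => fst (phi q)) p -> continuous (fun q => snd (phi q)) p ->
  continuous phi p.
Proof.
  intros Hf Hh. eapply continuous_ext; [|exact (continuous_pair U _ _ p Hf Hh)].
  intros x. simpl. rewrite <- surjective_pairing. reflexivity.
Qed.

Lemma Cn_comp (n : nat) (D U : plane -> Prop) (f : plane -> R) (phi : plane -> plane) :
  open D -> open U -> (forall q, U q -> D (phi q)) -> Cn n D f ->
  Cn n U (fun q => fst (phi q)) -> Cn n U (fun q => snd (phi q)) ->
  Cn n U (fun q => f (phi q)).
Proof.
  intros HD HU HS. revert f. induction n as [|n IH]; intros f Hf H1 H2.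
  - split; [|exact I]. intros p Hp. apply (continuous_comp phi f).
    + apply continuous_plane_map; [apply H1 | apply H2]; exact Hp.
    + apply Hf, HS, Hp.
  - apply (Cn_intro n U _ (fun i q => dpar I1 f (phi q) * dpar i (fun q => fst (phi q)) q
      + dpar I2 f (phi q) * dpar i (fun q => snd (phi q)) q)); auto.
    + intros p Hp. apply (continuous_comp phi f).
      * apply continuous_plane_map; [apply H1 | apply H2]; exact Hp.
      * apply Hf, HS, Hp.
    + intros i p Hp. apply (is_dpar_comp i D); auto.
      * clear - Hf. destruct n; [exact Hf|]. destruct Hf as [Hc Hd]. split; [exact Hc|].
        intros i. destruct (Hd i) as [He Hn]. split; [exact He|]. split; [apply Hn | exact I].
      * apply (Cn_is_dpar n U); assumption.
      * apply (Cn_is_dpar n U); assumption.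
    + intros i. apply Cn_plus; auto; apply Cn_mult; auto using Cn_dpar;
        apply IH; auto using Cn_dpar, Cn_pred.
Qed.

(** ** The class [C^infty] *)

Lemma smooth_sub (D D' : plane -> Prop) (f : plane -> R) :
  (forall p, D' p -> D p) -> smooth D f -> smooth D' f.
Proof. intros H Hf n. apply (Cn_sub n D); auto. Qed.

Lemma smooth_ext (D : plane -> Prop) (f h : plane -> R) :
  open D -> (forall q, D q -> f q = h q) -> smooth D f -> smooth D h.
Proof. intros HD E Hf n. apply (Cn_ext n D f); auto. Qed.

Lemma smooth_const (D : plane -> Prop) (c : R) : open D -> smooth D (fun _ => c).
Proof. intros HD n. apply Cn_const, HD. Qed.

Lemma smooth_plus (D : plane -> Prop) (f h : plane -> R) :
  open D -> smooth D f -> smooth D h -> smooth D (fun p => f p + h p).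
Proof. intros HD Hf Hh n. apply Cn_plus; auto. Qed.

Lemma smooth_mult (D : plane -> Prop) (f h : plane -> R) :
  open D -> smooth D f -> smooth D h -> smooth D (fun p => f p * h p).
Proof. intros HD Hf Hh n. apply Cn_mult; auto. Qed.

Lemma smooth_opp (D : plane -> Prop) (f : plane -> R) :
  open D -> smooth D f -> smooth D (fun p => - f p).
Proof.
  intros HD Hf. apply (smooth_ext D (fun p => -1 * f p)); auto.
  - intros. ring.
  - apply smooth_mult; auto using smooth_const.
Qed.

Lemma smooth_minus (D : plane -> Prop) (f h : plane -> R) :
  open D -> smooth D f -> smooth D h -> smooth D (fun p => f p - h p).
Proof. intros HD Hf Hh. apply smooth_plus; auto using smooth_opp. Qed.

Lemma smooth_inv (D : plane -> Prop) (f : plane -> R) :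
  open D -> (forall p, D p -> f p <> 0) -> smooth D f -> smooth D (fun p => / f p).
Proof. intros HD Hz Hf n. apply Cn_inv; auto. Qed.

Lemma smooth_div (D : plane -> Prop) (f h : plane -> R) :
  open D -> (forall p, D p -> h p <> 0) -> smooth D f -> smooth D h ->
  smooth D (fun p => f p / h p).
Proof. intros HD Hz Hf Hh. apply smooth_mult; auto using smooth_inv. Qed.

Lemma smooth_sqrt (D : plane -> Prop) (f : plane -> R) :
  open D -> (forall p, D p -> 0 < f p) -> smooth D f -> smooth D (fun p => sqrt (f p)).
Proof. intros HD Hz Hf n. apply Cn_sqrt; auto. Qed.

Lemma smooth_dpar (D : plane -> Prop) (f : plane -> R) (i : ix) :
  smooth D f -> smooth D (dpar i f).
Proof. intros Hf n. apply Cn_dpar, Hf. Qed.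

Lemma smooth_cont (D : plane -> Prop) (f : plane -> R) (p : plane) :
  smooth D f -> D p -> continuous f p.
Proof. intros Hf. exact (Cn_cont 0 D f p (Hf O)). Qed.

Lemma smooth_is_dpar (D : plane -> Prop) (f : plane -> R) (i : ix) (p : plane) :
  smooth D f -> D p -> is_dpar i f p (dpar i f p).
Proof. intros Hf. exact (Cn_is_dpar 0 D f i p (Hf 1%nat)). Qed.

Lemma smooth_comp (D U : plane -> Prop) (f : plane -> R) (phi : plane -> plane) :
  open D -> open U -> (forall q, U q -> D (phi q)) -> smooth D f -> smooth2 U phi ->
  smooth U (fun q => f (phi q)).
Proof. intros HD HU HS Hf [H1 H2] n. apply (Cn_comp n D U); auto. Qed.

Lemma smooth_intro (D : plane -> Prop) (f : plane -> R) (d : ix -> plane -> R) :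
  open D -> (forall p, D p -> continuous f p) ->
  (forall i p, D p -> is_dpar i f p (d i p)) -> (forall i, smooth D (d i)) ->
  smooth D f.
Proof.
  intros HD Hc Hd Hn [|n].
  - split; [exact Hc | exact I].
  - apply (Cn_intro n D f d); auto. intros i. apply Hn.
Qed.

Lemma smooth_coord (D : plane -> Prop) (i : ix) : open D -> smooth D (coord i).
Proof.
  intros HD. apply (smooth_intro D _ (fun j _ => basis i j)); auto.
  - intros p _. destruct i; [apply continuous_fst | apply continuous_snd].
  - intros j p _. apply is_dpar_coord.
  - intros j. apply smooth_const, HD.
Qed.

(** ** Rules for partial derivatives *)

Lemma dpar_const (i : ix) (c : R) (p : plane) : dpar i (fun _ => c) p = 0.
Proof. apply is_dpar_unique, is_dpar_const. Qed.

Lemma dpar_coord (i j : ix) (p : plane) : dpar j (coord i) p = basis i j.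
Proof. apply is_dpar_unique, is_dpar_coord. Qed.

Section Rules.
Variables (D : plane -> Prop) (i : ix) (p : plane).
Hypothesis Hp : D p.

Lemma dpar_plus (f h : plane -> R) : smooth D f -> smooth D h ->
  dpar i (fun q => f q + h q) p = dpar i f p + dpar i h p.
Proof.
  intros Hf Hh. apply is_dpar_unique.
  apply (is_derive_plus (V := R_NormedModule)); apply (smooth_is_dpar D); assumption.
Qed.

Lemma dpar_minus (f h : plane -> R) : smooth D f -> smooth D h ->
  dpar i (fun q => f q - h q) p = dpar i f p - dpar i h p.
Proof.
  intros Hf Hh. apply is_dpar_unique.
  apply (is_derive_minus (V := R_NormedModule)); apply (smooth_is_dpar D); assumption.
Qed.

Lemma dpar_mult (f h : plane -> R) : smooth D f -> smooth D h ->
  dpar i (fun q => f q * h q) p = dpar i f p * h p + f p * dpar i h p.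
Proof.
  intros Hf Hh. apply is_dpar_unique, is_dpar_mult; apply (smooth_is_dpar D); assumption.
Qed.

End Rules.

Lemma dpar_comp (D U : plane -> Prop) (f : plane -> R) (phi : plane -> plane)
    (i : ix) (p : plane) :
  open D -> smooth D f -> smooth2 U phi -> U p -> D (phi p) ->
  dpar i (fun q => f (phi q)) p =
    dpar I1 f (phi p) * dpar i (fun q => fst (phi q)) p
    + dpar I2 f (phi p) * dpar i (fun q => snd (phi q)) p.
Proof.
  intros HD Hf [H1 H2] Hp Hq. apply is_dpar_unique.
  apply (is_dpar_comp i D); auto; apply (smooth_is_dpar U); assumption.
Qed.

(** Schwarz's theorem. *)
Lemma dpar_swap (D : plane -> Prop) (f : plane -> R) (i j : ix) (p : plane) :
  open D -> smooth D f -> D p -> dpar i (dpar j f) p = dpar j (dpar i f) p.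
Proof.
  intros HD Hf.
  assert (main : forall p, D p -> dpar I1 (dpar I2 f) p = dpar I2 (dpar I1 f) p).
  { clear p. intros p Hp.
    assert (C : forall k l, continuity_2d_pt (fun u v => dpar k (dpar l f) (u, v))
                              (fst p) (snd p)).
    { intros k l. apply continuity_2d_pt_filterlim. rewrite <- surjective_pairing.
      generalize (smooth_cont D _ p (smooth_dpar D _ k (smooth_dpar D f l Hf)) Hp).
      apply continuous_ext. intros [a b]. reflexivity. }
    apply (Schwarz (fun u v => f (u, v)) (fst p) (snd p)).
    - apply locally_2d_locally. rewrite <- surjective_pairing.
      generalize (HD p Hp). apply filter_imp. intros q Hq.
      repeat split.
      + exact (is_dpar_ex_dpar I1 f q _ (smooth_is_dpar D f I1 q Hf Hq)).
      + exact (is_dpar_ex_dpar I2 f q _ (smooth_is_dpar D f I2 q Hf Hq)).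
      + exact (is_dpar_ex_dpar I1 (dpar I2 f) q _
          (smooth_is_dpar D _ I1 q (smooth_dpar D f I2 Hf) Hq)).
      + exact (is_dpar_ex_dpar I2 (dpar I1 f) q _
          (smooth_is_dpar D _ I2 q (smooth_dpar D f I1 Hf) Hq)).
    - exact (C I1 I2).
    - exact (C I2 I1). }
  intros Hp. destruct i, j; auto. symmetry. auto.
Qed.

(** ** Open sets *)

Lemma open_preimage (U : plane -> Prop) (W : plane -> Prop) (phi : plane -> plane) :
  open U -> open W -> (forall p, U p -> continuous phi p) ->
  open (fun p => U p /\ W (phi p)).
Proof.
  intros HU HW Hc p [Hp Hq].
  apply filter_and; [apply HU, Hp|]. apply (Hc p Hp W). apply HW, Hq.
Qed.

Lemma open_pos (U : plane -> Prop) (f : plane -> R) :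
  open U -> (forall p, U p -> continuous f p) -> open (fun p => U p /\ 0 < f p).
Proof.
  intros HU Hc p [Hp Hq].
  apply filter_and; [apply HU, Hp|]. apply (Hc p Hp (fun y => 0 < y)).
  apply open_gt, Hq.
Qed.

Lemma smooth2_continuous (U : plane -> Prop) (phi : plane -> plane) (p : plane) :
  smooth2 U phi -> U p -> continuous phi p.
Proof.
  intros [H1 H2] Hp. apply continuous_plane_map; [eapply smooth_cont | eapply smooth_cont]; eauto.
Qed.

Lemma open_ball (p : plane) (r : R) : open (fun q => ball p r q).
Proof.
  intros q [H1 H2].
  assert (G1 : 0 < r - Rabs (fst q - fst p)) by (apply Rlt_0_minus; exact H1).
  assert (G2 : 0 < r - Rabs (snd q - snd p)) by (apply Rlt_0_minus; exact H2).
  exists (mkposreal _ (Rmin_pos _ _ G1 G2)). intros x [X1 X2].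
  change (Rabs (fst x - fst q) < Rmin (r - Rabs (fst q - fst p)) (r - Rabs (snd q - snd p))) in X1.
  change (Rabs (snd x - snd q) < Rmin (r - Rabs (fst q - fst p)) (r - Rabs (snd q - snd p))) in X2.
  pose proof (Rmin_l (r - Rabs (fst q - fst p)) (r - Rabs (snd q - snd p))).
  pose proof (Rmin_r (r - Rabs (fst q - fst p)) (r - Rabs (snd q - snd p))).
  split.
  - change (Rabs (fst x - fst p) < r).
    replace (fst x - fst p) with ((fst x - fst q) + (fst q - fst p)) by ring.
    eapply Rle_lt_trans; [apply Rabs_triang|]. lra.
  - change (Rabs (snd x - snd p) < r).
    replace (snd x - snd p) with ((snd x - snd q) + (snd q - snd p)) by ring.
    eapply Rle_lt_trans; [apply Rabs_triang|]. lra.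
Qed.

(** * Fixed points in spaces of bounded families *)

Section FixedPoint.

Variables (T : Type) (S : (T -> R) -> Prop) (Phi : (T -> R) -> T -> R).
Variables (f0 : T -> R) (C : R).
Hypothesis S0 : S f0.
Hypothesis SPhi : forall f, S f -> S (Phi f).
Hypothesis Sclosed : forall f,
  (forall eps, 0 < eps -> exists h, S h /\ forall t, Rabs (h t - f t) <= eps) -> S f.
Hypothesis Phi_half : forall f h c, S f -> S h ->
  (forall t, Rabs (f t - h t) <= c) -> forall t, Rabs (Phi f t - Phi h t) <= c / 2.
Hypothesis step0 : forall t, Rabs (Phi f0 t - f0 t) <= C.

Fixpoint iterate (n : nat) : T -> R :=
  match n with O => f0 | Datatypes.S m => Phi (iterate m) end.

Lemma iterate_in (n : nat) : S (iterate n).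
Proof. induction n; simpl; auto. Qed.

Lemma iterate_step (n : nat) (t : T) :
  Rabs (iterate (Datatypes.S n) t - iterate n t) <= C * (1 / 2) ^ n.
Proof.
  revert t. induction n as [|n IH]; intros t.
  - simpl. rewrite Rmult_1_r. apply step0.
  - replace (C * (1 / 2) ^ Datatypes.S n) with ((C * (1 / 2) ^ n) / 2) by (simpl; field).
    apply (Phi_half (iterate (Datatypes.S n)) (iterate n)); auto using iterate_in.
Qed.

Lemma iterate_far (n k : nat) (t : T) :
  Rabs (iterate (k + n) t - iterate n t) <= 2 * C * (1 / 2) ^ n * (1 - (1 / 2) ^ k).
Proof.
  induction k as [|k IH].
  - simpl. rewrite Rminus_diag, Rabs_R0. lra.
  - change (Datatypes.S k + n)%nat with (Datatypes.S (k + n)).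
    replace (iterate (Datatypes.S (k + n)) t - iterate n t)
      with ((iterate (Datatypes.S (k + n)) t - iterate (k + n) t)
            + (iterate (k + n) t - iterate n t)) by ring.
    eapply Rle_trans; [apply Rabs_triang|].
    generalize (iterate_step (k + n) t). rewrite pow_add. simpl pow. lra.
Qed.

Lemma C_nonneg (t : T) : 0 <= C.
Proof. eapply Rle_trans; [apply Rabs_pos | apply (step0 t)]. Qed.

Lemma iterate_close (n m : nat) (t : T) : (n <= m)%nat ->
  Rabs (iterate m t - iterate n t) <= 2 * C * (1 / 2) ^ n.
Proof.
  intros H. replace m with ((m - n) + n)%nat by lia.
  eapply Rle_trans; [apply iterate_far|].
  assert (0 <= 2 * C * (1 / 2) ^ n).
  { apply Rmult_le_pos; [generalize (C_nonneg t); lra | apply pow_le; lra]. }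
  assert (0 < (1 / 2) ^ (m - n)) by (apply pow_lt; lra).
  rewrite <- (Rmult_1_r (2 * C * (1 / 2) ^ n)) at 2.
  apply Rmult_le_compat_l; lra.
Qed.

Lemma half_pow_small (eps : R) (t : T) : 0 < eps -> exists n, 2 * C * (1 / 2) ^ n <= eps.
Proof.
  intros He. pose proof (C_nonneg t) as HC.
  destruct (pow_lt_1_zero (1 / 2)) with (y := eps / (2 * C + 1)) as [N HN].
  - rewrite Rabs_right; lra.
  - apply Rdiv_lt_0_compat; lra.
  - exists N. specialize (HN N (Nat.le_refl N)).
    assert (0 < (1 / 2) ^ N) by (apply pow_lt; lra).
    rewrite Rabs_right in HN by lra.
    apply Rmult_lt_compat_r with (r := 2 * C + 1) in HN; [|lra].
    unfold Rdiv in HN at 2. rewrite Rmult_assoc, Rinv_l, Rmult_1_r in HN by lra. nra.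
Qed.

Definition iterate_limit (t : T) : R := real (Lim_seq (fun n => iterate n t)).

Lemma iterate_limit_close (n : nat) (t : T) :
  Rabs (iterate n t - iterate_limit t) <= 2 * C * (1 / 2) ^ n.
Proof.
  assert (Hex : ex_finite_lim_seq (fun n => iterate n t)).
  { apply ex_lim_seq_cauchy_corr. intros eps.
    destruct (half_pow_small (eps / 4) t) as [N HN].
    { generalize (cond_pos eps). lra. }
    exists N. intros a b Ha Hb.
    replace (iterate a t - iterate b t)
      with ((iterate a t - iterate N t) + - (iterate b t - iterate N t)) by ring.
    eapply Rle_lt_trans; [apply Rabs_triang|]. rewrite Rabs_Ropp.
    generalize (iterate_close N a t Ha) (iterate_close N b t Hb) (cond_pos eps). lra. }
  apply Lim_seq_correct' in Hex. fold (iterate_limit t) in Hex.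
  apply (is_lim_seq_incr_n _ n) in Hex.
  assert (H1 : Rbar_le (iterate n t - 2 * C * (1 / 2) ^ n) (iterate_limit t)).
  { eapply (is_lim_seq_le (fun _ => iterate n t - 2 * C * (1 / 2) ^ n));
      [|apply is_lim_seq_const | exact Hex].
    intros k. generalize (iterate_close n (k + n) t ltac:(lia)).
    intros H; apply Rabs_le_between in H. lra. }
  assert (H2 : Rbar_le (iterate_limit t) (iterate n t + 2 * C * (1 / 2) ^ n)).
  { eapply (is_lim_seq_le _ (fun _ => iterate n t + 2 * C * (1 / 2) ^ n));
      [|exact Hex | apply is_lim_seq_const].
    intros k. generalize (iterate_close n (k + n) t ltac:(lia)).
    intros H; apply Rabs_le_between in H. lra. }
  simpl in H1, H2. apply Rabs_le. lra.
Qed.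

(** Contraction principle in the sup norm. The index type [T] has two elements
    when it solves equations in the plane, and is a line for each unknown when
    it solves differential equations. *)
Lemma contraction_fixed_point : exists f, S f /\ forall t, Phi f t = f t.
Proof.
  assert (HS : S iterate_limit).
  { apply Sclosed. intros eps He.
    destruct (classic (exists t : T, True)) as [[t _]|Hn].
    - destruct (half_pow_small eps t He) as [n Hn]. exists (iterate n).
      split; [apply iterate_in|]. intros t'.
      eapply Rle_trans; [apply iterate_limit_close | exact Hn].
    - exists f0. split; [exact S0|]. intros t. exfalso. eauto. }
  exists iterate_limit. split; [exact HS|]. intros t.
  apply Rminus_diag_uniq.
  apply Rabs_eq_0. apply Rle_antisym; [|apply Rabs_pos].
  apply Rle_plus_epsilon. intros eps He.
  destruct (half_pow_small (eps / 2) t) as [n Hn]; [lra|].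
  replace (Phi iterate_limit t - iterate_limit t)
    with (- (Phi (iterate n) t - Phi iterate_limit t)
          + (iterate (Datatypes.S n) t - iterate_limit t)) by (simpl; ring).
  eapply Rle_trans; [apply Rabs_triang|]. rewrite Rabs_Ropp.
  generalize (Phi_half _ _ _ (iterate_in n) HS (iterate_limit_close n) t).
  generalize (iterate_limit_close (Datatypes.S n) t). simpl pow.
  pose proof (Rabs_pos (iterate n t - iterate_limit t)). lra.
Qed.

End FixedPoint.

(** * Linear differential systems *)

Lemma continuous_R_eps (f : R -> R) (x : R) :
  continuous f x <-> forall eps, 0 < eps -> locally x (fun y => Rabs (f y - f x) < eps).
Proof.
  split.
  - intros H eps He. apply (H (fun y => Rabs (y - f x) < eps)).
    exists (mkposreal eps He). intros y Hy. exact Hy.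
  - intros H P [eps HP]. change (locally x (fun y => P (f y))).
    generalize (H eps (cond_pos eps)). apply filter_imp.
    intros y Hy. apply HP. exact Hy.
Qed.

Definition clamp (a d t : R) : R := Rmax (a - d) (Rmin (a + d) t).

Lemma clamp_in (a d t : R) : 0 < d -> Rabs (clamp a d t - a) <= d.
Proof.
  intros Hd. unfold clamp. apply Rabs_le. unfold Rmax, Rmin.
  repeat destruct Rle_dec; lra.
Qed.

Lemma clamp_id (a d t : R) : Rabs (t - a) <= d -> clamp a d t = t.
Proof.
  intros H. apply Rabs_le_between in H. unfold clamp, Rmax, Rmin.
  repeat destruct Rle_dec; lra.
Qed.

Lemma clamp_lipschitz (a d s t : R) : Rabs (clamp a d s - clamp a d t) <= Rabs (s - t).
Proof.
  unfold clamp, Rmax, Rmin.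
  repeat destruct Rle_dec; unfold Rabs; repeat destruct Rcase_abs; lra.
Qed.

Lemma clamp_continuous (a d t : R) : continuous (clamp a d) t.
Proof.
  apply continuous_R_eps. intros eps He. exists (mkposreal eps He). intros s Hs.
  eapply Rle_lt_trans; [apply clamp_lipschitz | exact Hs].
Qed.

Lemma continuous_ex_RInt (f : R -> R) (a b : R) :
  (forall t, continuous f t) -> ex_RInt f a b.
Proof. intros H. apply (ex_RInt_continuous (V := R_CompleteNormedModule)). auto. Qed.

Lemma RInt_bound (f : R -> R) (a b M : R) :
  (forall t, continuous f t) -> (forall t, Rabs (f t) <= M) ->
  Rabs (RInt f a b) <= Rabs (b - a) * M.
Proof.
  intros Hf HM. destruct (Rle_dec a b) as [H|H].
  - rewrite (Rabs_right (b - a)) by lra.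
    apply abs_RInt_le_const; auto using continuous_ex_RInt.
  - replace (Rabs (b - a)) with (a - b) by (rewrite Rabs_left; lra).
    replace (RInt f a b) with (- RInt f b a).
    + rewrite Rabs_Ropp. apply abs_RInt_le_const; auto using continuous_ex_RInt; lra.
    + exact (opp_RInt_swap f b a (continuous_ex_RInt f b a Hf)).
Qed.

Lemma is_derive_RInt_continuous (f : R -> R) (a t : R) :
  (forall t, continuous f t) -> is_derive (RInt f a) t (f t).
Proof.
  intros Hf. apply (is_derive_RInt (V := R_NormedModule) f (RInt f a) a t); auto.
  apply filter_forall. intros b.
  apply (RInt_correct (V := R_CompleteNormedModule)), continuous_ex_RInt, Hf.
Qed.

Lemma locally_bounded (f : R -> R) (x : R) : continuous f x ->
  locally x (fun y => Rabs (f y) <= Rabs (f x) + 1).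
Proof.
  intros H. generalize (proj1 (continuous_R_eps f x) H 1 Rlt_0_1). apply filter_imp.
  intros y Hy. replace (f y) with (f x + (f y - f x)) by ring.
  eapply Rle_trans; [apply Rabs_triang | lra].
Qed.

(** Local existence for the system [y' = S y] of two equations: the integral
    operator is a contraction on a short interval. The coefficients are clamped
    to that interval, so that sup norms may be taken over the whole line. *)
Lemma linear_system (S : ix -> ix -> R -> R) (y0 : ix -> R) (u0 r : R) :
  0 < r -> (forall i j t, Rabs (t - u0) < r -> continuous (S i j) t) ->
  exists d, 0 < d <= r /\ exists y : ix -> R -> R, (forall i, y i u0 = y0 i) /\
    forall i t, Rabs (t - u0) < d ->
      is_derive (y i) t (S i I1 t * y I1 t + S i I2 t * y I2 t).
Proof.
  intros Hr HS.
  assert (Hbd : exists M d0, 0 < M /\ 0 < d0 /\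
    forall i j t, Rabs (t - u0) < d0 -> Rabs (S i j t) <= M).
  { assert (Hij : forall i j, locally u0 (fun t => Rabs (S i j t) <= Rabs (S i j u0) + 1)).
    { intros i j. apply locally_bounded, HS. rewrite Rminus_diag, Rabs_R0. exact Hr. }
    exists (Rabs (S I1 I1 u0) + Rabs (S I1 I2 u0) + Rabs (S I2 I1 u0) + Rabs (S I2 I2 u0) + 1).
    destruct (filter_and _ _ (filter_and _ _ (Hij I1 I1) (Hij I1 I2))
                (filter_and _ _ (Hij I2 I1) (Hij I2 I2))) as [d0 Hd].
    exists d0. pose proof (Rabs_pos (S I1 I1 u0)). pose proof (Rabs_pos (S I1 I2 u0)).
    pose proof (Rabs_pos (S I2 I1 u0)). pose proof (Rabs_pos (S I2 I2 u0)).
    split; [lra|]. split; [apply cond_pos|].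
    intros i j t Ht. destruct (Hd t Ht) as [[? ?] [? ?]]. destruct i, j; lra. }
  destruct Hbd as (M & d0 & HM & Hd0 & Hb).
  (* [4 M d <= 1] makes the integral operator halve distances *)
  set (d := Rmin (Rmin (r / 2) (d0 / 2)) (/ (4 * M))).
  assert (H4 : 0 < / (4 * M)) by (apply Rinv_0_lt_compat; lra).
  assert (Hd : 0 < d /\ d < r /\ d < d0 /\ d * (4 * M) <= 1).
  { pose proof (Rmin_l (Rmin (r / 2) (d0 / 2)) (/ (4 * M))).
    pose proof (Rmin_r (Rmin (r / 2) (d0 / 2)) (/ (4 * M))).
    pose proof (Rmin_l (r / 2) (d0 / 2)). pose proof (Rmin_r (r / 2) (d0 / 2)).
    fold d in H, H0.
    assert (0 < d) by (unfold d; repeat apply Rmin_pos; lra).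
    repeat split; try lra.
    apply Rmult_le_compat_r with (r := 4 * M) in H0; [|lra].
    rewrite Rinv_l in H0 by lra. exact H0. }
  destruct Hd as (Hd & Hdr & Hdd & HdM).
  exists d. split; [lra|].
  set (A := fun i j t => S i j (clamp u0 d t)).
  assert (HAc : forall i j t, continuous (A i j) t).
  { intros i j t. apply (continuous_comp (clamp u0 d) (S i j)).
    - apply clamp_continuous.
    - apply HS. generalize (clamp_in u0 d t Hd). lra. }
  assert (HAb : forall i j t, Rabs (A i j t) <= M).
  { intros i j t. apply Hb. generalize (clamp_in u0 d t Hd). lra. }
  set (rhs := fun (f : ix * R -> R) i s => A i I1 s * f (I1, s) + A i I2 s * f (I2, s)).
  set (Phi := fun (f : ix * R -> R) (it : ix * R) =>
    y0 (fst it) + RInt (rhs f (fst it)) u0 (clamp u0 d (snd it))).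
  set (Cont := fun f : ix * R -> R => forall i t, continuous (fun s => f (i, s)) t).
  assert (Hrhs : forall f i t, Cont f -> continuous (rhs f i) t).
  { intros f i t Hf. unfold rhs.
    apply (continuous_plus (V := R_NormedModule));
      apply (continuous_mult (K := R_AbsRing)); auto; apply Hf. }
  assert (Hint : forall f it c, Cont f -> (forall t, Rabs (rhs f (fst it) t) <= c) ->
    Rabs (RInt (rhs f (fst it)) u0 (clamp u0 d (snd it))) <= d * c).
  { intros f it c Hf Hc.
    assert (0 <= c) by (eapply Rle_trans; [apply Rabs_pos | apply (Hc 0)]).
    eapply Rle_trans; [apply RInt_bound; auto|].
    apply Rmult_le_compat_r; [auto | apply clamp_in, Hd]. }
  assert (Hrb : forall f i c1 c2 t, (forall s, Rabs (f (I1, s)) <= c1) ->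
    (forall s, Rabs (f (I2, s)) <= c2) -> Rabs (rhs f i t) <= M * c1 + M * c2).
  { intros f i c1 c2 t H1 H2. unfold rhs. eapply Rle_trans; [apply Rabs_triang|].
    rewrite !Rabs_mult.
    apply Rplus_le_compat; apply Rmult_le_compat; auto using Rabs_pos. }
  destruct (contraction_fixed_point (ix * R) Cont Phi (fun it => y0 (fst it))
              (d * (M * Rabs (y0 I1) + M * Rabs (y0 I2)))) as [f [Hf Hfix]].
  - intros i t. apply continuous_const.
  - intros f Hf i t. unfold Phi. simpl.
    apply (continuous_plus (V := R_NormedModule)); [apply continuous_const|].
    apply (continuous_comp (clamp u0 d) (RInt (rhs f i) u0)); [apply clamp_continuous|].
    apply (ex_derive_continuous (K := R_AbsRing) (V := R_NormedModule)).
    eexists. apply is_derive_RInt_continuous. auto.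
  - intros f Hf i t. apply continuous_R_eps. intros eps He.
    destruct (Hf (eps / 3)) as [h [Hh Hc]]; [lra|].
    generalize (proj1 (continuous_R_eps _ t) (Hh i t) (eps / 3) ltac:(lra)).
    apply filter_imp. intros s Hs.
    replace (f (i, s) - f (i, t)) with
      (- (h (i, s) - f (i, s)) + ((h (i, s) - h (i, t)) + (h (i, t) - f (i, t)))) by ring.
    eapply Rle_lt_trans; [apply Rabs_triang|]. rewrite Rabs_Ropp.
    pose proof (Rabs_triang (h (i, s) - h (i, t)) (h (i, t) - f (i, t))).
    pose proof (Hc (i, s)). pose proof (Hc (i, t)). lra.
  - intros f h c Hf Hh Hc [i t]. unfold Phi. simpl.
    assert (0 <= c) by (eapply Rle_trans; [apply Rabs_pos | apply (Hc (i, t))]).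
    set (e := fun it => f it - h it).
    assert (He : Cont e).
    { intros j s. apply (continuous_minus (V := R_NormedModule)); [apply Hf | apply Hh]. }
    replace (y0 i + RInt (rhs f i) u0 (clamp u0 d t)
             - (y0 i + RInt (rhs h i) u0 (clamp u0 d t)))
      with (RInt (rhs e i) u0 (clamp u0 d t)).
    + apply Rle_trans with (d * (M * c + M * c)).
      * apply (Hint e (i, t)); auto. intros s. apply Hrb; intros; apply Hc.
      * nra.
    + transitivity (RInt (fun s => minus (rhs f i s) (rhs h i s)) u0 (clamp u0 d t)).
      * apply RInt_ext. intros s _. unfold rhs, e, minus, plus, opp. simpl. as_R; ring.
      * rewrite (RInt_minus (V := R_CompleteNormedModule) (rhs f i) (rhs h i))
          by (apply continuous_ex_RInt; auto).
        unfold minus, plus, opp. simpl. as_R; ring.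
  - intros it. unfold Phi.
    rewrite Rplus_minus_l.
    apply Hint.
    + intros i t. apply continuous_const.
    + intros t. apply Hrb; intros; apply Rle_refl.
  - exists (fun i t => f (i, t)). split.
    + intros i. rewrite <- Hfix. unfold Phi. simpl.
      rewrite clamp_id by (rewrite Rminus_diag, Rabs_R0; lra).
      rewrite RInt_point. apply Rplus_0_r.
    + intros i t Ht.
      assert (Hloc : locally t (fun s => Rabs (s - u0) < d)).
      { assert (Hp : 0 < d - Rabs (t - u0)) by lra.
        exists (mkposreal _ Hp). intros s Hs. change (Rabs (s - t) < d - Rabs (t - u0)) in Hs.
        replace (s - u0) with ((s - t) + (t - u0)) by ring.
        eapply Rle_lt_trans; [apply Rabs_triang|]. lra. }
      apply (is_derive_ext_loc (fun s => y0 i + RInt (rhs f i) u0 s)).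
      * revert Hloc. apply filter_imp. intros s Hs.
        change (y0 i + RInt (rhs f i) u0 s = f (i, s)). rewrite <- (Hfix (i, s)). unfold Phi. simpl. rewrite clamp_id by lra. reflexivity.
      * replace (S i I1 t * f (I1, t) + S i I2 t * f (I2, t)) with (0 + rhs f i t).
        -- apply (is_derive_plus (V := R_NormedModule)).
           ++ apply (is_derive_const (V := R_NormedModule)).
           ++ apply is_derive_RInt_continuous. auto.
        -- unfold rhs, A. rewrite clamp_id by lra. ring.
Qed.

(** * Squares: connectedness and the Poincare lemma *)

Lemma segment_between (a b t : R) : 0 <= t <= 1 ->
  Rmin a b <= a + t * (b - a) <= Rmax a b.
Proof. intros Ht. unfold Rmin, Rmax. destruct Rle_dec; nra. Qed.

Lemma ball_segment (p a b : plane) (r t : R) :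
  ball p r a -> ball p r b -> 0 <= t <= 1 ->
  ball p r (fst a + t * (fst b - fst a), snd a + t * (snd b - snd a)).
Proof.
  rewrite !ball_plane. simpl. intros [A1 A2] [B1 B2] Ht.
  generalize (segment_between (fst a) (fst b) t Ht) (segment_between (snd a) (snd b) t Ht).
  unfold Rmin, Rmax. apply Rabs_def2 in A1, A2, B1, B2.
  do 2 destruct Rle_dec; split; apply Rabs_def1; lra.
Qed.

(** Balls of the product are squares; along a segment that joins the two open
    sets, the indicator of one of them would be a continuous function with
    values 0 and 1. *)
Lemma ball_connected (p : plane) (r : R) : connected (fun q : plane => ball p r q).
Proof.
  intros A B HA HB Hcov (a & Ha & Aa) (b & Hb & Bb).
  apply NNPP. intros Hno.
  set (gam := fun t => (fst a + clamp (1/2) (1/2) t * (fst b - fst a),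
                        snd a + clamp (1/2) (1/2) t * (snd b - snd a)) : plane).
  assert (Hin : forall t, ball p r (gam t)).
  { intros t. apply ball_segment; auto.
    generalize (clamp_in (1/2) (1/2) t ltac:(lra)). intros H.
    apply Rabs_le_between in H. lra. }
  assert (Hcl : forall t, continuous (clamp (1/2) (1/2)) t) by (intros; apply clamp_continuous).
  assert (Hgc : forall t, continuous gam t).
  { intros t. apply continuous_pair;
      (apply (continuous_plus (V := R_NormedModule)); [apply continuous_const|]);
      apply (continuous_mult (K := R_AbsRing)); auto; apply continuous_const. }
  set (f := fun t => if excluded_middle_informative (A (gam t)) then 0 else 1).
  assert (Hf : continuity f).
  { intros t. apply continuity_pt_filterlim. apply continuous_R_eps. intros eps He.
    assert (L : locally t (fun s => f s = f t)).
    { unfold f. destruct (excluded_middle_informative (A (gam t))) as [Ht|Ht].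
      - assert (L : locally t (fun s => A (gam s))) by exact (Hgc t A (HA _ Ht)).
        revert L. apply filter_imp. intros s Hs.
        destruct excluded_middle_informative; [reflexivity | contradiction].
      - assert (HtB : B (gam t)) by (destruct (Hcov _ (Hin t)); tauto).
        assert (L : locally t (fun s => B (gam s))) by exact (Hgc t B (HB _ HtB)).
        revert L. apply filter_imp. intros s Hs.
        destruct excluded_middle_informative; [|reflexivity].
        exfalso. apply Hno. exists (gam s). auto. }
    revert L. apply filter_imp. intros s ->. rewrite Rminus_diag, Rabs_R0. exact He. }
  assert (G0 : gam 0 = a).
  { unfold gam. replace (clamp (1/2) (1/2) 0) with 0.
    - rewrite !Rmult_0_l, !Rplus_0_r. destruct a; reflexivity.
    - unfold clamp, Rmax, Rmin. repeat destruct Rle_dec; lra. }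
  assert (G1 : gam 1 = b).
  { unfold gam. replace (clamp (1/2) (1/2) 1) with 1.
    - destruct b as [b1 b2]. simpl. f_equal; ring.
    - unfold clamp, Rmax, Rmin. repeat destruct Rle_dec; lra. }
  assert (F0 : f 0 = 0).
  { unfold f. rewrite G0. destruct excluded_middle_informative; [reflexivity | contradiction]. }
  assert (F1 : f 1 = 1).
  { unfold f. rewrite G1. destruct excluded_middle_informative as [H|]; [|reflexivity].
    exfalso. apply Hno. exists b. auto. }
  destruct (IVT_gen f 0 1 (1/2) Hf) as [x [_ Hx]].
  - rewrite F0, F1. unfold Rmin, Rmax. destruct Rle_dec; lra.
  - unfold f in Hx. destruct excluded_middle_informative; lra.
Qed.

Lemma ball_domain (p : plane) (r : R) : Defs.domain (fun q : plane => ball p r q).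
Proof. split; [apply open_ball | apply ball_connected]. Qed.

(** One continuous partial derivative and the existence of the other one give
    differentiability. *)
Lemma continuous_of_partials (D : plane -> Prop) (f : plane -> R) (d : ix -> plane -> R)
    (p : plane) :
  open D -> D p -> (forall i q, D q -> is_dpar i f q (d i q)) ->
  continuous (d I1) p -> continuous f p.
Proof.
  intros HD Hp Hd Hc.
  apply (continuous_ext (fun q : R * R => f (fst q, snd q))).
  { intros [a b]. reflexivity. }
  apply (filterdiff_continuous (K := R_AbsRing)
    (U := prod_NormedModule R_AbsRing R_NormedModule R_NormedModule) (V := R_NormedModule)).
  eexists. destruct p as [p1 p2].
  apply (is_derive_filterdiff (fun a b => f (a, b)) p1 p2
           (fun a b => d I1 (a, b)) (d I2 (p1, p2))).
  - generalize (HD _ Hp). apply filter_imp.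
    intros q Hq. generalize (Hd I1 q Hq). destruct q. exact (fun H => H).
  - exact (Hd I2 _ Hp).
  - revert Hc. apply continuous_ext. intros [a b]. reflexivity.
Qed.

Lemma continuous_line (f : plane -> R) (i : ix) (p : plane) (t : R) :
  continuous f (line i p t) -> continuous (fun s => f (line i p s)) t.
Proof.
  intros H. apply (continuous_comp (line i p) f); [|exact H].
  destruct i; apply continuous_pair; first [apply continuous_id | apply continuous_const].
Qed.

Lemma between_near_endpoint (a b c r : R) : Rmin a b <= c <= Rmax a b -> Rabs (b - a) < r ->
  Rabs (c - a) < r.
Proof.
  intros H Hb. apply Rabs_def2 in Hb. revert H. unfold Rmin, Rmax.
  destruct Rle_dec; intros; apply Rabs_def1; lra.
Qed.

Lemma Rabs_lt_locally (a x r : R) : Rabs (x - a) < r -> locally x (fun y => Rabs (y - a) < r).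
Proof.
  intros H. assert (Hp : 0 < r - Rabs (x - a)) by lra.
  exists (mkposreal _ Hp). intros s Hs. change (Rabs (s - x) < r - Rabs (x - a)) in Hs.
  replace (s - a) with ((s - x) + (x - a)) by ring.
  eapply Rle_lt_trans; [apply Rabs_triang|]. lra.
Qed.

(** The potential is the integral along a horizontal and then a vertical
    segment. Its vertical derivative is immediate; the horizontal one is
    obtained by differentiating under the second integral, where closedness
    turns the integrand into a vertical derivative. *)
Lemma poincare (p : plane) (r : R) (w : ix -> plane -> R) :
  let U := fun q : plane => ball p r q in
  (forall i, smooth U (w i)) ->
  (forall q, U q -> dpar I1 (w I2) q = dpar I2 (w I1) q) ->
  exists u, smooth U u /\ forall i q, U q -> dpar i u q = w i q.
Proof.
  intros U Hw Hclosed.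
  assert (HU : open U) by apply open_ball.
  set (u := fun q : plane => RInt (fun t => w I1 (t, snd p)) (fst p) (fst q)
                     + RInt (fun t => w I2 (fst q, t)) (snd p) (snd q)).
  assert (Hin : forall q s t, U q -> Rmin (fst p) (fst q) <= s <= Rmax (fst p) (fst q) ->
     Rmin (snd p) (snd q) <= t <= Rmax (snd p) (snd q) -> U (s, t)).
  { intros q s t [H1 H2] Hs Ht. apply ball_plane. simpl.
    split; eapply between_near_endpoint; eauto. }
  assert (Hl : forall a b, Rmin a b <= a <= Rmax a b /\ Rmin a b <= b <= Rmax a b).
  { intros a b. unfold Rmin, Rmax. destruct Rle_dec; lra. }
  assert (Hc : forall i q, U q -> continuous (w i) q).
  { intros i q Hq. apply (smooth_cont U); auto. }
  assert (Hvert : forall q, U q -> ex_RInt (fun t => w I2 (fst q, t)) (snd p) (snd q)).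
  { intros q Hq. apply (ex_RInt_continuous (V := R_CompleteNormedModule)).
    intros t Ht. apply (continuous_line (w I2) I2 q t), Hc.
    simpl. apply (Hin q); auto. apply Hl. }
  assert (Hd : forall i q, U q -> is_dpar i u q (w i q)).
  { intros i q Hq. pose proof Hq as [Hq1 Hq2].
    change (Rabs (fst q - fst p) < r) in Hq1. change (Rabs (snd q - snd p) < r) in Hq2.
    destruct i; unfold is_dpar, u; simpl.
    - replace (w I1 q) with (w I1 (fst q, snd p)
        + RInt (fun t => dpar I1 (w I2) (fst q, t)) (snd p) (snd q)).
      + apply (is_derive_plus (V := R_NormedModule)).
        * apply (is_derive_RInt (V := R_NormedModule) (fun t => w I1 (t, snd p)) _ (fst p)).
          -- generalize (Rabs_lt_locally _ _ _ Hq1). apply filter_imp. intros s Hs.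
             apply (RInt_correct (V := R_CompleteNormedModule)).
             apply (ex_RInt_continuous (V := R_CompleteNormedModule)).
             intros t Ht. apply (continuous_line (w I1) I1 (fst q, snd p) t), Hc.
             apply (Hin (s, snd q)); auto; [split; auto | apply Hl].
          -- apply (continuous_line (w I1) I1 (fst q, snd p) (fst q)), Hc.
             apply (Hin q); auto; apply Hl.
        * apply (is_derive_RInt_param (fun x t => w I2 (x, t))).
          -- generalize (Rabs_lt_locally _ _ _ Hq1). apply filter_imp. intros s Hs t Ht.
             assert (Hst : U (s, t)) by (apply (Hin (s, snd q)); auto; [split; auto | apply Hl]).
             exact (is_dpar_ex_dpar I1 _ _ _ (smooth_is_dpar U (w I2) I1 (s, t) (Hw I2) Hst)).
          -- intros t Ht. apply continuity_2d_pt_filterlim.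
             assert (Hst : U (fst q, t)) by (apply (Hin q); auto; apply Hl).
             change (continuous (fun z : plane => dpar I1 (w I2) (fst z, snd z)) (fst q, t)).
             generalize (smooth_cont U _ _ (smooth_dpar U (w I2) I1 (Hw I2)) Hst).
             apply continuous_ext. intros [a b]. reflexivity.
          -- generalize (Rabs_lt_locally _ _ _ Hq1). apply filter_imp. intros s Hs.
             apply (Hvert (s, snd q)). split; auto.
      + assert (E : RInt (fun t => dpar I1 (w I2) (fst q, t)) (snd p) (snd q)
                    = w I1 q - w I1 (fst q, snd p)).
        { transitivity (RInt (Derive (fun t => w I1 (fst q, t))) (snd p) (snd q)).
          - apply RInt_ext. intros t Ht. apply (Hclosed (fst q, t)).
            apply (Hin q); auto; [apply Hl | lra].
          - rewrite RInt_Derive.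
            + rewrite <- surjective_pairing. reflexivity.
            + intros t Ht. assert (Hst : U (fst q, t)) by (apply (Hin q); auto; apply Hl).
              exact (is_dpar_ex_dpar I2 _ _ _
                (smooth_is_dpar U (w I1) I2 (fst q, t) (Hw I1) Hst)).
            + intros t Ht. assert (Hst : U (fst q, t)) by (apply (Hin q); auto; apply Hl).
              exact (continuous_line (dpar I2 (w I1)) I2 q t
                (smooth_cont U _ _ (smooth_dpar U (w I1) I2 (Hw I1)) Hst)). }
        rewrite E. ring.
    - replace (w I2 q) with (0 + w I2 q) by ring.
      apply (is_derive_plus (V := R_NormedModule)); [apply (is_derive_const (V := R_NormedModule))|].
      replace (w I2 q) with (w I2 (line I2 q (coord I2 q))) by (rewrite line_coord; reflexivity).
      apply (is_derive_RInt (V := R_NormedModule) (fun t => w I2 (fst q, t)) _ (snd p)).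
      + generalize (Rabs_lt_locally _ _ _ Hq2). apply filter_imp. intros s Hs.
        apply (RInt_correct (V := R_CompleteNormedModule)), (Hvert (fst q, s)).
        split; auto.
      + apply (continuous_line (w I2) I2 q (snd q)). apply Hc.
        change (snd q) with (coord I2 q). rewrite line_coord. exact Hq. }
  exists u. split.
  - apply (smooth_intro U u w); auto. intros q Hq.
    apply (continuous_of_partials U u w q); auto.
  - intros i q Hq. apply is_dpar_unique. auto.
Qed.

(** * The inverse function theorem in the plane *)

Lemma between_near (a b c p r : R) : Rmin a b <= c <= Rmax a b ->
  Rabs (a - p) < r -> Rabs (b - p) < r -> Rabs (c - p) < r.
Proof.
  intros H Ha Hb. apply Rabs_def2 in Ha, Hb. revert H. unfold Rmin, Rmax.
  destruct Rle_dec; intros; apply Rabs_def1; lra.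
Qed.

Lemma line_lipschitz (p : plane) (r c : R) (f : plane -> R) (i : ix) (q : plane) (t : R) :
  smooth (fun q : plane => ball p r q) f -> (forall q, ball p r q -> Rabs (dpar i f q) <= c) ->
  ball p r q -> ball p r (line i q t) ->
  Rabs (f (line i q t) - f q) <= c * Rabs (t - coord i q).
Proof.
  intros Hf Hb Hq Ht.
  set (U := fun q : plane => ball p r q).
  assert (Hin : forall s, Rmin (coord i q) t <= s <= Rmax (coord i q) t -> U (line i q s)).
  { intros s Hs. destruct Hq, Ht. apply ball_plane. destruct i; split; simpl in *;
      try assumption; eapply between_near; eauto. }
  destruct (MVT_gen (fun s => f (line i q s)) (coord i q) t
              (fun s => dpar i f (line i q s))) as [s [Hs E]].
  - intros s Hs. assert (Hs' : U (line i q s)) by (apply Hin; lra).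
    generalize (smooth_is_dpar U f i _ Hf Hs'). unfold is_dpar. destruct i; exact (fun H => H).
  - intros s Hs. apply continuity_pt_filterlim. apply continuous_line.
    apply (smooth_cont U); auto.
  - rewrite line_coord in E. rewrite E, Rabs_mult.
    apply Rmult_le_compat_r; [apply Rabs_pos | apply Hb, Hin, Hs].
Qed.

Lemma ball_lipschitz (p : plane) (r c : R) (f : plane -> R) (x y : plane) :
  smooth (fun q : plane => ball p r q) f -> (forall i q, ball p r q -> Rabs (dpar i f q) <= c) ->
  ball p r x -> ball p r y ->
  Rabs (f x - f y) <= c * Rabs (fst x - fst y) + c * Rabs (snd x - snd y).
Proof.
  intros Hf Hb Hx Hy.
  assert (Hm : ball p r (fst x, snd y)) by (destruct Hx, Hy; split; assumption).
  replace (f x - f y) with ((f (fst x, snd y) - f y) + (f x - f (fst x, snd y))) by ring.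
  eapply Rle_trans; [apply Rabs_triang|]. apply Rplus_le_compat.
  - apply (line_lipschitz p r c f I1 y (fst x)); auto.
  - generalize (line_lipschitz p r c f I2 (fst x, snd y) (snd x) Hf (Hb I2) Hm).
    replace (line I2 (fst x, snd y) (snd x)) with x by (destruct x; reflexivity). auto.
Qed.

Lemma is_derive_eps (f : R -> R) (t0 l : R) :
  (forall eps, 0 < eps ->
     locally t0 (fun t => Rabs (f t - f t0 - l * (t - t0)) <= eps * Rabs (t - t0))) ->
  is_derive f t0 l.
Proof.
  intros H. split; [apply is_linear_scal_l|].
  intros x Hx. 
  generalize (is_filter_lim_locally_unique (V := AbsRing_NormedModule R_AbsRing) _ _ Hx).
  intros <-.
  intros eps. generalize (H eps (cond_pos eps)). apply filter_imp. intros t Ht.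
  change (Rabs (f t - f t0 - (t - t0) * l) <= eps * Rabs (t - t0)).
  rewrite (Rmult_comm _ l). exact Ht.
Qed.


Definition jacobian (F : plane -> plane) (q : plane) : R :=
  dpar I1 (F1 F) q * dpar I2 (F2 F) q - dpar I2 (F1 F) q * dpar I1 (F2 F) q.

Definition pt (f : ix -> R) : plane := (f I1, f I2).

Section Inverse.

Variables (D : plane -> Prop) (F : plane -> plane) (p : plane).
Hypothesis HD : open D.
Hypothesis HF : smooth2 D F.
Hypothesis Hp : D p.
Hypothesis HJ : jacobian F p <> 0.

(** The inverse of the differential of [F] at [p]. *)
Definition linv (i : ix) (y : plane) : R :=
  match i with
  | I1 => (dpar I2 (F2 F) p * fst y - dpar I2 (F1 F) p * snd y) / jacobian F p
  | I2 => (- dpar I1 (F2 F) p * fst y + dpar I1 (F1 F) p * snd y) / jacobian F p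
  end.

Lemma linv_inj (y y' : plane) : (forall i, linv i y = linv i y') -> y = y'.
Proof.
  intros H. generalize (H I1) (H I2). simpl. intros H1 H2.
  apply (f_equal (fun x => x * jacobian F p)) in H1, H2.
  unfold Rdiv in H1, H2. rewrite !Rmult_assoc, !Rinv_l, !Rmult_1_r in H1, H2 by assumption.
  destruct y as [a b], y' as [a' b']. simpl in *.
  assert (E1 : jacobian F p * (a - a') = 0).
  { transitivity (dpar I1 (F1 F) p * ((dpar I2 (F2 F) p * a - dpar I2 (F1 F) p * b)
        - (dpar I2 (F2 F) p * a' - dpar I2 (F1 F) p * b'))
      + dpar I2 (F1 F) p * ((- dpar I1 (F2 F) p * a + dpar I1 (F1 F) p * b)
        - (- dpar I1 (F2 F) p * a' + dpar I1 (F1 F) p * b'))).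
    - unfold jacobian. ring.
    - rewrite H1, H2. ring. }
  assert (E2 : jacobian F p * (b - b') = 0).
  { transitivity (dpar I1 (F2 F) p * ((dpar I2 (F2 F) p * a - dpar I2 (F1 F) p * b)
        - (dpar I2 (F2 F) p * a' - dpar I2 (F1 F) p * b'))
      + dpar I2 (F2 F) p * ((- dpar I1 (F2 F) p * a + dpar I1 (F1 F) p * b)
        - (- dpar I1 (F2 F) p * a' + dpar I1 (F1 F) p * b'))).
    - unfold jacobian. ring.
    - rewrite H1, H2. ring. }
  apply Rmult_integral in E1, E2. f_equal; apply Rminus_diag_uniq; tauto.
Qed.

(** [x] minus the Newton correction; its differential vanishes at [p]. *)
Definition err (i : ix) (x : plane) : R := coord i x - linv i (F x).

Lemma smooth_F1 : smooth D (F1 F). Proof. apply HF. Qed.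
Lemma smooth_F2 : smooth D (F2 F). Proof. apply HF. Qed.

Lemma err_smooth (i : ix) : smooth D (err i).
Proof.
  unfold err. apply smooth_minus; auto using smooth_coord.
  destruct i; simpl; apply smooth_mult; auto using smooth_const;
    [apply smooth_minus | apply smooth_plus]; auto; apply smooth_mult;
    auto using smooth_const, smooth_F1, smooth_F2.
Qed.

Lemma err_dpar (i k : ix) (q : plane) : D q ->
  dpar k (err i) q = basis i k - linv i (dpar k (F1 F) q, dpar k (F2 F) q).
Proof.
  intros Hq. unfold err. rewrite (dpar_minus D k q Hq) by
    (destruct i; simpl; try apply smooth_mult; try apply smooth_minus; try apply smooth_plus;
     auto using smooth_const, smooth_coord; apply smooth_mult;
     auto using smooth_const, smooth_F1, smooth_F2).
  rewrite dpar_coord. f_equal.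
  pose proof (smooth_is_dpar D _ k q smooth_F1 Hq) as K1.
  pose proof (smooth_is_dpar D _ k q smooth_F2 Hq) as K2.
  apply is_dpar_unique. unfold is_dpar in *.
  destruct i; simpl.
  - apply (is_derive_ext (fun t => / jacobian F p *
      (dpar I2 (F2 F) p * F1 F (line k q t) - dpar I2 (F1 F) p * F2 F (line k q t)))).
    { intros t. unfold F1, F2. as_R. field. exact HJ. }
    evar_last.
    + apply is_derive_scal. apply (is_derive_minus (V := R_NormedModule));
        apply is_derive_scal; eassumption.
    + unfold minus, plus, opp. simpl. as_R. field. exact HJ.
  - apply (is_derive_ext (fun t => / jacobian F p *
      (- dpar I1 (F2 F) p * F1 F (line k q t) + dpar I1 (F1 F) p * F2 F (line k q t)))).
    { intros t. unfold F1, F2. as_R. field. exact HJ. }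
    evar_last.
    + apply is_derive_scal. apply (is_derive_plus (V := R_NormedModule));
        apply is_derive_scal; eassumption.
    + unfold minus, plus, opp. simpl. as_R. field. exact HJ.
Qed.

Lemma err_dpar_p (i k : ix) : dpar k (err i) p = 0.
Proof.
  rewrite err_dpar by exact Hp. unfold jacobian in HJ.
  destruct i, k; simpl; unfold jacobian; field; exact HJ.
Qed.

Lemma small_ball : exists r, 0 < r /\ (forall q, ball p r q -> D q) /\
  forall i k q, ball p r q -> Rabs (dpar k (err i) q) <= 1 / 4.
Proof.
  assert (H : forall i k, locally p (fun q => Rabs (dpar k (err i) q) <= 1 / 4)).
  { intros i k. pose proof (smooth_cont D _ p (smooth_dpar D _ k (err_smooth i)) Hp) as Hc.
    assert (Hq : locally (dpar k (err i) p) (fun y => Rabs y <= 1 / 4)).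
    { rewrite err_dpar_p. exists (mkposreal (1 / 4) ltac:(lra)). intros y Hy.
      change (Rabs (y - 0) < 1 / 4) in Hy. rewrite Rminus_0_r in Hy. lra. }
    exact (Hc _ Hq). }
  destruct (filter_and _ _ (HD p Hp) (filter_and _ _
     (filter_and _ _ (H I1 I1) (H I1 I2)) (filter_and _ _ (H I2 I1) (H I2 I2)))) as [r Hr].
  exists r. split; [apply cond_pos|]. split.
  - intros q Hq. apply Hr, Hq.
  - intros i k q Hq. destruct (Hr q Hq) as (_ & (? & ?) & (? & ?)). destruct i, k; assumption.
Qed.

Section Ball.

Variable r : R.
Hypothesis Hr : 0 < r.
Hypothesis HrD : forall q, ball p r q -> D q.
Hypothesis Hre : forall i k q, ball p r q -> Rabs (dpar k (err i) q) <= 1 / 4.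

Lemma err_half (x y : plane) (c : R) (i : ix) : ball p r x -> ball p r y ->
  Rabs (fst x - fst y) <= c -> Rabs (snd x - snd y) <= c ->
  Rabs (err i x - err i y) <= c / 2.
Proof.
  intros Hx Hy H1 H2.
  generalize (ball_lipschitz p r (1 / 4) (err i) x y
    (smooth_sub D _ _ HrD (err_smooth i)) (fun k q => Hre i k q) Hx Hy). lra.
Qed.

(** A bound for the norm of [linv]; adding 1 makes it positive without a case
    distinction. *)
Definition lnorm : R :=
  (Rabs (dpar I1 (F1 F) p) + Rabs (dpar I2 (F1 F) p) + Rabs (dpar I1 (F2 F) p)
   + Rabs (dpar I2 (F2 F) p)) / Rabs (jacobian F p) + 1.

Lemma lnorm_pos : 0 < lnorm.
Proof.
  unfold lnorm. apply Rplus_le_lt_0_compat; [|lra].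
  apply Rdiv_le_0_compat; [|apply Rabs_pos_lt; exact HJ].
  pose proof (Rabs_pos (dpar I1 (F1 F) p)). pose proof (Rabs_pos (dpar I2 (F1 F) p)).
  pose proof (Rabs_pos (dpar I1 (F2 F) p)). pose proof (Rabs_pos (dpar I2 (F2 F) p)). lra.
Qed.

Lemma linv_bound (i : ix) (y y' : plane) (c : R) :
  Rabs (fst y - fst y') <= c -> Rabs (snd y - snd y') <= c ->
  Rabs (linv i y - linv i y') <= lnorm * c.
Proof.
  intros H1 H2.
  assert (0 <= c) by (eapply Rle_trans; [apply Rabs_pos | exact H1]).
  pose proof (Rabs_pos (dpar I1 (F1 F) p)). pose proof (Rabs_pos (dpar I2 (F1 F) p)).
  pose proof (Rabs_pos (dpar I1 (F2 F) p)). pose proof (Rabs_pos (dpar I2 (F2 F) p)).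
  pose proof (Rabs_pos_lt _ HJ) as HJp.
  assert (main : forall a b, Rabs a + Rabs b <= Rabs (dpar I1 (F1 F) p) + Rabs (dpar I2 (F1 F) p)
     + Rabs (dpar I1 (F2 F) p) + Rabs (dpar I2 (F2 F) p) ->
     Rabs ((a * fst y + b * snd y) / jacobian F p - (a * fst y' + b * snd y') / jacobian F p)
       <= lnorm * c).
  { intros a b Hab.
    replace ((a * fst y + b * snd y) / jacobian F p - (a * fst y' + b * snd y') / jacobian F p)
      with ((a * (fst y - fst y') + b * (snd y - snd y')) / jacobian F p) by (field; exact HJ).
    unfold Rdiv. rewrite Rabs_mult, Rabs_inv.
    apply Rle_trans with (((Rabs a + Rabs b) * c) * / Rabs (jacobian F p)).
    - apply Rmult_le_compat_r; [left; apply Rinv_0_lt_compat; exact HJp|].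
      eapply Rle_trans; [apply Rabs_triang|]. rewrite !Rabs_mult, Rmult_plus_distr_r.
      apply Rplus_le_compat; apply Rmult_le_compat_l; auto using Rabs_pos.
    - unfold lnorm.
      apply Rle_trans with ((Rabs (dpar I1 (F1 F) p) + Rabs (dpar I2 (F1 F) p)
        + Rabs (dpar I1 (F2 F) p) + Rabs (dpar I2 (F2 F) p)) / Rabs (jacobian F p) * c).
      + unfold Rdiv. rewrite Rmult_assoc, (Rmult_comm c), <- Rmult_assoc.
        apply Rmult_le_compat_r; [assumption|].
        apply Rmult_le_compat_r; [left; apply Rinv_0_lt_compat; exact HJp | exact Hab].
      + apply Rmult_le_compat_r; lra. }
  destruct i; unfold linv.
  - generalize (main (dpar I2 (F2 F) p) (- dpar I2 (F1 F) p)).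
    rewrite Rabs_Ropp. intros M. replace (dpar I2 (F2 F) p * fst y - dpar I2 (F1 F) p * snd y)
      with (dpar I2 (F2 F) p * fst y + - dpar I2 (F1 F) p * snd y) by ring.
    replace (dpar I2 (F2 F) p * fst y' - dpar I2 (F1 F) p * snd y')
      with (dpar I2 (F2 F) p * fst y' + - dpar I2 (F1 F) p * snd y') by ring.
    apply M. lra.
  - apply main. rewrite Rabs_Ropp. lra.
Qed.

(** As [err] halves distances, the distance of two points is at most twice that of
    their images under the linear map [linv] composed with [F]. *)
Lemma dist_bound (x y : plane) (c : R) : ball p r x -> ball p r y ->
  Rabs (fst (F x) - fst (F y)) <= c -> Rabs (snd (F x) - snd (F y)) <= c ->
  Rabs (fst x - fst y) <= 2 * lnorm * c /\ Rabs (snd x - snd y) <= 2 * lnorm * c.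
Proof.
  intros Hx Hy H1 H2.
  set (m := Rmax (Rabs (fst x - fst y)) (Rabs (snd x - snd y))).
  assert (M1 : Rabs (fst x - fst y) <= m) by apply Rmax_l.
  assert (M2 : Rabs (snd x - snd y) <= m) by apply Rmax_r.
  assert (E : forall i, Rabs (coord i x - coord i y) <= m / 2 + lnorm * c).
  { intros i. replace (coord i x - coord i y)
      with ((err i x - err i y) + (linv i (F x) - linv i (F y))) by (unfold err; ring).
    eapply Rle_trans; [apply Rabs_triang|].
    apply Rplus_le_compat; [apply err_half | apply linv_bound]; auto. }
  assert (Hm : m <= m / 2 + lnorm * c).
  { unfold m at 1. apply Rmax_lub; [apply (E I1) | apply (E I2)]. }
  lra.
Qed.

Lemma F_inj (x y : plane) : ball p r x -> ball p r y -> F x = F y -> x = y.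
Proof.
  intros Hx Hy E. destruct (dist_bound x y 0 Hx Hy) as [H1 H2];
    try (rewrite E, Rminus_diag, Rabs_R0; apply Rle_refl).
  rewrite Rmult_0_r in H1, H2.
  destruct x, y; simpl in *.
  f_equal; apply Rminus_diag_uniq, Rabs_eq_0; apply Rle_antisym; auto using Rabs_pos.
Qed.

Definition rho : R := r / (4 * lnorm).

Lemma rho_pos : 0 < rho.
Proof. generalize lnorm_pos. intros. apply Rdiv_lt_0_compat; lra. Qed.

(** A preimage of [q] is a fixed point of [x |-> err x + linv q], a contraction
    of the closed ball of radius [r / 2]. *)
Lemma F_onto (q : plane) : ball (F p) rho q -> exists x, ball p r x /\ F x = q.
Proof.
  intros [Hq1 Hq2].
  change (Rabs (fst q - fst (F p)) < rho) in Hq1.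
  change (Rabs (snd q - snd (F p)) < rho) in Hq2.
  set (S := fun f : ix -> R => forall i, Rabs (f i - coord i p) <= r / 2).
  assert (HS : forall f, S f -> ball p r (pt f)).
  { intros f Hf. apply ball_plane. generalize (Hf I1) (Hf I2). simpl. split; lra. }
  assert (Hpp : pt (fun i => coord i p) = p) by (destruct p; reflexivity).
  assert (S0 : S (fun i => coord i p)) by (intros i; rewrite Rminus_diag, Rabs_R0; lra).
  assert (Hlin : forall i, Rabs (linv i q - linv i (F p)) <= r / 4).
  { intros i. replace (r / 4) with (lnorm * rho).
    - apply linv_bound; lra.
    - unfold rho. field. generalize lnorm_pos. lra. }
  set (Phi := fun (f : ix -> R) i => err i (pt f) + linv i q).
  destruct (contraction_fixed_point ix S Phi (fun i => coord i p) (r / 4)) as [f [Hf Hfix]].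
  - exact S0.
  - intros f Hf i. unfold Phi.
    replace (err i (pt f) + linv i q - coord i p)
      with ((err i (pt f) - err i p) + (linv i q - linv i (F p))) by (unfold err; ring).
    eapply Rle_trans; [apply Rabs_triang|].
    assert (Rabs (err i (pt f) - err i p) <= (r / 2) / 2).
    { apply err_half; auto.
      - apply (ball_center p (mkposreal r Hr)).
      - apply (Hf I1).
      - apply (Hf I2). }
    generalize (Hlin i). lra.
  - intros f Hf i. apply Rle_plus_epsilon. intros eps He.
    destruct (Hf eps He) as [h [Hh Hc]].
    replace (f i - coord i p) with ((h i - coord i p) + - (h i - f i)) by ring.
    eapply Rle_trans; [apply Rabs_triang|]. rewrite Rabs_Ropp.
    generalize (Hh i) (Hc i). lra.
  - intros f h c Hf Hh Hc i. unfold Phi.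
    replace (err i (pt f) + linv i q - (err i (pt h) + linv i q))
      with (err i (pt f) - err i (pt h)) by ring.
    apply err_half; auto; apply Hc.
  - intros i. unfold Phi. rewrite Hpp.
    replace (err i p + linv i q - coord i p) with (linv i q - linv i (F p))
      by (unfold err; ring). apply Hlin.
  - exists (pt f). split; [apply HS, Hf|]. apply linv_inj. intros i.
    generalize (Hfix i). unfold Phi, err. destruct i; simpl coord; lra.
Qed.

Definition local_inverse (q : plane) : plane :=
  epsilon (inhabits p) (fun x => ball p r x /\ F x = q).

Lemma local_inverse_spec (q : plane) : ball (F p) rho q ->
  ball p r (local_inverse q) /\ F (local_inverse q) = q.
Proof. intros Hq. apply (epsilon_spec (inhabits p) _ (F_onto q Hq)). Qed.

Lemma local_inverse_lipschitz (q q' : plane) (c : R) :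
  ball (F p) rho q -> ball (F p) rho q' ->
  Rabs (fst q - fst q') <= c -> Rabs (snd q - snd q') <= c ->
  Rabs (fst (local_inverse q) - fst (local_inverse q')) <= 2 * lnorm * c /\
  Rabs (snd (local_inverse q) - snd (local_inverse q')) <= 2 * lnorm * c.
Proof.
  intros Hq Hq' H1 H2.
  destruct (local_inverse_spec q Hq) as [B E]. destruct (local_inverse_spec q' Hq') as [B' E'].
  apply dist_bound; rewrite ?E, ?E'; auto.
Qed.

Lemma local_inverse_continuous (q : plane) : ball (F p) rho q -> continuous local_inverse q.
Proof.
  intros Hq P [eps HP]. pose proof lnorm_pos.
  assert (He : 0 < eps / (4 * lnorm)) by (apply Rdiv_lt_0_compat; [apply cond_pos | lra]).
  assert (L : locally q (fun q' => ball (F p) rho q' /\ ball q (eps / (4 * lnorm)) q')).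
  { apply filter_and; [apply open_ball, Hq|]. exists (mkposreal _ He). auto. }
  change (locally q (fun q' => P (local_inverse q'))).
  revert L. apply filter_imp. intros q' [Hq' [H1 H2]]. apply HP.
  change (Rabs (fst q' - fst q) < eps / (4 * lnorm)) in H1.
  change (Rabs (snd q' - snd q) < eps / (4 * lnorm)) in H2.
  destruct (local_inverse_lipschitz q' q (eps / (4 * lnorm)) Hq' Hq
      (Rlt_le _ _ H1) (Rlt_le _ _ H2)) as [K1 K2].
  replace (2 * lnorm * (eps / (4 * lnorm))) with (eps / 2) in K1, K2 by (field; lra).
  pose proof (cond_pos eps). apply ball_plane. lra.
Qed.

(** [linv] composed with [dF] is the identity minus a matrix with entries at most
    [1 / 4]. *)
Lemma jacobian_nonzero (x : plane) : ball p r x -> jacobian F x <> 0.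
Proof.
  intros Hx E.
  set (e := fun i k => dpar k (err i) x).
  assert (He : forall i k, - (1 / 4) <= e i k <= 1 / 4).
  { intros i k. apply Rabs_le_between, Hre, Hx. }
  assert (Hd : (1 - e I1 I1) * (1 - e I2 I2) - e I1 I2 * e I2 I1
               = jacobian F x / jacobian F p).
  { unfold e. rewrite !err_dpar by auto. unfold basis, linv. simpl.
    unfold jacobian in *. field. exact HJ. }
  rewrite E in Hd. unfold Rdiv in Hd. rewrite Rmult_0_l in Hd.
  generalize (He I1 I1) (He I1 I2) (He I2 I1) (He I2 I2). intros. nra.
Qed.

(** Cramer's rule for the partial derivatives of the inverse. *)
Definition inverse_dpar (k i : ix) (x : plane) : R :=
  match k, i with
  | I1, I1 => dpar I2 (F2 F) x
  | I1, I2 => - dpar I2 (F1 F) x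
  | I2, I1 => - dpar I1 (F2 F) x
  | I2, I2 => dpar I1 (F1 F) x
  end * / jacobian F x.

(** The first order expansion of [F] at [x] is a linear system for the
    increments of the inverse; its errors are [o(|t|)] because the inverse is
    Lipschitz. *)
Lemma local_inverse_dpar (k i : ix) (q : plane) : ball (F p) rho q ->
  is_dpar i (fun q => coord k (local_inverse q)) q (inverse_dpar k i (local_inverse q)).
Proof.
  intros Hq. destruct (local_inverse_spec q Hq) as [Bx Ex].
  set (x := local_inverse q) in *.
  pose proof (jacobian_nonzero x Bx) as HJx.
  pose proof lnorm_pos as HL.
  set (K := (Rabs (dpar I1 (F1 F) x) + Rabs (dpar I2 (F1 F) x) + Rabs (dpar I1 (F2 F) x)
    + Rabs (dpar I2 (F2 F) x)) * (2 * lnorm) / Rabs (jacobian F x) + 1).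
  pose proof (Rabs_pos (dpar I1 (F1 F) x)) as P1. pose proof (Rabs_pos (dpar I2 (F1 F) x)) as P2.
  pose proof (Rabs_pos (dpar I1 (F2 F) x)) as P3. pose proof (Rabs_pos (dpar I2 (F2 F) x)) as P4.
  pose proof (Rabs_pos_lt _ HJx) as HJp.
  assert (HK : 0 < K).
  { unfold K. apply Rplus_le_lt_0_compat; [|lra].
    apply Rdiv_le_0_compat; [|exact HJp]. apply Rmult_le_pos; lra. }
  unfold is_dpar. apply is_derive_eps. intros eps He.
  assert (HeK : 0 < eps / K) by (apply Rdiv_lt_0_compat; lra).
  set (xt := fun t => local_inverse (line i q t)).
  assert (Hct : continuous xt (coord i q)).
  { apply (continuous_comp (line i q) local_inverse).
    - destruct i; apply continuous_pair; first [apply continuous_id | apply continuous_const].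
    - rewrite line_coord. apply local_inverse_continuous, Hq. }
  assert (Hd : forall G, smooth D G -> locally (coord i q) (fun t =>
     Rabs (G (xt t) - G x - (dpar I1 G x * (fst (xt t) - fst x)
        + dpar I2 G x * (snd (xt t) - snd x)))
     <= eps / K * Rmax (Rabs (fst (xt t) - fst x)) (Rabs (snd (xt t) - snd x)))).
  { intros G HG. generalize (Cn_1_differentiable D G x HD (HG 1%nat) (HrD x Bx)
       (mkposreal _ HeK)). intros H. apply locally_2d_locally in H.
    rewrite <- surjective_pairing in H.
    assert (Ex0 : xt (coord i q) = x) by (unfold xt; rewrite line_coord; reflexivity).
    rewrite <- Ex0 in H at 1. generalize (Hct _ H). unfold filtermap.
    apply filter_imp. intros t Ht. simpl in Ht. rewrite <- !surjective_pairing in Ht.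
    exact Ht. }
  assert (L : locally (coord i q) (fun t => ball (F p) rho (line i q t))).
  { apply open_line; [apply open_ball | exact Hq]. }
  generalize (filter_and _ _ L (filter_and _ _ (Hd _ smooth_F1) (Hd _ smooth_F2))).
  apply filter_imp. intros t [Ht [D1 D2]].
  destruct (local_inverse_spec _ Ht) as [Bt Et]. fold (xt t) in Bt, Et.
  set (dt := t - coord i q) in *.
  assert (Hlip : Rabs (fst (xt t) - fst x) <= 2 * lnorm * Rabs dt /\
                 Rabs (snd (xt t) - snd x) <= 2 * lnorm * Rabs dt).
  { apply local_inverse_lipschitz; auto; destruct i; simpl in *; unfold dt;
      rewrite ?Rminus_diag, ?Rabs_R0; auto using Rabs_pos, Rle_refl. }
  destruct Hlip as [Hl1 Hl2].
  assert (Hmax : Rmax (Rabs (fst (xt t) - fst x)) (Rabs (snd (xt t) - snd x))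
                 <= 2 * lnorm * Rabs dt) by (apply Rmax_lub; assumption).
  assert (Q1 : F1 F (xt t) - F1 F x = basis I1 i * dt).
  { unfold F1. rewrite Et, Ex. unfold dt. destruct i; simpl; ring. }
  assert (Q2 : F2 F (xt t) - F2 F x = basis I2 i * dt).
  { unfold F2. rewrite Et, Ex. unfold dt. destruct i; simpl; ring. }
  rewrite Q1 in D1. rewrite Q2 in D2.
  set (o1 := basis I1 i * dt - (dpar I1 (F1 F) x * (fst (xt t) - fst x)
        + dpar I2 (F1 F) x * (snd (xt t) - snd x))) in *.
  set (o2 := basis I2 i * dt - (dpar I1 (F2 F) x * (fst (xt t) - fst x)
        + dpar I2 (F2 F) x * (snd (xt t) - snd x))) in *.
  set (m := eps / K * (2 * lnorm * Rabs dt)).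
  assert (O1 : Rabs o1 <= m).
  { eapply Rle_trans; [exact D1|]. apply Rmult_le_compat_l; lra. }
  assert (O2 : Rabs o2 <= m).
  { eapply Rle_trans; [exact D2|]. apply Rmult_le_compat_l; lra. }
  assert (Hm : 0 <= m) by (eapply Rle_trans; [apply Rabs_pos | exact O1]).
  assert (Hfin : (Rabs (dpar I1 (F1 F) x) + Rabs (dpar I2 (F1 F) x) + Rabs (dpar I1 (F2 F) x)
     + Rabs (dpar I2 (F2 F) x)) * m / Rabs (jacobian F x) <= eps * Rabs dt).
  { unfold m. replace ((Rabs (dpar I1 (F1 F) x) + Rabs (dpar I2 (F1 F) x) + Rabs (dpar I1 (F2 F) x)
     + Rabs (dpar I2 (F2 F) x)) * (eps / K * (2 * lnorm * Rabs dt)) / Rabs (jacobian F x))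
     with (eps / K * Rabs dt * (K - 1)) by (unfold K at 2; field; lra).
    replace (eps * Rabs dt) with (eps / K * Rabs dt * K) by (field; lra).
    apply Rmult_le_compat_l; [|lra]. apply Rmult_le_pos; [lra | apply Rabs_pos]. }
  assert (Hcomb : forall a b, Rabs a + Rabs b <= Rabs (dpar I1 (F1 F) x)
      + Rabs (dpar I2 (F1 F) x) + Rabs (dpar I1 (F2 F) x) + Rabs (dpar I2 (F2 F) x) ->
      Rabs ((a * o1 + b * o2) / jacobian F x) <= eps * Rabs dt).
  { intros a b Hab. eapply Rle_trans; [|exact Hfin].
    unfold Rdiv. rewrite Rabs_mult, Rabs_inv.
    apply Rmult_le_compat_r; [left; apply Rinv_0_lt_compat; exact HJp|].
    eapply Rle_trans; [apply Rabs_triang|]. rewrite !Rabs_mult.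
    apply Rle_trans with ((Rabs a + Rabs b) * m).
    - rewrite Rmult_plus_distr_r.
      apply Rplus_le_compat; apply Rmult_le_compat_l; auto using Rabs_pos.
    - apply Rmult_le_compat_r; auto. }
  change (Rabs (coord k (xt t) - coord k (xt (coord i q)) - inverse_dpar k i x * dt)
    <= eps * Rabs dt).
  replace (xt (coord i q)) with x by (unfold xt; rewrite line_coord; reflexivity).
  unfold jacobian in HJx.
  destruct k.
  - replace (coord I1 (xt t) - coord I1 x - inverse_dpar I1 i x * dt)
      with ((- dpar I2 (F2 F) x * o1 + dpar I2 (F1 F) x * o2) / jacobian F x).
    + apply Hcomb. rewrite Rabs_Ropp. lra.
    + unfold o1, o2, inverse_dpar, jacobian. destruct i; simpl; field; exact HJx.
  - replace (coord I2 (xt t) - coord I2 x - inverse_dpar I2 i x * dt)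
      with ((dpar I1 (F2 F) x * o1 + - dpar I1 (F1 F) x * o2) / jacobian F x).
    + apply Hcomb. rewrite Rabs_Ropp. lra.
    + unfold o1, o2, inverse_dpar, jacobian. destruct i; simpl; field; exact HJx.
Qed.

(** By [inverse_dpar], the derivatives of the inverse are smooth functions of the
    inverse itself, so each class [C^n] is inherited by the next. *)
Lemma local_inverse_smooth : smooth2 (fun q : plane => ball (F p) rho q) local_inverse.
Proof.
  set (U := fun q : plane => ball (F p) rho q).
  set (B := fun q : plane => ball p r q).
  assert (HU : open U) by apply open_ball.
  assert (HB : open B) by apply open_ball.
  assert (main : forall n k, Cn n U (fun q => coord k (local_inverse q))).
  { assert (Hc : forall k q, U q -> continuous (fun q => coord k (local_inverse q)) q).
    { intros k q Hq. apply (continuous_comp local_inverse (coord k)).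
      - apply local_inverse_continuous, Hq.
      - destruct k; [apply continuous_fst | apply continuous_snd]. }
    induction n as [|n IH]; intros k.
    - split; [apply Hc | exact I].
    - apply (Cn_intro n U _ (fun i q => inverse_dpar k i (local_inverse q))); auto.
      + intros i q Hq. apply local_inverse_dpar, Hq.
      + intros i. apply (Cn_comp n B U (inverse_dpar k i)); auto.
        * intros q Hq. apply local_inverse_spec, Hq.
        * assert (S1 : forall j, smooth B (dpar j (F1 F))).
          { intros j. apply (smooth_sub D); auto. apply smooth_dpar, smooth_F1. }
          assert (S2 : forall j, smooth B (dpar j (F2 F))).
          { intros j. apply (smooth_sub D); auto. apply smooth_dpar, smooth_F2. }
          revert n IH. change (forall n, (forall k, Cn n U (fun q => coord k (local_inverse q)))
            -> Cn n B (inverse_dpar k i)). intros n _. revert n. change (smooth B (inverse_dpar k i)).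
          unfold inverse_dpar. apply smooth_mult; auto.
          -- destruct k, i; auto using smooth_opp.
          -- apply smooth_inv; auto; [intros q Hq; apply jacobian_nonzero, Hq|].
             unfold jacobian. apply smooth_minus; auto; apply smooth_mult; auto.
        * exact (IH I1).
        * exact (IH I2). }
  split; intros n; [exact (main n I1) | exact (main n I2)].
Qed.

End Ball.

Theorem inverse_function : exists r (W : plane -> Prop) phi,
  0 < r /\ open W /\ W p /\ (forall x, W x -> D x) /\
  smooth2 (fun q : plane => ball (F p) r q) phi /\
  (forall q, ball (F p) r q -> W (phi q) /\ F (phi q) = q) /\
  (forall x, W x -> ball (F p) r (F x) /\ phi (F x) = x).
Proof.
  destruct small_ball as (r & Hr & HrD & Hre).
  exists (rho r), (fun x => ball p r x /\ ball (F p) (rho r) (F x)), (local_inverse r).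
  assert (Hrho := rho_pos r Hr).
  split; [exact Hrho|]. split; [|split; [|split; [|split; [|split]]]].
  - apply (open_preimage _ (fun q : plane => ball (F p) (rho r) q)); try apply open_ball.
    intros x Hx. apply (smooth2_continuous D); auto.
  - split; [apply (ball_center p (mkposreal r Hr)) | apply (ball_center (F p) (mkposreal _ Hrho))].
  - intros x [Hx _]. auto.
  - apply local_inverse_smooth; auto.
  - intros q Hq. destruct (local_inverse_spec r Hr HrD Hre q Hq) as [H1 H2].
    rewrite H2. auto.
  - intros x [Hx HFx]. split; [exact HFx|].
    destruct (local_inverse_spec r Hr HrD Hre (F x) HFx) as [H1 H2].
    apply (F_inj r HrD Hre); auto.
Qed.

End Inverse.

(** * Linear algebra of Minkowski space *)

Lemma lor_sym (a b : E4) : lor a b = lor b a.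
Proof. unfold lor. ring. Qed.

Lemma lor_plus_l (a b c : E4) : lor (plus a b) c = lor a c + lor b c.
Proof.
  change (lor (plus a b) c) with
    ((x1 a + x1 b) * x1 c + (x2 a + x2 b) * x2 c + (x3 a + x3 b) * x3 c
     - (x4 a + x4 b) * x4 c).
  unfold lor. ring.
Qed.

Lemma lor_scal_l (k : R) (a c : E4) : lor (scal k a) c = k * lor a c.
Proof.
  change (lor (scal k a) c) with
    ((k * x1 a) * x1 c + (k * x2 a) * x2 c + (k * x3 a) * x3 c - (k * x4 a) * x4 c).
  unfold lor. ring.
Qed.

Lemma lor_minus_l (a b c : E4) : lor (minus a b) c = lor a c - lor b c.
Proof.
  change (lor (minus a b) c) with
    ((x1 a + - x1 b) * x1 c + (x2 a + - x2 b) * x2 c + (x3 a + - x3 b) * x3 c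
     - (x4 a + - x4 b) * x4 c).
  unfold lor. ring.
Qed.

Lemma lor_zero_l (c : E4) : lor zero c = 0.
Proof.
  change (lor zero c) with (0 * x1 c + 0 * x2 c + 0 * x3 c - 0 * x4 c). ring.
Qed.

Lemma lor_plus_r (a b c : E4) : lor c (plus a b) = lor c a + lor c b.
Proof. rewrite !(lor_sym c). apply lor_plus_l. Qed.

Lemma lor_scal_r (k : R) (a c : E4) : lor c (scal k a) = k * lor c a.
Proof. rewrite !(lor_sym c). apply lor_scal_l. Qed.

Lemma lor_minus_r (a b c : E4) : lor c (minus a b) = lor c a - lor c b.
Proof. rewrite !(lor_sym c). apply lor_minus_l. Qed.

Lemma lor_zero_r (c : E4) : lor c zero = 0.
Proof. rewrite lor_sym. apply lor_zero_l. Qed.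

Create HintDb lor.
Hint Rewrite lor_plus_l lor_scal_l lor_minus_l lor_zero_l
  lor_plus_r lor_scal_r lor_minus_r lor_zero_r : lor.

Definition det3 (a1 a2 a3 b1 b2 b3 c1 c2 c3 : R) : R :=
  a1 * (b2 * c3 - b3 * c2) - a2 * (b1 * c3 - b3 * c1) + a3 * (b1 * c2 - b2 * c1).

(** Characterized by [lor w (cross a b c) = det (w, a, b, c)]. *)
Definition cross (a b c : E4) : E4 :=
  (det3 (x2 a) (x3 a) (x4 a) (x2 b) (x3 b) (x4 b) (x2 c) (x3 c) (x4 c),
   - det3 (x1 a) (x3 a) (x4 a) (x1 b) (x3 b) (x4 b) (x1 c) (x3 c) (x4 c),
   det3 (x1 a) (x2 a) (x4 a) (x1 b) (x2 b) (x4 b) (x1 c) (x2 c) (x4 c),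
   det3 (x1 a) (x2 a) (x3 a) (x1 b) (x2 b) (x3 b) (x1 c) (x2 c) (x3 c)).

Lemma cross_orth1 (a b c : E4) : lor (cross a b c) a = 0.
Proof. unfold lor, cross, det3, x1, x2, x3, x4. simpl. ring. Qed.
Lemma cross_orth2 (a b c : E4) : lor (cross a b c) b = 0.
Proof. unfold lor, cross, det3, x1, x2, x3, x4. simpl. ring. Qed.
Lemma cross_orth3 (a b c : E4) : lor (cross a b c) c = 0.
Proof. unfold lor, cross, det3, x1, x2, x3, x4. simpl. ring. Qed.

Lemma cross_norm (a b c : E4) : lor (cross a b c) (cross a b c) =
  - det3 (lor a a) (lor a b) (lor a c) (lor a b) (lor b b) (lor b c)
         (lor a c) (lor b c) (lor c c).
Proof. unfold lor, cross, det3, x1, x2, x3, x4. simpl. ring. Qed.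

Definition gram2 (a b : E4) : R := lor a a * lor b b - lor a b * lor a b.

(** The square of the determinant of four vectors is minus their Gram
    determinant. *)
Lemma gram4_det (a b n m : E4) :
  lor n n = 1 -> lor m m = 1 -> lor n m = 0 -> lor a n = 0 -> lor a m = 0 ->
  lor b n = 0 -> lor b m = 0 ->
  lor a (cross b n m) * lor a (cross b n m) = - gram2 a b.
Proof.
  intros Hnn Hmm Hnm Han Ham Hbn Hbm.
  transitivity (-
   (lor a a * det3 (lor b b) (lor b n) (lor b m) (lor b n) (lor n n) (lor n m)
                   (lor b m) (lor n m) (lor m m)
    - lor a b * det3 (lor a b) (lor b n) (lor b m) (lor a n) (lor n n) (lor n m)
                   (lor a m) (lor n m) (lor m m)
    + lor a n * det3 (lor a b) (lor b b) (lor b m) (lor a n) (lor b n) (lor n m)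
                   (lor a m) (lor b m) (lor m m)
    - lor a m * det3 (lor a b) (lor b b) (lor b n) (lor a n) (lor b n) (lor n n)
                   (lor a m) (lor b m) (lor n m))).
  - destruct a as [[[a1 a2] a3] a4], b as [[[b1 b2] b3] b4].
    destruct n as [[[n1 n2] n3] n4], m as [[[m1 m2] m3] m4].
    unfold lor, cross, det3, x1, x2, x3, x4. cbn [fst snd]. ring.
  - rewrite Hnn, Hmm, Hnm, Han, Ham, Hbn, Hbm. unfold gram2, det3. ring.
Qed.

Lemma E4_eq (a b : E4) :
  x1 a = x1 b -> x2 a = x2 b -> x3 a = x3 b -> x4 a = x4 b -> a = b.
Proof.
  destruct a as [[[a1 a2] a3] a4], b as [[[b1 b2] b3] b4]. unfold x1, x2, x3, x4. simpl.
  intros -> -> -> ->. reflexivity.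
Qed.

(** An orthonormal pair completes a nondegenerate plane orthogonal to it. *)
Lemma frame_zero (a b n m w : E4) :
  lor n n = 1 -> lor m m = 1 -> lor n m = 0 -> lor a n = 0 -> lor a m = 0 ->
  lor b n = 0 -> lor b m = 0 -> gram2 a b <> 0 ->
  lor w a = 0 -> lor w b = 0 -> lor w n = 0 -> lor w m = 0 -> w = zero.
Proof.
  intros Hnn Hmm Hnm Han Ham Hbn Hbm Hg Ha Hb Hn Hm.
  (* Cramer's rule: the determinant of the frame times [w] is a combination of
     the four vanishing products *)
  pose proof (gram4_det a b n m Hnn Hmm Hnm Han Ham Hbn Hbm) as Hd.
  assert (Hd0 : lor a (cross b n m) <> 0) by (intros E; rewrite E in Hd; lra).
  assert (key : forall x : E4 -> R, (x = x1 \/ x = x2 \/ x = x3 \/ x = x4) -> x w = 0).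
  { intros x Hx. apply Rmult_eq_reg_l with (lor a (cross b n m)); [|exact Hd0].
    rewrite Rmult_0_r.
    transitivity (lor w a * x (cross b n m) - lor w b * x (cross a n m)
                  + lor w n * x (cross a b m) - lor w m * x (cross a b n)).
    - destruct Hx as [-> | [-> | [-> | -> ]]]; unfold lor, cross, det3,
        x1, x2, x3, x4; cbn [fst snd]; ring.
    - rewrite Ha, Hb, Hn, Hm. ring. }
  apply E4_eq; [rewrite (key x1) | rewrite (key x2) | rewrite (key x3) | rewrite (key x4)];
    auto; reflexivity.
Qed.

Lemma frame_ext (a b n m v w : E4) :
  lor n n = 1 -> lor m m = 1 -> lor n m = 0 -> lor a n = 0 -> lor a m = 0 ->
  lor b n = 0 -> lor b m = 0 -> gram2 a b <> 0 ->
  lor v a = lor w a -> lor v b = lor w b -> lor v n = lor w n -> lor v m = lor w m -> v = w.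
Proof.
  intros Hnn Hmm Hnm Han Ham Hbn Hbm Hg Ha Hb Hn Hm.
  assert (E : minus v w = zero).
  { apply (frame_zero a b n m); auto; rewrite lor_minus_l; lra. }
  apply E4_eq; apply Rminus_diag_uniq;
    [ exact (f_equal x1 E) | exact (f_equal x2 E) | exact (f_equal x3 E) | exact (f_equal x4 E) ].
Qed.

(** * Calculus of vector fields along a surface *)

Section VectorFields.

Variable D : plane -> Prop.
Hypothesis HD : open D.

Lemma smooth4_dvec (w : plane -> E4) (i : ix) : smooth4 D w -> smooth4 D (dvec i w).
Proof. intros (H1 & H2 & H3 & H4). repeat split; apply smooth_dpar; assumption. Qed.

Lemma smooth_lor (v w : plane -> E4) :
  smooth4 D v -> smooth4 D w -> smooth D (fun p => lor (v p) (w p)).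
Proof.
  intros (H1 & H2 & H3 & H4) (K1 & K2 & K3 & K4). unfold lor.
  apply smooth_minus; auto using smooth_mult.
  apply smooth_plus; auto using smooth_mult. apply smooth_plus; auto using smooth_mult.
Qed.

Lemma smooth4_plus (v w : plane -> E4) :
  smooth4 D v -> smooth4 D w -> smooth4 D (fun p => plus (v p) (w p)).
Proof.
  intros (H1 & H2 & H3 & H4) (K1 & K2 & K3 & K4).
  repeat split;
   [exact (smooth_plus D _ _ HD H1 K1) | exact (smooth_plus D _ _ HD H2 K2)
   |exact (smooth_plus D _ _ HD H3 K3) | exact (smooth_plus D _ _ HD H4 K4)].
Qed.

Lemma smooth4_scal (c : plane -> R) (w : plane -> E4) :
  smooth D c -> smooth4 D w -> smooth4 D (fun p => scal (c p) (w p)).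
Proof.
  intros Hc (H1 & H2 & H3 & H4).
  repeat split;
   [exact (smooth_mult D _ _ HD Hc H1) | exact (smooth_mult D _ _ HD Hc H2)
   |exact (smooth_mult D _ _ HD Hc H3) | exact (smooth_mult D _ _ HD Hc H4)].
Qed.

Lemma smooth4_cross (a b c : plane -> E4) :
  smooth4 D a -> smooth4 D b -> smooth4 D c -> smooth4 D (fun p => cross (a p) (b p) (c p)).
Proof.
  intros (A1 & A2 & A3 & A4) (B1 & B2 & B3 & B4) (C1 & C2 & C3 & C4).
  repeat split; unfold cross, det3; simpl; try apply smooth_opp; auto;
    (apply smooth_plus; [auto| |]; [apply smooth_minus; auto|]; auto;
     apply smooth_mult; auto; apply smooth_minus; auto; apply smooth_mult; auto).
Qed.

Lemma dvec_ext (v w : plane -> E4) (i : ix) (p : plane) : D p ->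
  (forall q, D q -> v q = w q) -> dvec i v p = dvec i w p.
Proof.
  intros Hp E. apply E4_eq; apply (dpar_ext i D); auto; intros q Hq; rewrite (E q Hq); reflexivity.
Qed.

Lemma dpar_lor (v w : plane -> E4) (i : ix) (p : plane) : D p ->
  smooth4 D v -> smooth4 D w ->
  dpar i (fun q => lor (v q) (w q)) p = lor (dvec i v p) (w p) + lor (v p) (dvec i w p).
Proof.
  intros Hp (H1 & H2 & H3 & H4) (K1 & K2 & K3 & K4). unfold lor.
  rewrite (dpar_minus D), !(dpar_plus D), !(dpar_mult D); auto using smooth_mult, smooth_plus.
  unfold dvec, x1, x2, x3, x4. simpl. ring.
Qed.

Lemma dvec_scal (c : plane -> R) (w : plane -> E4) (i : ix) (p : plane) : D p ->
  smooth D c -> smooth4 D w ->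
  dvec i (fun q => scal (c q) (w q)) p
    = plus (scal (dpar i c p) (w p)) (scal (c p) (dvec i w p)).
Proof.
  intros Hp Hc (H1 & H2 & H3 & H4).
  apply E4_eq;
  [ exact (dpar_mult D i p Hp c _ Hc H1) | exact (dpar_mult D i p Hp c _ Hc H2)
  | exact (dpar_mult D i p Hp c _ Hc H3) | exact (dpar_mult D i p Hp c _ Hc H4) ].
Qed.

Lemma dvec_plus (v w : plane -> E4) (i : ix) (p : plane) : D p ->
  smooth4 D v -> smooth4 D w ->
  dvec i (fun q => plus (v q) (w q)) p = plus (dvec i v p) (dvec i w p).
Proof.
  intros Hp (H1 & H2 & H3 & H4) (K1 & K2 & K3 & K4).
  apply E4_eq;
  [ exact (dpar_plus D i p Hp _ _ H1 K1) | exact (dpar_plus D i p Hp _ _ H2 K2)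
  | exact (dpar_plus D i p Hp _ _ H3 K3) | exact (dpar_plus D i p Hp _ _ H4 K4) ].
Qed.

Lemma dvec_swap (w : plane -> E4) (i j : ix) (p : plane) : D p -> smooth4 D w ->
  dvec i (dvec j w) p = dvec j (dvec i w) p.
Proof.
  intros Hp (H1 & H2 & H3 & H4).
  apply E4_eq; apply (dpar_swap D); assumption.
Qed.

Lemma lor_const_dpar (v w : plane -> E4) (c : R) (i : ix) (p : plane) : D p ->
  smooth4 D v -> smooth4 D w -> (forall q, D q -> lor (v q) (w q) = c) ->
  lor (dvec i v p) (w p) = - lor (v p) (dvec i w p).
Proof.
  intros Hp Hv Hw Hc.
  pose proof (dpar_lor v w i p Hp Hv Hw) as E.
  rewrite (dpar_ext i D _ (fun _ => c)) in E by auto.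
  rewrite dpar_const in E. lra.
Qed.

End VectorFields.

Lemma smooth4_sub (D D' : plane -> Prop) (w : plane -> E4) :
  (forall p, D' p -> D p) -> smooth4 D w -> smooth4 D' w.
Proof. intros S (H1 & H2 & H3 & H4). repeat split; apply (smooth_sub D); assumption. Qed.

Lemma smooth4_comp (D U : plane -> Prop) (w : plane -> E4) (phi : plane -> plane) :
  open D -> open U -> (forall q, U q -> D (phi q)) -> smooth4 D w -> smooth2 U phi ->
  smooth4 U (fun q => w (phi q)).
Proof.
  intros HD HU HS (H1 & H2 & H3 & H4) Hphi.
  repeat split;
  [ exact (smooth_comp D U _ phi HD HU HS H1 Hphi)
  | exact (smooth_comp D U _ phi HD HU HS H2 Hphi)
  | exact (smooth_comp D U _ phi HD HU HS H3 Hphi)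
  | exact (smooth_comp D U _ phi HD HU HS H4 Hphi) ].
Qed.

Lemma dvec_comp (D U : plane -> Prop) (w : plane -> E4) (phi : plane -> plane)
    (i : ix) (p : plane) :
  open D -> smooth4 D w -> smooth2 U phi -> U p -> D (phi p) ->
  dvec i (fun q => w (phi q)) p =
    plus (scal (dpar i (F1 phi) p) (dvec I1 w (phi p)))
         (scal (dpar i (F2 phi) p) (dvec I2 w (phi p))).
Proof.
  intros HD (H1 & H2 & H3 & H4) Hphi Hp Hq.
  assert (E : forall f, smooth D f -> dpar i (fun q => f (phi q)) p =
    dpar i (F1 phi) p * dpar I1 f (phi p) + dpar i (F2 phi) p * dpar I2 f (phi p)).
  { intros f Hf. rewrite (dpar_comp D U f phi i p HD Hf Hphi Hp Hq).
    rewrite (Rmult_comm (dpar i (F1 phi) p)), (Rmult_comm (dpar i (F2 phi) p)). reflexivity. }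
  apply E4_eq; [ exact (E _ H1) | exact (E _ H2) | exact (E _ H3) | exact (E _ H4) ].
Qed.

(** * Second fundamental forms *)

Definition sff (z n : plane -> E4) (i j : ix) (p : plane) : R :=
  lor (dvec i (dvec j z) p) (n p).

Lemma tangent_lor (z : plane -> E4) (p : plane) (a : ix -> R) (w : E4) :
  lor (tangent z p a) w = a I1 * lor (dvec I1 z p) w + a I2 * lor (dvec I2 z p) w.
Proof. unfold tangent, sum_ix. autorewrite with lor. reflexivity. Qed.

Lemma g_sym (z : plane -> E4) (i j : ix) (p : plane) : g z i j p = g z j i p.
Proof. apply lor_sym. Qed.

Lemma detg_gram2 (z : plane -> E4) (p : plane) :
  gram2 (dvec I1 z p) (dvec I2 z p) = detg z p.
Proof. unfold detg. rewrite (g_sym z I2 I1). reflexivity. Qed.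

(** A change of basis multiplies the determinant of the metric by a square. *)
Lemma detg_neg (z : plane -> E4) (p : plane) : lorentzian_at z p -> detg z p < 0.
Proof.
  intros (a & b & Ha & Hb & Hab).
  assert (E : forall a b, metric z p a b = a I1 * b I1 * g z I1 I1 p
     + (a I1 * b I2 + a I2 * b I1) * g z I1 I2 p + a I2 * b I2 * g z I2 I2 p).
  { intros a' b'. unfold metric. rewrite tangent_lor.
    rewrite !(lor_sym _ (tangent z p b')), !tangent_lor.
    fold (g z I1 I1 p) (g z I2 I1 p) (g z I1 I2 p) (g z I2 I2 p).
    rewrite (g_sym z I2 I1). ring. }
  assert (H : metric z p a a * metric z p b b - metric z p a b * metric z p a b
              = detg z p * (a I1 * b I2 - a I2 * b I1) ^ 2).
  { rewrite !E. unfold detg. rewrite (g_sym z I2 I1). ring. }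
  rewrite Ha, Hb, Hab in H.
  assert (0 <= (a I1 * b I2 - a I2 * b I1) ^ 2) by apply pow2_ge_0. nra.
Qed.

Section Pointwise.

Variables (z : plane -> E4) (p : plane).
Hypothesis Hdet : detg z p <> 0.

Lemma tangential_part_dvec (w : E4) (k : ix) :
  lor (tangential_part z p w) (dvec k z p) = lor w (dvec k z p).
Proof.
  unfold tangential_part, sum_ix. autorewrite with lor.
  fold (g z I1 k p) (g z I2 k p). unfold ginv.
  destruct k; unfold detg in *; rewrite ?(g_sym z I2 I1) in *; field; exact Hdet.
Qed.

Lemma normal_part_dvec (w : E4) (k : ix) : lor (normal_part z p w) (dvec k z p) = 0.
Proof. unfold normal_part. rewrite lor_minus_l, tangential_part_dvec. ring. Qed.

Lemma normal_part_normal (w n : E4) :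
  (forall k, lor (dvec k z p) n = 0) -> lor (normal_part z p w) n = lor w n.
Proof.
  intros Hn. unfold normal_part, tangential_part, sum_ix. autorewrite with lor.
  rewrite !Hn. ring.
Qed.

Lemma sigma_dvec (a b : ix -> R) (k : ix) : lor (sigma z p a b) (dvec k z p) = 0.
Proof. apply normal_part_dvec. Qed.

Lemma sigma_normal (n : plane -> E4) (a b : ix -> R) :
  (forall k, lor (dvec k z p) (n p) = 0) ->
  lor (sigma z p a b) (n p) =
    a I1 * b I1 * sff z n I1 I1 p + a I1 * b I2 * sff z n I1 I2 p
    + a I2 * b I1 * sff z n I2 I1 p + a I2 * b I2 * sff z n I2 I2 p.
Proof.
  intros Hn. unfold sigma. rewrite normal_part_normal by exact Hn.
  unfold sum_ix. autorewrite with lor. unfold sff. ring.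
Qed.

Lemma mean_curvature_dvec (k : ix) : lor (mean_curvature z p) (dvec k z p) = 0.
Proof.
  unfold mean_curvature, sum_ix. autorewrite with lor. rewrite !sigma_dvec. ring.
Qed.

Lemma mean_curvature_normal (n : plane -> E4) :
  (forall k, lor (dvec k z p) (n p) = 0) ->
  lor (mean_curvature z p) (n p) =
    1 / 2 * (ginv z I1 I1 p * sff z n I1 I1 p + ginv z I1 I2 p * sff z n I1 I2 p
      + ginv z I2 I1 p * sff z n I2 I1 p + ginv z I2 I2 p * sff z n I2 I2 p).
Proof.
  intros Hn. unfold mean_curvature, sum_ix. autorewrite with lor.
  rewrite !(sigma_normal n) by exact Hn. unfold basis. ring.
Qed.

End Pointwise.

(** * A timelike surface with an orthonormal normal frame *)

Record normal_frame (D : plane -> Prop) (z n m : plane -> E4) : Prop := {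
  nf_open : open D;
  nf_z : smooth4 D z;
  nf_det : forall p, D p -> detg z p <> 0;
  nf_n : smooth4 D n;
  nf_m : smooth4 D m;
  nf_zn : forall p k, D p -> lor (dvec k z p) (n p) = 0;
  nf_zm : forall p k, D p -> lor (dvec k z p) (m p) = 0;
  nf_nn : forall p, D p -> lor (n p) (n p) = 1;
  nf_mm : forall p, D p -> lor (m p) (m p) = 1;
  nf_nm : forall p, D p -> lor (n p) (m p) = 0 }.

Lemma normal_frame_sub (D D' : plane -> Prop) (z n m : plane -> E4) :
  open D' -> (forall p, D' p -> D p) -> normal_frame D z n m -> normal_frame D' z n m.
Proof.
  intros HD' S [].
  constructor; auto; apply (smooth4_sub D); assumption.
Qed.

Section Frame.

Variables (D : plane -> Prop) (z n m : plane -> E4).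
Hypothesis HF : normal_frame D z n m.

Let HD := nf_open _ _ _ _ HF.
Let Hz := nf_z _ _ _ _ HF.
Let Hdet := nf_det _ _ _ _ HF.
Let Hn := nf_n _ _ _ _ HF.
Let Hm := nf_m _ _ _ _ HF.
Let Hzn := nf_zn _ _ _ _ HF.
Let Hzm := nf_zm _ _ _ _ HF.
Let Hnn := nf_nn _ _ _ _ HF.
Let Hmm := nf_mm _ _ _ _ HF.
Let Hnm := nf_nm _ _ _ _ HF.

Lemma surface_frame_ext (p : plane) (v w : E4) : D p ->
  (forall k, lor v (dvec k z p) = lor w (dvec k z p)) ->
  lor v (n p) = lor w (n p) -> lor v (m p) = lor w (m p) -> v = w.
Proof.
  intros Hp Ht H1 H2. apply (frame_ext (dvec I1 z p) (dvec I2 z p) (n p) (m p)); auto.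
  rewrite detg_gram2. auto.
Qed.

Lemma sff_sym (N : plane -> E4) (i j : ix) (p : plane) : D p -> sff z N i j p = sff z N j i p.
Proof. intros Hp. unfold sff. rewrite (dvec_swap D HD); auto. Qed.

Lemma sff_dvec (N : plane -> E4) (i j : ix) (p : plane) : D p -> smooth4 D N ->
  (forall p k, D p -> lor (dvec k z p) (N p) = 0) ->
  lor (dvec i N p) (dvec j z p) = - sff z N i j p.
Proof.
  intros Hp HN Ht. unfold sff. rewrite (lor_sym (dvec i N p)).
  rewrite (lor_const_dpar D HD (dvec j z) N 0 i p); auto using smooth4_dvec. ring.
Qed.

Lemma unit_dvec (N : plane -> E4) (i : ix) (p : plane) : D p -> smooth4 D N ->
  (forall p, D p -> lor (N p) (N p) = 1) -> lor (dvec i N p) (N p) = 0.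
Proof.
  intros Hp HN Hu. pose proof (lor_const_dpar D HD N N 1 i p Hp HN HN Hu) as E.
  rewrite (lor_sym (N p)) in E. lra.
Qed.

Lemma tangent_decomposition (p : plane) (v : E4) : D p ->
  lor v (n p) = 0 -> lor v (m p) = 0 -> v = tangential_part z p v.
Proof.
  intros Hp H1 H2. apply (surface_frame_ext p); auto.
  - intros k. rewrite tangential_part_dvec; auto.
  - rewrite H1. unfold tangential_part, sum_ix. autorewrite with lor.
    rewrite !Hzn by assumption. ring.
  - rewrite H2. unfold tangential_part, sum_ix. autorewrite with lor.
    rewrite !Hzm by assumption. ring.
Qed.

Lemma lor_tangent (p : plane) (v w : E4) : D p ->
  lor v (n p) = 0 -> lor v (m p) = 0 ->
  detg z p * lor v w =
    g z I2 I2 p * (lor v (dvec I1 z p) * lor w (dvec I1 z p))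
    - g z I1 I2 p * (lor v (dvec I1 z p) * lor w (dvec I2 z p)
                     + lor v (dvec I2 z p) * lor w (dvec I1 z p))
    + g z I1 I1 p * (lor v (dvec I2 z p) * lor w (dvec I2 z p)).
Proof.
  intros Hp H1 H2. rewrite (tangent_decomposition p v) at 1 by assumption.
  unfold tangential_part, sum_ix. autorewrite with lor. unfold ginv.
  rewrite !(lor_sym (dvec _ z p) w). field. auto.
Qed.

Lemma sigma_eq (p : plane) (a b : ix -> R) (cn cm : R) : D p ->
  lor (sigma z p a b) (n p) = cn -> lor (sigma z p a b) (m p) = cm ->
  sigma z p a b = plus (scal cn (n p)) (scal cm (m p)).
Proof.
  intros Hp H1 H2. apply (surface_frame_ext p _ _ Hp).
  - intros k. rewrite sigma_dvec by auto. autorewrite with lor.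
    rewrite !(lor_sym _ (dvec k z p)), Hzn, Hzm by assumption. ring.
  - rewrite H1. autorewrite with lor. rewrite Hnn, (lor_sym (m p)), Hnm by assumption. ring.
  - rewrite H2. autorewrite with lor. rewrite Hmm, Hnm by assumption. ring.
Qed.

(** ** The Gauss equation *)

Lemma smooth_g (i j : ix) : smooth D (g z i j).
Proof. apply smooth_lor; auto using smooth4_dvec. Qed.

Lemma dpar_g (i j k : ix) (p : plane) : D p ->
  dpar k (g z i j) p = lor (dvec k (dvec i z) p) (dvec j z p)
                       + lor (dvec k (dvec j z) p) (dvec i z p).
Proof.
  intros Hp. unfold g at 1.
  rewrite (dpar_lor D HD _ _ k p Hp); auto using smooth4_dvec.
  rewrite (lor_sym (dvec i z p)). reflexivity.
Qed.

Lemma christoffel_eq (k i j : ix) (p : plane) : D p ->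
  christoffel z k i j p =
    ginv z k I1 p * lor (dvec i (dvec j z) p) (dvec I1 z p)
    + ginv z k I2 p * lor (dvec i (dvec j z) p) (dvec I2 z p).
Proof.
  intros Hp. unfold christoffel, sum_ix, plus. simpl.
  rewrite !dpar_g by assumption.
  assert (S : forall l, lor (dvec i (dvec l z) p) (dvec j z p)
                        = lor (dvec l (dvec i z) p) (dvec j z p)).
  { intros l. rewrite (dvec_swap D HD z i l); auto. }
  assert (S' : forall l, lor (dvec j (dvec l z) p) (dvec i z p)
                        = lor (dvec l (dvec j z) p) (dvec i z p)).
  { intros l. rewrite (dvec_swap D HD z j l); auto. }
  rewrite !S, !S', (dvec_swap D HD z j i p Hp Hz). field.
Qed.

Lemma christoffel_lower (l i j : ix) (p : plane) : D p ->
  g z l I1 p * christoffel z I1 i j p + g z l I2 p * christoffel z I2 i j p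
  = lor (dvec i (dvec j z) p) (dvec l z p).
Proof.
  intros Hp. rewrite !christoffel_eq by assumption. unfold ginv.
  generalize (Hdet p Hp). unfold detg.
  destruct l; rewrite ?(g_sym z I2 I1); intros; field; assumption.
Qed.

Lemma smooth_ginv (i j : ix) : smooth D (ginv z i j).
Proof.
  assert (Hd : smooth D (detg z)).
  { unfold detg. apply smooth_minus; auto; apply smooth_mult; auto using smooth_g. }
  destruct i, j; unfold ginv; apply smooth_div; auto using smooth_g, smooth_opp.
Qed.

Lemma smooth_christoffel (k i j : ix) : smooth D (christoffel z k i j).
Proof.
  eapply smooth_ext; [exact HD| intros q Hq; symmetry; apply christoffel_eq, Hq |].
  apply smooth_plus; auto; apply smooth_mult; auto using smooth_ginv;
    apply smooth_lor; auto using smooth4_dvec.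
Qed.

Lemma second_derivative_decomposition (i j : ix) (p : plane) (w : E4) : D p ->
  lor (dvec i (dvec j z) p) w =
    christoffel z I1 i j p * lor (dvec I1 z p) w + christoffel z I2 i j p * lor (dvec I2 z p) w
    + sff z n i j p * lor (n p) w + sff z m i j p * lor (m p) w.
Proof.
  intros Hp.
  replace (dvec i (dvec j z) p) with
    (plus (plus (scal (christoffel z I1 i j p) (dvec I1 z p))
                (scal (christoffel z I2 i j p) (dvec I2 z p)))
          (plus (scal (sff z n i j p) (n p)) (scal (sff z m i j p) (m p)))).
  { autorewrite with lor. ring. }
  symmetry. apply (surface_frame_ext p _ _ Hp).
  - intros k. rewrite <- (christoffel_lower k i j p Hp). autorewrite with lor.
    rewrite !(lor_sym _ (dvec k z p)), Hzn, Hzm by assumption. unfold g. ring.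
  - autorewrite with lor. rewrite !Hzn, Hnn, (lor_sym (m p)), Hnm by assumption.
    unfold sff. ring.
  - autorewrite with lor. rewrite !Hzm, Hmm, Hnm by assumption. unfold sff. ring.
Qed.

(** Differentiating [christoffel_lower], the third derivatives of [z] cancel by
    symmetry, and what remains is the difference of the products of second
    derivatives, less that of their tangential parts. *)
Lemma gauss_equation (p : plane) : D p ->
  gauss_curvature z p * detg z p =
    sff z n I1 I1 p * sff z n I2 I2 p - sff z n I1 I2 p * sff z n I1 I2 p
    + (sff z m I1 I1 p * sff z m I2 I2 p - sff z m I1 I2 p * sff z m I1 I2 p).
Proof.
  intros Hp.
  assert (L : forall i j k, dpar k (g z I1 I1) p * christoffel z I1 i j p
      + g z I1 I1 p * dpar k (christoffel z I1 i j) p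
      + (dpar k (g z I1 I2) p * christoffel z I2 i j p
         + g z I1 I2 p * dpar k (christoffel z I2 i j) p)
    = lor (dvec k (dvec i (dvec j z)) p) (dvec I1 z p)
      + lor (dvec i (dvec j z) p) (dvec k (dvec I1 z) p)).
  { intros i j k. rewrite <- (dpar_lor D HD _ _ k p Hp); auto using smooth4_dvec.
    rewrite <- !(dpar_mult D k p Hp); auto using smooth_g, smooth_christoffel.
    rewrite <- (dpar_plus D k p Hp); auto using smooth_g, smooth_christoffel, smooth_mult.
    apply (dpar_ext k D); auto. intros q Hq. apply (christoffel_lower I1 i j q Hq). }
  pose proof (L I2 I2 I1) as L1. pose proof (L I1 I2 I2) as L2.
  rewrite (dvec_swap D HD (dvec I2 z) I2 I1) in L2; auto using smooth4_dvec.
  rewrite !dpar_g in L1, L2 by assumption.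
  unfold gauss_curvature. unfold Rdiv. rewrite Rmult_assoc, Rinv_l, Rmult_1_r by auto.
  unfold riemann_122, sum_ix, plus. simpl.
  pose proof (christoffel_lower I1 I1 I1 p Hp) as C11.
  pose proof (christoffel_lower I1 I1 I2 p Hp) as C12.
  pose proof (christoffel_lower I1 I2 I1 p Hp) as C21.
  pose proof (christoffel_lower I1 I2 I2 p Hp) as C22.
  pose proof (second_derivative_decomposition I2 I2 p (dvec I1 (dvec I1 z) p) Hp) as E1.
  pose proof (second_derivative_decomposition I1 I2 p (dvec I1 (dvec I2 z) p) Hp) as E2.
  rewrite (dvec_swap D HD z I2 I1 p Hp Hz) in *.
  rewrite (lor_sym (n p)), (lor_sym (m p)) in E1, E2.
  rewrite !(lor_sym (dvec _ z p)) in E1, E2.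
  fold (sff z n I1 I1 p) (sff z m I1 I1 p) in E1.
  fold (sff z n I1 I2 p) (sff z m I1 I2 p) in E2.
  rewrite E1 in L1. rewrite E2 in L2.
  apply (f_equal (Rmult (christoffel z I1 I2 I2 p))) in C11.
  apply (f_equal (Rmult (christoffel z I2 I2 I2 p))) in C12.
  apply (f_equal (Rmult (christoffel z I1 I1 I2 p))) in C21.
  apply (f_equal (Rmult (christoffel z I2 I1 I2 p))) in C22.
  lra.
Qed.

(** ** The Ricci equation *)

Section Parallel.

Hypothesis Hpar : forall p i, D p -> lor (dvec i n p) (m p) = 0.

Lemma m_dvec_n (i : ix) (p : plane) : D p -> lor (dvec i m p) (n p) = 0.
Proof.
  intros Hp. pose proof (lor_const_dpar D HD n m 0 i p Hp Hn Hm Hnm) as E.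
  rewrite Hpar in E by exact Hp. rewrite lor_sym. lra.
Qed.

(** As [n] is parallel, [dn] and [dm] are tangent, and the symmetry of the second
    derivatives of [n], tested against [m], says that the two shape operators
    commute. *)
Lemma ricci_equation (p : plane) : D p ->
  g z I2 I2 p * (sff z n I1 I2 p * sff z m I1 I1 p - sff z n I1 I1 p * sff z m I1 I2 p)
  - g z I1 I2 p * (sff z n I2 I2 p * sff z m I1 I1 p - sff z n I1 I1 p * sff z m I2 I2 p)
  + g z I1 I1 p * (sff z n I2 I2 p * sff z m I1 I2 p - sff z n I1 I2 p * sff z m I2 I2 p) = 0.
Proof.
  intros Hp.
  assert (E : lor (dvec I2 n p) (dvec I1 m p) = lor (dvec I1 n p) (dvec I2 m p)).
  { assert (A : forall i j, lor (dvec i (dvec j n) p) (m p) = - lor (dvec j n p) (dvec i m p)).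
    { intros i j. apply (lor_const_dpar D HD (dvec j n) m 0); auto using smooth4_dvec. }
    pose proof (A I1 I2) as A1. pose proof (A I2 I1) as A2.
    rewrite (dvec_swap D HD n I1 I2) in A1 by auto. lra. }
  assert (T : forall i j, detg z p * lor (dvec i n p) (dvec j m p) =
     g z I2 I2 p * (sff z n i I1 p * sff z m j I1 p)
     - g z I1 I2 p * (sff z n i I1 p * sff z m j I2 p + sff z n i I2 p * sff z m j I1 p)
     + g z I1 I1 p * (sff z n i I2 p * sff z m j I2 p)).
  { intros i j. rewrite (lor_tangent p); auto using unit_dvec.
    rewrite !sff_dvec; auto. ring. }
  pose proof (T I2 I1) as T1. pose proof (T I1 I2) as T2.
  rewrite E in T1.
  rewrite (sff_sym n I2 I1 p Hp) in T1. rewrite (sff_sym m I2 I1 p Hp) in T2. lra.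
Qed.

End Parallel.

End Frame.

(** The third hypothesis, the commutation of the shape operators of [h] and [k],
    is the vanishing of the determinant of the three triples [g], [h], [k]; and
    the first two triples are independent, as only the second is trace free. *)
Lemma commuting_forms (g11 g12 g22 h11 h12 h22 k11 k12 k22 : R) :
  g11 * g22 - g12 * g12 <> 0 ->
  g22 * h11 - 2 * g12 * h12 + g11 * h22 = 0 ->
  g22 * (k12 * h11 - k11 * h12) - g12 * (k22 * h11 - k11 * h22)
    + g11 * (k22 * h12 - k12 * h22) = 0 ->
  ~ (h11 = 0 /\ h12 = 0 /\ h22 = 0) ->
  exists nu c, k11 = nu * g11 + c * h11 /\ k12 = nu * g12 + c * h12 /\
    k22 = nu * g22 + c * h22.
Proof.
  intros Hd Ht Hr Hh.
  set (d := g11 * g22 - g12 * g12) in *.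
  set (nu := (g22 * k11 - 2 * g12 * k12 + g11 * k22) / (2 * d)).
  (* the trace free part [b] of [k], which must be a multiple of [h]: the cross
     product of the triples [h] and [b] is orthogonal to [g], but it is also a
     multiple of the triple [(g22, - 2 g12, g11)], whose product with [g] is
     [2 d] *)
  set (b11 := k11 - nu * g11). set (b12 := k12 - nu * g12). set (b22 := k22 - nu * g22).
  assert (Hb : g22 * b11 - 2 * g12 * b12 + g11 * b22 = 0).
  { unfold b11, b12, b22, nu, d. unfold d in Hd. field. exact Hd. }
  assert (HR : g22 * (b12 * h11 - b11 * h12) - g12 * (b22 * h11 - b11 * h22)
    + g11 * (b22 * h12 - b12 * h22) = 0).
  { rewrite <- Hr. unfold b11, b12, b22. ring. }
  assert (P : forall x, 2 * d * x = 0 -> x = 0).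
  { intros x Hx. apply Rmult_integral in Hx. destruct Hx; [lra | assumption]. }
  assert (X1 : h12 * b22 - h22 * b12 = 0).
  { apply P. transitivity (g22 * (g22 * (b12 * h11 - b11 * h12) - g12 * (b22 * h11 - b11 * h22)
      + g11 * (b22 * h12 - b12 * h22))
      + (g12 * b22 - g22 * b12) * (g22 * h11 - 2 * g12 * h12 + g11 * h22)
      - (g12 * h22 - g22 * h12) * (g22 * b11 - 2 * g12 * b12 + g11 * b22)).
    - unfold d. ring.
    - rewrite HR, Hb, Ht. ring. }
  assert (X2 : h22 * b11 - h11 * b22 = 0).
  { apply P. transitivity (- 2 * g12 * (g22 * (b12 * h11 - b11 * h12)
      - g12 * (b22 * h11 - b11 * h22) + g11 * (b22 * h12 - b12 * h22))
      + (g22 * b11 - g11 * b22) * (g22 * h11 - 2 * g12 * h12 + g11 * h22)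
      - (g22 * h11 - g11 * h22) * (g22 * b11 - 2 * g12 * b12 + g11 * b22)).
    - unfold d. ring.
    - rewrite HR, Hb, Ht. ring. }
  assert (X3 : h11 * b12 - h12 * b11 = 0).
  { apply P. transitivity (g11 * (g22 * (b12 * h11 - b11 * h12)
      - g12 * (b22 * h11 - b11 * h22) + g11 * (b22 * h12 - b12 * h22))
      + (g11 * b12 - g12 * b11) * (g22 * h11 - 2 * g12 * h12 + g11 * h22)
      - (g11 * h12 - g12 * h11) * (g22 * b11 - 2 * g12 * b12 + g11 * b22)).
    - unfold d. ring.
    - rewrite HR, Hb, Ht. ring. }
  exists nu.
  assert (C : exists c, b11 = c * h11 /\ b12 = c * h12 /\ b22 = c * h22).
  { destruct (Req_dec h11 0) as [H1|H1]; [destruct (Req_dec h12 0) as [H2|H2];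
      [destruct (Req_dec h22 0) as [H3|H3]; [tauto|]|]|].
    - exists (b22 / h22). repeat split; [| |field; exact H3];
        apply Rmult_eq_reg_r with h22; try exact H3; field_simplify; try exact H3; lra.
    - exists (b12 / h12). repeat split; [|field; exact H2|];
        apply Rmult_eq_reg_r with h12; try exact H2; field_simplify; try exact H2; lra.
    - exists (b11 / h11). repeat split; [field; exact H1| |];
        apply Rmult_eq_reg_r with h11; try exact H1; field_simplify; try exact H1; lra. }
  destruct C as (c & C1 & C2 & C3). exists c.
  unfold b11, b12, b22 in C1, C2, C3. lra.
Qed.

(** The determinant of [nu g + c h] is [nu^2 det g + c^2 det h], as [h] is trace
    free; the Gauss equation with [K = H^2] therefore reads
    [(1 + c^2) det h = 0]. *)
Lemma rank_one_form (g11 g12 g22 h11 h12 h22 k11 k12 k22 nu c : R) :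
  g11 * g22 - g12 * g12 <> 0 ->
  g22 * h11 - 2 * g12 * h12 + g11 * h22 = 0 ->
  k11 = nu * g11 + c * h11 -> k12 = nu * g12 + c * h12 -> k22 = nu * g22 + c * h22 ->
  4 * (k11 * k22 - k12 * k12 + (h11 * h22 - h12 * h12)) * (g11 * g22 - g12 * g12)
    = (g22 * k11 - 2 * g12 * k12 + g11 * k22) ^ 2 ->
  h11 * h22 - h12 * h12 = 0.
Proof.
  intros Hd Ht -> -> -> HG.
  set (d := g11 * g22 - g12 * g12) in *.
  assert (E : (4 * d * (1 + c ^ 2)) * (h11 * h22 - h12 * h12)
    = (4 * ((nu * g11 + c * h11) * (nu * g22 + c * h22)
       - (nu * g12 + c * h12) * (nu * g12 + c * h12) + (h11 * h22 - h12 * h12)) * d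
      - (g22 * (nu * g11 + c * h11) - 2 * g12 * (nu * g12 + c * h12)
          + g11 * (nu * g22 + c * h22)) ^ 2)
      + c ^ 2 * (g22 * h11 - 2 * g12 * h12 + g11 * h22) ^ 2) by (unfold d; ring).
  rewrite HG, Ht in E.
  assert (F : (4 * d * (1 + c ^ 2)) * (h11 * h22 - h12 * h12) = 0) by (rewrite E; ring).
  apply Rmult_integral in F. destruct F as [F|F]; [|exact F].
  assert (0 <= c ^ 2) by apply pow2_ge_0.
  apply Rmult_integral in F. lra.
Qed.

(** * The null one-form *)

Section RankOne.

Variables (D : plane -> Prop) (z n m : plane -> E4).
Hypothesis HF : normal_frame D z n m.
Hypothesis Hpar : forall p i, D p -> lor (dvec i n p) (m p) = 0.
Hypothesis Htr : forall p, D p -> g z I2 I2 p * sff z m I1 I1 p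
  - 2 * g z I1 I2 p * sff z m I1 I2 p + g z I1 I1 p * sff z m I2 I2 p = 0.
Hypothesis Hrank : forall p, D p ->
  sff z m I1 I1 p * sff z m I2 I2 p - sff z m I1 I2 p * sff z m I1 I2 p = 0.

Variables (e : ix) (eps kap : R).
Hypothesis Heps : eps * eps = 1.
Hypothesis Hkap : kap * kap = 1.
Hypothesis Hpos : forall p, D p -> 0 < eps * sff z m e e p.

Let HD := nf_open _ _ _ _ HF.
Let Hz := nf_z _ _ _ _ HF.
Let Hdet := nf_det _ _ _ _ HF.
Let Hn := nf_n _ _ _ _ HF.
Let Hm := nf_m _ _ _ _ HF.
Let Hzn := nf_zn _ _ _ _ HF.
Let Hzm := nf_zm _ _ _ _ HF.
Let Hmm := nf_mm _ _ _ _ HF.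
Let Hnm := nf_nm _ _ _ _ HF.

(** The square root of [eps] times the rank one form [sff z m], read off from the
    row of a diagonal entry [e] that does not vanish; [kap] is its sign. *)
Definition null_form (i : ix) (p : plane) : R :=
  kap * sff z m i e p / sqrt (eps * sff z m e e p).

(** The metric dual of a one-form. *)
Definition sharp (w : ix -> plane -> R) (i : ix) (p : plane) : R :=
  ginv z i I1 p * w I1 p + ginv z i I2 p * w I2 p.

Definition null_field (p : plane) : E4 :=
  plus (scal (sharp null_form I1 p) (dvec I1 z p))
       (scal (sharp null_form I2 p) (dvec I2 z p)).

Local Notation w := null_form.
Local Notation V := null_field.

Lemma smooth_sff (i j : ix) : smooth D (sff z m i j).
Proof. apply smooth_lor; auto using smooth4_dvec. Qed.

Lemma smooth_null_form (i : ix) : smooth D (w i).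
Proof.
  unfold null_form. apply smooth_div; auto.
  - intros p Hp E. generalize (sqrt_lt_R0 _ (Hpos p Hp)). lra.
  - apply smooth_mult; auto using smooth_const, smooth_sff.
  - apply smooth_sqrt; auto. apply smooth_mult; auto using smooth_const, smooth_sff.
Qed.

Lemma smooth_null_field : smooth4 D V.
Proof.
  assert (S : forall i, smooth D (sharp w i)).
  { intros i. apply smooth_plus; auto; apply smooth_mult; auto using smooth_null_form;
      apply (smooth_ginv D z n m HF). }
  apply smooth4_plus; auto; apply smooth4_scal; auto using smooth4_dvec.
Qed.

Lemma null_form_square (i j : ix) (p : plane) : D p -> eps * w i p * w j p = sff z m i j p.
Proof.
  intros Hp. pose proof (Hpos p Hp) as P. pose proof (Hrank p Hp) as Rk.
  pose proof (sqrt_lt_R0 _ P) as Ps. pose proof (sqrt_sqrt _ (Rlt_le _ _ P)) as Sq.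
  unfold null_form. set (s := sqrt _) in *.
  transitivity ((kap * kap) * eps * (sff z m i e p * sff z m j e p) / (s * s)); [field; lra|].
  rewrite Hkap, Sq.
  assert (Hee : sff z m e e p <> 0) by (intros E; rewrite E in P; lra).
  assert (He0 : eps <> 0) by (intros E; rewrite E in Heps; lra).
  assert (M : sff z m i e p * sff z m j e p = sff z m i j p * sff z m e e p).
  { pose proof (sff_sym D z n m HF m I1 I2 p Hp).
    destruct i, j, e; rewrite ?H in *; lra. }
  rewrite M. field. auto.
Qed.

Lemma null_form_nonzero (p : plane) : D p -> w e p <> 0.
Proof.
  intros Hp E. pose proof (null_form_square e e p Hp) as Q. rewrite E in Q.
  generalize (Hpos p Hp). rewrite <- Q. lra.
Qed.

Lemma null_form_null (p : plane) : D p ->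
  g z I2 I2 p * (w I1 p * w I1 p) - 2 * g z I1 I2 p * (w I1 p * w I2 p)
  + g z I1 I1 p * (w I2 p * w I2 p) = 0.
Proof.
  intros Hp. pose proof (Htr p Hp) as T.
  rewrite <- (null_form_square I1 I1), <- (null_form_square I1 I2),
    <- (null_form_square I2 I2) in T by exact Hp.
  apply Rmult_eq_reg_l with eps; [|intros E; rewrite E in Heps; lra]. lra.
Qed.

Lemma null_field_dvec (k : ix) (p : plane) : D p -> lor (V p) (dvec k z p) = w k p.
Proof.
  intros Hp. unfold null_field, sharp. autorewrite with lor.
  fold (g z I1 k p) (g z I2 k p). unfold ginv. generalize (Hdet p Hp). unfold detg.
  destruct k; rewrite ?(g_sym z I2 I1); intros; field; assumption.
Qed.

Lemma null_field_n (p : plane) : D p -> lor (V p) (n p) = 0.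
Proof. intros Hp. unfold null_field. autorewrite with lor. rewrite !Hzn by exact Hp. ring. Qed.

Lemma null_field_m (p : plane) : D p -> lor (V p) (m p) = 0.
Proof. intros Hp. unfold null_field. autorewrite with lor. rewrite !Hzm by exact Hp. ring. Qed.

Lemma sharp_null (p : plane) : D p ->
  sharp w I1 p * w I1 p + sharp w I2 p * w I2 p = 0.
Proof.
  intros Hp. pose proof (null_form_null p Hp) as N. unfold sharp, ginv.
  transitivity ((g z I2 I2 p * (w I1 p * w I1 p) - 2 * g z I1 I2 p * (w I1 p * w I2 p)
  + g z I1 I1 p * (w I2 p * w I2 p)) / detg z p); [field; auto|]. rewrite N.
  unfold Rdiv. ring.
Qed.

Lemma null_field_null (p : plane) : D p -> lor (V p) (V p) = 0.
Proof.
  intros Hp. unfold null_field at 2. rewrite lor_plus_r, !lor_scal_r.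
  rewrite !null_field_dvec by exact Hp. apply sharp_null, Hp.
Qed.

(** A vector is null and has zero time component only if it vanishes. *)
Lemma null_field_time (p : plane) : D p -> x4 (V p) <> 0.
Proof.
  intros Hp E. pose proof (null_field_null p Hp) as N. unfold lor in N. rewrite E in N.
  assert (Z : x1 (V p) = 0 /\ x2 (V p) = 0 /\ x3 (V p) = 0).
  { assert (H1 := Rle_0_sqr (x1 (V p))). assert (H2 := Rle_0_sqr (x2 (V p))).
    assert (H3 := Rle_0_sqr (x3 (V p))). unfold Rsqr in *.
    repeat split; apply Rsqr_0_uniq; unfold Rsqr; lra. }
  destruct Z as (Z1 & Z2 & Z3).
  apply (null_form_nonzero p Hp). rewrite <- (null_field_dvec e p Hp).
  unfold lor. rewrite Z1, Z2, Z3, E. ring.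
Qed.

Lemma dvec_m (i : ix) (p : plane) : D p -> dvec i m p = scal (- (eps * w i p)) (V p).
Proof.
  intros Hp. apply (surface_frame_ext D z n m HF p _ _ Hp).
  - intros k. rewrite (sff_dvec D z n m HF m i k p Hp Hm) by (intros; apply Hzm; assumption).
    rewrite lor_scal_l, null_field_dvec, <- null_form_square by exact Hp. ring.
  - rewrite lor_scal_l, null_field_n, (m_dvec_n D z n m HF Hpar) by exact Hp. ring.
  - rewrite lor_scal_l, null_field_m, (unit_dvec D z n m HF) by auto. ring.
Qed.

(** The Codazzi equation in disguise: [dm] is the rank one form [- eps w V], and
    the symmetry of second derivatives of [m], tested against the tangent
    plane, gives [2 dw = 0] because [V] is null. *)
Lemma null_form_closed (p : plane) : D p -> dpar I1 (w I2) p = dpar I2 (w I1) p.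
Proof.
  intros Hp.
  assert (He0 : eps <> 0) by (intros E; rewrite E in Heps; lra).
  pose proof smooth_null_field as HV. pose proof smooth_null_form as Hw.
  assert (Hew : forall i, smooth D (fun q => - (eps * w i q))).
  { intros i. apply smooth_opp; auto. apply smooth_mult; auto using smooth_const. }
  assert (Dew : forall i j, dpar j (fun q => - (eps * w i q)) p = - eps * dpar j (w i) p).
  { intros i j. rewrite <- (dpar_ext j D (fun q => - eps * w i q)); auto.
    - rewrite (dpar_mult D j p Hp) by auto using smooth_const. rewrite dpar_const. ring.
    - intros. ring. }
  (* [d(w V) = 0], by the symmetry of the second derivatives of [m] *)
  assert (S : forall x, (dpar I1 (w I2) p - dpar I2 (w I1) p) * lor (V p) x
     = w I1 p * lor (dvec I2 V p) x - w I2 p * lor (dvec I1 V p) x).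
  { intros x. pose proof (dvec_swap D HD m I1 I2 p Hp Hm) as E.
    assert (Q : forall i j, dvec j (dvec i m) p =
      plus (scal (- eps * dpar j (w i) p) (V p)) (scal (- (eps * w i p)) (dvec j V p))).
    { intros i j. rewrite <- Dew, <- (dvec_scal D) by auto.
      apply (dvec_ext D HD); auto. intros q Hq. apply dvec_m, Hq. }
    rewrite !Q in E. apply (f_equal (fun v => lor v x)) in E.
    autorewrite with lor in E.
    apply Rmult_eq_reg_l with eps; [|exact He0]. lra. }
  (* the field [y] spans the kernel of [w], hence is a multiple of [V] and null;
     so its derivatives are orthogonal to [V] *)
  set (y := fun q => plus (scal (w I1 q) (dvec I2 z q)) (scal (- w I2 q) (dvec I1 z q))).
  assert (Hy : smooth4 D y).
  { apply smooth4_plus; auto; apply smooth4_scal; auto using smooth4_dvec, smooth_opp. }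
  assert (Dy : forall i, dvec i y p =
    plus (plus (scal (dpar i (w I1) p) (dvec I2 z p)) (scal (w I1 p) (dvec i (dvec I2 z) p)))
         (plus (scal (- dpar i (w I2) p) (dvec I1 z p))
               (scal (- w I2 p) (dvec i (dvec I1 z) p)))).
  { intros i. unfold y.
    rewrite (dvec_plus D), !(dvec_scal D); auto using smooth4_dvec, smooth_opp, smooth4_scal.
    assert (N : dpar i (fun q => - w I2 q) p = - dpar i (w I2) p).
    { rewrite <- (dpar_ext i D (fun q => -1 * w I2 q)); auto.
      - rewrite (dpar_mult D i p Hp) by auto using smooth_const. rewrite dpar_const. ring.
      - intros. ring. }
    rewrite N. reflexivity. }
  assert (Hyy : forall q, D q -> lor (y q) (y q) = 0).
  { intros q Hq. rewrite <- (null_form_null q Hq). unfold y. autorewrite with lor.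
    fold (g z I1 I1 q) (g z I1 I2 q) (g z I2 I1 q) (g z I2 I2 q).
    rewrite (g_sym z I2 I1). ring. }
  assert (Hdyy : forall i, lor (dvec i y p) (y p) = 0).
  { intros i. pose proof (lor_const_dpar D HD y y 0 i p Hp Hy Hy Hyy) as E.
    rewrite (lor_sym (y p)) in E. lra. }
  assert (HdyV : forall i, lor (dvec i y p) (V p) = 0).
  { intros i.
    assert (K : forall j, w j p * lor (dvec i y p) (V p) = 0).
    { intros j. pose proof (sharp_null p Hp) as N. pose proof (Hdyy i) as Y.
      unfold y in Y at 2. rewrite lor_plus_r, !lor_scal_r in Y.
      unfold null_field. rewrite lor_plus_r, !lor_scal_r.
      set (t1 := lor (dvec i y p) (dvec I1 z p)) in *.
      set (t2 := lor (dvec i y p) (dvec I2 z p)) in *.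
      set (a1 := sharp w I1 p) in *. set (a2 := sharp w I2 p) in *.
      destruct j.
      - transitivity (a2 * (w I1 p * t2 + - w I2 p * t1)
          + t1 * (a1 * w I1 p + a2 * w I2 p)); [ring|]. rewrite Y, N. ring.
      - transitivity (- a1 * (w I1 p * t2 + - w I2 p * t1)
          + t2 * (a1 * w I1 p + a2 * w I2 p)); [ring|]. rewrite Y, N. ring. }
    destruct (Rmult_integral _ _ (K e)) as [E|E]; [|exact E].
    exfalso. exact (null_form_nonzero p Hp E). }
  assert (DV : forall i j, lor (dvec j V p) (dvec i z p)
     = dpar j (w i) p - lor (V p) (dvec j (dvec i z) p)).
  { intros i j.
    rewrite <- (dpar_ext j D (fun q => lor (V q) (dvec i z q)) (w i) p HD Hp).
    - rewrite (dpar_lor D HD V (dvec i z) j p); auto using smooth4_dvec. ring.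
    - intros q Hq. apply null_field_dvec, Hq. }
  assert (F : forall i, 2 * (dpar I1 (w I2) p - dpar I2 (w I1) p) * w i p = 0).
  { intros i. pose proof (S (dvec i z p)) as Si. rewrite null_field_dvec in Si by exact Hp.
    rewrite !DV in Si. pose proof (HdyV i) as Yi. rewrite Dy in Yi.
    autorewrite with lor in Yi. rewrite !(lor_sym _ (V p)), !null_field_dvec in Yi by exact Hp.
    rewrite (dvec_swap D HD z I1 i), (dvec_swap D HD z I2 i) in Si by auto.
    destruct i; lra. }
  destruct (Rmult_integral _ _ (F e)) as [E|E]; [lra|].
  exfalso. exact (null_form_nonzero p Hp E).
Qed.

End RankOne.

(** * Recognizing canonical parameters *)

Lemma normal_frame_unit (D : plane -> Prop) (z n m : plane -> E4) :
  normal_frame D z n m -> unit_normal_field D z n /\ unit_normal_field D z m.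
Proof.
  intros HF. split; split; try apply (nf_n _ _ _ _ HF); try apply (nf_m _ _ _ _ HF);
    intros p Hp; (split; [|first [apply (nf_nn _ _ _ _ HF) | apply (nf_mm _ _ _ _ HF)]; exact Hp]);
    intros a; rewrite lor_sym, tangent_lor.
  - rewrite !(nf_zn _ _ _ _ HF) by exact Hp. ring.
  - rewrite !(nf_zm _ _ _ _ HF) by exact Hp. ring.
Qed.

(** In isotropic parameters [H] is a multiple of the mixed component of the second
    fundamental form, so the vanishing of that of [m] makes it collinear with
    [n]. *)
Lemma canonical_of_forms (U : plane -> Prop) (z n m : plane -> E4) (eps : R) :
  normal_frame U z n m -> eps * eps = 1 ->
  (forall q, U q -> g z I1 I1 q = 0 /\ g z I2 I2 q = 0 /\ g z I1 I2 q < 0) ->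
  (forall q, U q -> sff z m I1 I1 q = eps /\ sff z m I1 I2 q = 0 /\ sff z m I2 I2 q = 0) ->
  (forall q, U q -> sff z n I2 I2 q = 0) ->
  canonical_parameters U z.
Proof.
  intros HF Heps Hg Hh Hk.
  pose proof (nf_open _ _ _ _ HF) as HU. pose proof (nf_z _ _ _ _ HF) as Hz.
  set (F := fun q => - g z I1 I2 q).
  assert (HFp : forall q, U q -> 0 < F q).
  { intros q Hq. unfold F. destruct (Hg q Hq) as (_ & _ & H). lra. }
  assert (HFs : smooth U F) by (apply smooth_opp; auto; apply (smooth_g U z n m HF)).
  assert (HFn : forall q, U q -> F q <> 0) by (intros q Hq E; generalize (HFp q Hq); lra).
  assert (Hsff : forall N i j, smooth4 U N -> smooth U (sff z N i j)).
  { intros N i j HN. apply smooth_lor; auto using smooth4_dvec. }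
  pose proof (nf_n _ _ _ _ HF) as Hn. pose proof (nf_m _ _ _ _ HF) as Hm.
  assert (Hzn : forall q, U q -> forall k, lor (dvec k z q) (n q) = 0)
    by (intros; apply (nf_zn _ _ _ _ HF); assumption).
  assert (Hzm : forall q, U q -> forall k, lor (dvec k z q) (m q) = 0)
    by (intros; apply (nf_zm _ _ _ _ HF); assumption).
  exists (fun q => sqrt (F q)), (fun q => sff z n I1 I1 q / F q), (fun q => eps / F q),
    (fun q => - sff z n I1 I2 q / F q), n, m.
  split; [|split; [|split; [|split; [|split; [|split; [|split; [|split]]]]]]].
  - split; [apply smooth_sqrt; auto|]. intros q Hq. destruct (Hg q Hq) as (G1 & G2 & G3).
    pose proof (sqrt_lt_R0 _ (HFp q Hq)).
    rewrite <- Rsqr_pow2, Rsqr_sqrt by (left; auto). unfold F in *.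
    repeat split; auto. ring.
  - apply (normal_frame_unit U z n m HF).
  - intros q Hq. exists (lor (mean_curvature z q) (n q)).
    apply (surface_frame_ext U z n m HF q _ _ Hq).
    + intros k. rewrite mean_curvature_dvec by (apply (nf_det _ _ _ _ HF); exact Hq).
      rewrite lor_scal_l, (lor_sym (n q)), Hzn by exact Hq. ring.
    + rewrite lor_scal_l, (nf_nn _ _ _ _ HF) by exact Hq. ring.
    + rewrite lor_scal_l, (nf_nm _ _ _ _ HF) by exact Hq.
      rewrite mean_curvature_normal by auto.
      rewrite (sff_sym U z n m HF m I2 I1 q Hq).
      destruct (Hh q Hq) as (H1 & H2 & H3). destruct (Hg q Hq) as (G1 & G2 & _).
      rewrite H2, H3. unfold ginv. rewrite G2. unfold Rdiv. ring.
  - apply (normal_frame_unit U z n m HF).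
  - apply (nf_nm _ _ _ _ HF).
  - apply smooth_div; auto.
  - apply smooth_div; auto using smooth_const.
  - apply smooth_div; auto using smooth_opp.
  - intros q Hq. pose proof (HFp q Hq) as P. pose proof (sqrt_lt_R0 _ P) as Ps.
    pose proof (sqrt_sqrt _ (Rlt_le _ _ P)) as Sq.
    destruct (Hh q Hq) as (H1 & H2 & H3).
    assert (He : eps <> 0) by (intros E; rewrite E in Heps; lra).
    assert (Sg : forall a b (N : plane -> E4), (forall k, lor (dvec k z q) (N q) = 0) ->
      lor (sigma z q (fun i => basis a i / sqrt (F q)) (fun i => basis b i / sqrt (F q))) (N q)
      = sff z N a b q / F q).
    { intros a b N HN. rewrite (sigma_normal z q N) by exact HN.
      rewrite <- Sq at 9. destruct a, b; unfold basis; field; lra. }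
    assert (Hs : forall a b, sigma z q (fun i => basis a i / sqrt (F q))
        (fun i => basis b i / sqrt (F q))
      = plus (scal (sff z n a b q / F q) (n q)) (scal (sff z m a b q / F q) (m q))).
    { intros a b. apply (sigma_eq U z n m HF); auto; apply Sg; auto. }
    assert (Z : forall v : E4, scal 0 v = zero).
    { intros v. apply E4_eq; apply Rmult_0_l. }
    assert (Z' : forall v : E4, plus v zero = v).
    { intros v. apply E4_eq; apply Rplus_0_r. }
    split; [|split; [|split; [|split]]].
    + rewrite Hs, H1. reflexivity.
    + rewrite Hs, H2. replace (0 / F q) with 0 by (unfold Rdiv; ring). rewrite Z, Z'.
      f_equal. field. lra.
    + rewrite Hs, H3, (Hk q Hq). replace (0 / F q) with 0 by (unfold Rdiv; ring).
      rewrite !Z, Z'. reflexivity.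
    + apply Rmult_integral_contrapositive_currified; [exact He|].
      apply Rinv_neq_0_compat. lra.
    + assert (Ha : Rabs (eps / F q) = / F q).
      { unfold Rdiv. rewrite Rabs_mult, (Rabs_right (/ F q))
          by (left; apply Rinv_0_lt_compat; exact P).
        replace (Rabs eps) with 1; [ring|].
        apply Rsqr_inj; [lra | apply Rabs_pos|]. rewrite <- Rsqr_abs. unfold Rsqr. lra. }
      rewrite Ha, sqrt_inv. field. lra.
Qed.

(** * The isotropic parameter transversal to the null lines *)

Lemma vertical_constant (q0 : plane) (r : R) (f : plane -> R) (q : plane) :
  smooth (fun q : plane => ball q0 r q) f -> (forall q : plane, ball q0 r q -> dpar I2 f q = 0) ->
  ball q0 r q -> f q = f (fst q, snd q0).
Proof.
  intros Hf Hd Hq.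
  assert (Hr : 0 < r).
  { destruct Hq as [H _]. change (Rabs (fst q - fst q0) < r) in H.
    generalize (Rabs_pos (fst q - fst q0)). lra. }
  assert (Hl : ball q0 r (line I2 q (snd q0))).
  { destruct Hq as [H _]. apply ball_plane. simpl. rewrite Rminus_diag, Rabs_R0. auto. }
  assert (B : Rabs (f (line I2 q (snd q0)) - f q) <= 0 * Rabs (snd q0 - coord I2 q)).
  { apply (line_lipschitz q0 r); auto. intros x Hx. rewrite Hd, Rabs_R0; auto with real. }
  rewrite Rmult_0_l in B. symmetry. apply Rminus_diag_uniq, Rabs_eq_0.
  apply Rle_antisym; [exact B | apply Rabs_pos].
Qed.

Lemma constant_on_ball (q0 : plane) (r : R) (f : plane -> R) (q : plane) :
  smooth (fun q : plane => ball q0 r q) f -> (forall i (q : plane), ball q0 r q -> dpar i f q = 0) ->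
  ball q0 r q -> f q = f q0.
Proof.
  intros Hf Hd Hq.
  assert (Hr : 0 < r).
  { destruct Hq as [H _]. change (Rabs (fst q - fst q0) < r) in H.
    generalize (Rabs_pos (fst q - fst q0)). lra. }
  assert (B : Rabs (f q - f q0) <= 0 * Rabs (fst q - fst q0) + 0 * Rabs (snd q - snd q0)).
  { apply (ball_lipschitz q0 r); auto.
    - intros i x Hx. rewrite Hd, Rabs_R0; auto with real.
    - apply (ball_center q0 (mkposreal r Hr)). }
  apply Rminus_diag_uniq, Rabs_eq_0. apply Rle_antisym; [lra | apply Rabs_pos].
Qed.

Lemma smooth_system (q0 : plane) (d : R) (S : ix -> ix -> R -> R) (y : ix -> R -> R) :
  let U := fun q : plane => ball q0 d q in
  (forall i j, smooth U (fun q => S i j (fst q))) ->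
  (forall i t, Rabs (t - fst q0) < d ->
      is_derive (y i) t (S i I1 t * y I1 t + S i I2 t * y I2 t)) ->
  forall i, smooth U (fun q => y i (fst q)) /\ forall q, U q ->
    dpar I1 (fun q => y i (fst q)) q = S i I1 (fst q) * y I1 (fst q) + S i I2 (fst q) * y I2 (fst q)
    /\ dpar I2 (fun q => y i (fst q)) q = 0.
Proof.
  intros U HS Hy.
  set (d' := fun i k (q : plane) => match k with
    | I1 => S i I1 (fst q) * y I1 (fst q) + S i I2 (fst q) * y I2 (fst q)
    | I2 => 0 end).
  assert (Hd : forall i k q, U q -> is_dpar k (fun q => y i (fst q)) q (d' i k q)).
  { intros i k q [Hq _]. destruct k.
    - exact (Hy i (fst q) Hq).
    - exact (is_derive_const (V := R_NormedModule) (y i (fst q)) (snd q)). }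
  assert (HU : open U) by apply open_ball.
  assert (Hs : forall n i, Cn n U (fun q => y i (fst q))).
  { assert (Hc : forall i q, U q -> continuous (fun q : plane => y i (fst q)) q).
    { intros i q [Hq _]. apply (continuous_comp fst (y i)); [apply continuous_fst|].
      apply (ex_derive_continuous (K := R_AbsRing) (V := R_NormedModule)).
      eexists. exact (Hy i (fst q) Hq). }
    induction n as [|n IH]; intros i.
    - split; [apply Hc | exact I].
    - apply (Cn_intro n U _ (d' i)); auto. intros k. destruct k; unfold d'.
      + apply Cn_plus; auto; apply Cn_mult; auto; apply HS.
      + apply Cn_const, HU. }
  intros i. split; [intros n; apply Hs|]. intros q Hq.
  split; [apply is_dpar_unique, (Hd i I1 q Hq) | apply is_dpar_unique, (Hd i I2 q Hq)].
Qed.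

Lemma zero_dvec (i : ix) (p : plane) : dvec i (fun _ => zero) p = zero.
Proof. apply E4_eq; exact (dpar_const i 0 p). Qed.

Lemma scal_eq_zero (c : R) (v : E4) : c <> 0 -> scal c v = zero -> v = zero.
Proof.
  intros Hc E.
  assert (K : forall a, c * a = 0 -> a = 0).
  { intros a H. apply Rmult_integral in H. tauto. }
  apply E4_eq; apply K;
    [ exact (f_equal x1 E) | exact (f_equal x2 E) | exact (f_equal x3 E) | exact (f_equal x4 E) ].
Qed.

(** In this section [u] is the first coordinate and [V] its gradient; the
    vertical lines are the null lines, parametrized by the ambient time. *)

Section Adapted.

Variables (q0 : plane) (r0 : R) (z n m V : plane -> E4) (eps : R).
Let U := fun q : plane => ball q0 r0 q.
Hypothesis Hr0 : 0 < r0.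
Hypothesis HF : normal_frame U z n m.
Hypothesis Heps : eps * eps = 1.
Hypothesis HV : smooth4 U V.
Hypothesis Hm1 : forall q, U q -> dvec I1 m q = scal (- eps) (V q).
Hypothesis Hm2 : forall q, U q -> dvec I2 m q = zero.
Hypothesis HVu : forall q, U q -> lor (V q) (dvec I1 z q) = 1.
Hypothesis HVs : forall q, U q -> lor (V q) (dvec I2 z q) = 0.
Hypothesis HVz : forall q, U q -> V q = scal (x4 (V q)) (dvec I2 z q).
Hypothesis HVt : forall q, U q -> x4 (V q) < 0.
Hypothesis Hk : forall q, U q -> sff z n I2 I2 q = 0.

Let HU : open U := nf_open _ _ _ _ HF.
Let Hz := nf_z _ _ _ _ HF.
Let Hn := nf_n _ _ _ _ HF.
Let Hm := nf_m _ _ _ _ HF.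

(** [V] is, up to the sign [- eps], the first derivative of [m], which depends on
    [u] only. *)
Lemma V_vertical (q : plane) : U q -> dvec I2 V q = zero.
Proof.
  intros Hq. assert (He : - eps <> 0) by (intros E; nra).
  apply (scal_eq_zero (- eps)); [exact He|].
  transitivity (dvec I2 (dvec I1 m) q).
  - rewrite (dvec_ext U HU (dvec I1 m) (fun q => scal (- eps) (V q)) I2 q Hq Hm1).
    rewrite (dvec_scal U (fun _ => - eps)) by auto using smooth_const.
    rewrite dpar_const. apply E4_eq; [ change (- eps * x1 (dvec I2 V q) = 0 * x1 (V q)
      + - eps * x1 (dvec I2 V q)) | change (- eps * x2 (dvec I2 V q) = 0 * x2 (V q)
      + - eps * x2 (dvec I2 V q)) | change (- eps * x3 (dvec I2 V q) = 0 * x3 (V q)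
      + - eps * x3 (dvec I2 V q)) | change (- eps * x4 (dvec I2 V q) = 0 * x4 (V q)
      + - eps * x4 (dvec I2 V q)) ]; ring.
  - rewrite (dvec_swap U HU m I2 I1 q Hq Hm).
    rewrite (dvec_ext U HU _ (fun _ => zero) I1 q Hq Hm2). apply zero_dvec.
Qed.

Definition time (q : plane) : R := x4 (V q).

Lemma smooth_time : smooth U time.
Proof. apply HV. Qed.

Lemma time_vertical (q : plane) : U q -> dpar I2 time q = 0.
Proof. intros Hq. exact (f_equal x4 (V_vertical q Hq)). Qed.

(** The null lines are straight in the ambient space, because [V] is constant along
    them and tangent to them. *)
Lemma ruling_vertical (q : plane) : U q -> dvec I2 (dvec I2 z) q = zero.
Proof.
  intros Hq. apply (scal_eq_zero (time q)); [generalize (HVt q Hq); unfold time; lra|].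
  pose proof (V_vertical q Hq) as E.
  rewrite (dvec_ext U HU V (fun q => scal (time q) (dvec I2 z q)) I2 q Hq HVz) in E.
  rewrite (dvec_scal U) in E by auto using smooth_time, smooth4_dvec.
  rewrite time_vertical in E by exact Hq. refine (eq_trans _ E).
  set (v := dvec I2 (dvec I2 z) q). set (v' := dvec I2 z q).
  apply E4_eq; [ change (time q * x1 v = 0 * x1 v' + time q * x1 v)
    | change (time q * x2 v = 0 * x2 v' + time q * x2 v)
    | change (time q * x3 v = 0 * x3 v' + time q * x3 v)
    | change (time q * x4 v = 0 * x4 v' + time q * x4 v) ]; ring.
Qed.

Let b' := dvec I1 (dvec I2 z).

Lemma b'_vertical (q : plane) : U q -> dvec I2 b' q = zero.
Proof.
  intros Hq. unfold b'. rewrite (dvec_swap U HU (dvec I2 z) I2 I1) by auto using smooth4_dvec.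
  rewrite (dvec_ext U HU _ (fun _ => zero) I1 q Hq ruling_vertical). apply zero_dvec.
Qed.

Lemma smooth_b' : smooth4 U b'.
Proof. unfold b'. auto using smooth4_dvec. Qed.

Lemma g12_time (q : plane) : U q -> time q * g z I1 I2 q = 1.
Proof.
  intros Hq. rewrite <- (HVu q Hq), (HVz q Hq), lor_scal_l. unfold g, time.
  rewrite (lor_sym (dvec I1 z q)). reflexivity.
Qed.

Lemma g22_zero (q : plane) : U q -> g z I2 I2 q = 0.
Proof.
  intros Hq. pose proof (HVs q Hq) as E. rewrite (HVz q Hq), lor_scal_l in E.
  apply Rmult_integral in E. destruct E as [E|E]; [|exact E].
  generalize (HVt q Hq). lra.
Qed.

(** The coefficients of the Riccati equation of the transversal null curves,
    quadratic along the rulings. *)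
Definition rA (q : plane) : R := / 2 * (time q * lor (b' q) (b' q)).
Definition rB (q : plane) : R := / 2 * (time q * lor (b' q) (dvec I1 z q)).
Definition rC (q : plane) : R := / 2 * (time q * lor (dvec I1 z q) (dvec I1 z q)).

Lemma smooth_rA : smooth U rA.
Proof.
  apply smooth_mult; auto using smooth_const. apply smooth_mult; auto using smooth_time.
  apply smooth_lor; auto using smooth_b'.
Qed.

Lemma smooth_rB : smooth U rB.
Proof.
  apply smooth_mult; auto using smooth_const. apply smooth_mult; auto using smooth_time.
  apply smooth_lor; auto using smooth_b', smooth4_dvec.
Qed.

Lemma smooth_rC : smooth U rC.
Proof.
  apply smooth_mult; auto using smooth_const. apply smooth_mult; auto using smooth_time.
  apply smooth_lor; auto using smooth4_dvec.
Qed.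

Lemma time_lor_dpar (v w : plane -> E4) (q : plane) : U q -> smooth4 U v -> smooth4 U w ->
  dpar I2 (fun q => / 2 * (time q * lor (v q) (w q))) q =
  / 2 * (time q * (lor (dvec I2 v q) (w q) + lor (v q) (dvec I2 w q))).
Proof.
  intros Hq Hv Hw.
  assert (smooth U (fun q => lor (v q) (w q))) by (apply smooth_lor; auto).
  rewrite !(dpar_mult U I2 q Hq) by auto using smooth_const, smooth_mult, smooth_time.
  rewrite dpar_const, time_vertical, (dpar_lor U) by auto. ring.
Qed.

Lemma rA_vertical (q : plane) : U q -> dpar I2 rA q = 0.
Proof.
  intros Hq. unfold rA. rewrite time_lor_dpar by auto using smooth_b'.
  rewrite b'_vertical, lor_zero_l, lor_zero_r by exact Hq. ring.
Qed.

Lemma rB_vertical (q : plane) : U q -> dpar I2 rB q = rA q.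
Proof.
  intros Hq. unfold rB. rewrite time_lor_dpar by auto using smooth_b', smooth4_dvec.
  rewrite b'_vertical, lor_zero_l, (dvec_swap U HU z I2 I1) by auto. fold b'. unfold rA. ring.
Qed.

Lemma rC_vertical (q : plane) : U q -> dpar I2 rC q = 2 * rB q.
Proof.
  intros Hq. unfold rC. rewrite time_lor_dpar by auto using smooth4_dvec.
  rewrite (dvec_swap U HU z I2 I1) by auto. fold b'. rewrite (lor_sym (dvec I1 z q)).
  unfold rB. ring.
Qed.

Let foot (q : plane) : plane := (fst q, snd q0).
Let height (q : plane) : R := coord I2 q - snd q0.

Lemma smooth_height (D : plane -> Prop) : open D -> smooth D height.
Proof. intros HD. apply smooth_minus; auto using smooth_coord, smooth_const. Qed.

Lemma dpar_height (i : ix) (q : plane) : U q -> dpar i height q = basis I2 i.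
Proof.
  intros Hq. unfold height. rewrite (dpar_minus U i q Hq) by auto using smooth_coord, smooth_const.
  rewrite dpar_coord, dpar_const. ring.
Qed.

Lemma rA_foot (q : plane) : U q -> rA q = rA (foot q).
Proof. intros Hq. apply (vertical_constant q0 r0); auto using smooth_rA, rA_vertical. Qed.

Lemma rB_foot (q : plane) : U q -> rB q = rB (foot q) + rA (foot q) * height q.
Proof.
  intros Hq. rewrite <- rA_foot by exact Hq.
  assert (E : rB q - rA q * height q = rB (foot q) - rA (foot q) * height (foot q)).
  { apply (vertical_constant q0 r0 (fun q => rB q - rA q * height q) q); auto.
    - apply smooth_minus; auto using smooth_rB. apply smooth_mult; auto using smooth_rA, smooth_height.
    - intros x Hx. change (U x) in Hx.
      rewrite (dpar_minus U), (dpar_mult U)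
        by auto using smooth_rA, smooth_rB, smooth_height, smooth_mult.
      rewrite rB_vertical, rA_vertical, dpar_height by exact Hx. simpl. ring. }
  assert (height (foot q) = 0) by (unfold height, foot; simpl; ring).
  rewrite H in E. lra.
Qed.

Lemma rC_foot (q : plane) : U q ->
  rC q = rC (foot q) + 2 * rB (foot q) * height q + rA (foot q) * height q ^ 2.
Proof.
  intros Hq.
  assert (S1 : smooth U (fun q => rB q * height q)).
  { apply smooth_mult; auto using smooth_rB, smooth_height. }
  assert (S2 : smooth U (fun q => rA q * (height q * height q))).
  { apply smooth_mult; auto using smooth_rA. apply smooth_mult; auto using smooth_height. }
  assert (E : rC q - 2 * (rB q * height q) + rA q * (height q * height q)
     = rC (foot q) - 2 * (rB (foot q) * height (foot q))
       + rA (foot q) * (height (foot q) * height (foot q))).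
  { apply (vertical_constant q0 r0
      (fun q => rC q - 2 * (rB q * height q) + rA q * (height q * height q)) q); auto.
    - apply smooth_plus; auto. apply smooth_minus; auto using smooth_rC, smooth_mult, smooth_const.
    - intros x Hx. change (U x) in Hx.
      rewrite (dpar_plus U), (dpar_minus U), !(dpar_mult U)
        by auto using smooth_rA, smooth_rB, smooth_rC, smooth_height, smooth_mult,
          smooth_const, smooth_minus.
      rewrite rC_vertical, rB_vertical, rA_vertical, dpar_height, dpar_const by exact Hx.
      simpl. ring. }
  assert (height (foot q) = 0) by (unfold height, foot; simpl; ring).
  rewrite H in E. pose proof (rB_foot q Hq) as EB. rewrite (rA_foot q Hq), EB in E. lra.
Qed.

Definition rS (i j : ix) (t : R) : R :=
  match i, j with
  | I1, I1 => rB (t, snd q0)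
  | I1, I2 => - rA (t, snd q0)
  | I2, I1 => rC (t, snd q0)
  | I2, I2 => - rB (t, snd q0)
  end.

(** The null curves transversal to the rulings have slope [- rC], quadratic in the
    height: a Riccati equation. A function is constant along them when it is the
    image of the height under the fractional linear map given by a fundamental
    matrix of the linear system [rS]. *)
Lemma transversal_parameter :
  exists (W : plane -> Prop) (v : plane -> R), open W /\ W q0 /\ (forall q, W q -> U q) /\
    smooth W v /\ forall q, W q -> 0 < dpar I2 v q /\ dpar I1 v q = rC q * dpar I2 v q.
Proof.
  assert (Hc : forall i j t, Rabs (t - fst q0) < r0 -> continuous (rS i j) t).
  { intros i j t Ht.
    assert (HUt : U (t, snd q0)).
    { apply ball_plane. simpl. rewrite Rminus_diag, Rabs_R0. auto. }
    assert (L : forall f, smooth U f -> continuous (fun s => f (s, snd q0)) t).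
    { intros f Hf. apply (continuous_line f I1 q0 t), (smooth_cont U); auto. }
    destruct i, j; unfold rS.
    - apply L, smooth_rB.
    - apply (L (fun q => - rA q)), smooth_opp; auto using smooth_rA.
    - apply L, smooth_rC.
    - apply (L (fun q => - rB q)), smooth_opp; auto using smooth_rB. }
  destruct (linear_system rS (basis I1) (fst q0) r0 Hr0 Hc) as (d1 & Hd1 & y & Hy0 & Hy).
  destruct (linear_system rS (basis I2) (fst q0) r0 Hr0 Hc) as (d2 & Hd2 & x & Hx0 & Hx).
  set (d := Rmin d1 d2).
  assert (Hd : 0 < d /\ d <= d1 /\ d <= d2 /\ d <= r0).
  { unfold d. pose proof (Rmin_l d1 d2). pose proof (Rmin_r d1 d2).
    repeat split; try lra. apply Rmin_pos; lra. }
  set (B := fun q : plane => ball q0 d q).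
  assert (HB : open B) by apply open_ball.
  assert (HBU : forall q, B q -> U q) by (intros q Hq; apply (ball_le q0 d); [lra | exact Hq]).
  assert (HSs : forall i j, smooth B (fun q => rS i j (fst q))).
  { assert (Hfs : smooth2 B foot).
    { split; [apply (smooth_coord B I1 HB) | exact (smooth_const B (snd q0) HB)]. }
    assert (L : forall f, smooth U f -> smooth B (fun q => f (foot q))).
    { intros f Hf. apply (smooth_comp U B); auto. intros q Hq. apply HBU in Hq.
      destruct Hq as [Hq _]. apply ball_plane. simpl. rewrite Rminus_diag, Rabs_R0. auto. }
    intros i j. destruct i, j; unfold rS.
    - apply L, smooth_rB.
    - apply smooth_opp; auto. apply L, smooth_rA.
    - apply L, smooth_rC.
    - apply smooth_opp; auto. apply L, smooth_rB. }
  assert (Hys := smooth_system q0 d rS y HSs (fun i t Ht => Hy i t ltac:(lra))).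
  assert (Hxs := smooth_system q0 d rS x HSs (fun i t Ht => Hx i t ltac:(lra))).
  clear Hy Hx. fold B in Hys, Hxs.
  set (P := fun q : plane => y I1 (fst q)). set (Q := fun q : plane => y I2 (fst q)).
  set (R := fun q : plane => x I1 (fst q)). set (T := fun q : plane => x I2 (fst q)).
  destruct (Hys I1) as [SP DP]. destruct (Hys I2) as [SQ DQ].
  destruct (Hxs I1) as [SR DR]. destruct (Hxs I2) as [ST DT].
  fold P in SP, DP. fold Q in SQ, DQ. fold R in SR, DR. fold T in ST, DT.
  assert (Hw : forall q, B q -> P q * T q - Q q * R q = 1).
  { intros q Hq. transitivity (P q0 * T q0 - Q q0 * R q0).
    - apply (constant_on_ball q0 d (fun q => P q * T q - Q q * R q)); auto.
      + apply smooth_minus; auto using smooth_mult.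
      + intros i p Hp. change (B p) in Hp.
        rewrite (dpar_minus B), !(dpar_mult B) by auto using smooth_mult.
        destruct (DP p Hp) as [P1 P2], (DQ p Hp) as [Q1 Q2],
          (DR p Hp) as [R1 R2], (DT p Hp) as [T1 T2].
        destruct i.
        * rewrite P1, Q1, R1, T1. unfold rS, P, Q, R, T. ring.
        * rewrite P2, Q2, R2, T2. ring.
    - unfold P, Q, R, T. rewrite !Hy0, !Hx0. simpl. ring. }
  (* [v] equals the height along the vertical line of [q0] *)
  set (num := fun q => P q * height q + Q q).
  set (den := fun q => R q * height q + T q).
  assert (Snum : smooth B num).
  { apply smooth_plus; auto. apply smooth_mult; auto using smooth_height. }
  assert (Sden : smooth B den).
  { apply smooth_plus; auto. apply smooth_mult; auto using smooth_height. }
  set (W := fun q => B q /\ 0 < den q).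
  assert (HW : open W) by (apply open_pos; auto; intros; apply (smooth_cont B); auto).
  assert (HWB : forall q, W q -> B q) by (intros q [Hq _]; exact Hq).
  assert (HWd : forall q, W q -> den q <> 0) by (intros q [_ Hq]; lra).
  assert (Sv : smooth W (fun q => num q / den q)).
  { apply smooth_div; auto; apply (smooth_sub B); auto. }
  exists W, (fun q => num q / den q). split; [exact HW|]. split; [|split; [|split]]; auto.
  - split; [apply (ball_center q0 (mkposreal d (proj1 Hd)))|].
    unfold den, R, T, height. rewrite !Hx0. simpl. lra.
  - intros q Hq. pose proof (HWB q Hq) as HqB. pose proof (HBU q HqB) as HqU.
    set (v := fun q => num q / den q) in *.
    assert (E : forall i, dpar i v q * den q + v q * dpar i den q = dpar i num q).
    { intros i. rewrite <- (dpar_mult W i q Hq) by (auto; apply (smooth_sub B); auto).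
      apply (dpar_ext i W); auto. intros p Hp. unfold v. field. auto. }
    assert (En : forall i, dpar i num q =
      dpar i P q * height q + P q * basis I2 i + dpar i Q q).
    { intros i. unfold num. rewrite (dpar_plus B i q HqB), (dpar_mult B i q HqB)
        by auto using smooth_height, smooth_mult.
      rewrite dpar_height by exact HqU. reflexivity. }
    assert (Ed : forall i, dpar i den q =
      dpar i R q * height q + R q * basis I2 i + dpar i T q).
    { intros i. unfold den. rewrite (dpar_plus B i q HqB), (dpar_mult B i q HqB)
        by auto using smooth_height, smooth_mult.
      rewrite dpar_height by exact HqU. reflexivity. }
    pose proof (E I1) as E1. pose proof (E I2) as E2. rewrite En, Ed in E1, E2.
    destruct (DP q HqB) as [P1 P2], (DQ q HqB) as [Q1 Q2],
          (DR q HqB) as [R1 R2], (DT q HqB) as [T1 T2].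
    rewrite P1, Q1, R1, T1 in E1. rewrite P2, Q2, R2, T2 in E2.
    fold (P q) (Q q) (R q) (T q) in E1. simpl basis in E1, E2. unfold rS in E1.
    change (fst q, snd q0) with (foot q) in E1.
    destruct Hq as [_ Hden]. pose proof (Hw q HqB) as Wq.
    assert (V2 : dpar I2 v q * (den q * den q) = 1).
    { rewrite <- Wq. transitivity ((P q - v q * R q) * den q); [|unfold v, num, den in *; field; lra].
      rewrite <- Rmult_assoc. f_equal. lra. }
    assert (V1 : dpar I1 v q * (den q * den q) = rC q).
    { rewrite (rC_foot q HqU).
      transitivity ((rC (foot q) + 2 * rB (foot q) * height q + rA (foot q) * height q ^ 2)
        * (P q * T q - Q q * R q)); [|rewrite Wq; ring].
      assert (Ev : v q * den q = num q) by (unfold v; field; lra).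
      match type of E1 with _ + v q * ?X = ?Y =>
        transitivity (Y * den q - (v q * den q) * X);
          [rewrite <- E1; ring | rewrite Ev; unfold num, den; ring] end. }
    assert (Hdd : 0 < den q * den q) by nra.
    split.
    + apply Rmult_lt_reg_r with (den q * den q); [exact Hdd | lra].
    + apply Rmult_eq_reg_r with (den q * den q); [|lra].
      rewrite V1, Rmult_assoc, V2. ring.
Qed.

(** In the coordinates [(u, v)], [v] the transversal parameter, the forms of [m]
    and [n] keep their shape, and the Riccati equation of [v] says that the
    lines of constant [v] are null. *)
Lemma adapted_canonical : exists (r : R) (c : plane) (W : plane -> Prop) (phi : plane -> plane),
  open W /\ W q0 /\ (forall q, W q -> U q) /\
  diffeomorphism (fun q : plane => ball c r q) W phi /\
  canonical_parameters (fun q : plane => ball c r q) (fun q => z (phi q)).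
Proof.
  destruct transversal_parameter as (W1 & v & HW1 & HW1q & HW1U & Sv & Hv).
  set (F := fun q : plane => (fst q, v q) : plane).
  assert (SF : smooth2 W1 F) by (split; [exact (smooth_coord W1 I1 HW1) | exact Sv]).
  assert (HJ : jacobian F q0 <> 0).
  { unfold jacobian. change (F1 F) with (coord I1). change (F2 F) with v.
    rewrite !dpar_coord. simpl. generalize (proj1 (Hv q0 HW1q)). lra. }
  destruct (inverse_function W1 F q0 HW1 SF HW1q HJ)
    as (r & W & phi & Hr & HW & HWq & HWW1 & Sphi & Hphi & Hpsi).
  set (B := fun q : plane => ball (F q0) r q) in *.
  assert (HB : open B) by apply open_ball.
  exists r, (F q0), W, phi. fold B.
  assert (HWU : forall q, W q -> U q) by auto.
  assert (HBU : forall q, B q -> U (phi q)) by (intros q Hq; apply HWU, Hphi, Hq).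
  split; [exact HW|]. split; [exact HWq|]. split; [exact HWU|].
  split.
  { exists F. split; [exact Sphi|]. split; [|split; assumption].
    split; [apply (smooth_sub W1 W _ HWW1), SF | apply (smooth_sub W1 W _ HWW1), SF]. }
  assert (J1 : forall i q, B q -> dpar i (F1 phi) q = basis I1 i).
  { intros i q Hq. rewrite <- (dpar_coord I1 i q). apply (dpar_ext i B); auto.
    intros x Hx. exact (f_equal fst (proj2 (Hphi x Hx))). }
  assert (J2 : forall i q, B q -> dpar I1 v (phi q) * basis I1 i
     + dpar I2 v (phi q) * dpar i (F2 phi) q = basis I2 i).
  { intros i q Hq. rewrite <- (J1 i q Hq), <- (dpar_coord I2 i q).
    symmetry. rewrite <- (dpar_ext i B (fun q => v (phi q)) (coord I2) q HB Hq).
    - apply (dpar_comp W1 B); auto. apply HWW1, Hphi, Hq.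
    - intros x Hx. exact (f_equal snd (proj2 (Hphi x Hx))). }
  assert (Dc : forall (w : plane -> E4) i q, smooth4 U w -> B q -> dvec i (fun q => w (phi q)) q =
    plus (scal (basis I1 i) (dvec I1 w (phi q)))
         (scal (dpar i (F2 phi) q) (dvec I2 w (phi q)))).
  { intros w i q Hw Hq. rewrite <- (J1 i q Hq). apply (dvec_comp U B); auto. }
  assert (Sc : forall w, smooth4 U w -> smooth4 B (fun q => w (phi q))).
  { intros w Hw. apply (smooth4_comp U B); auto. }
  assert (G : forall q, B q -> g (fun q => z (phi q)) I1 I1 q = 0 /\
     g (fun q => z (phi q)) I2 I2 q = 0 /\ g (fun q => z (phi q)) I1 I2 q < 0).
  { intros q Hq. pose proof (HBU q Hq) as HqU. unfold g. rewrite !Dc by auto.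
    autorewrite with lor. rewrite (lor_sym (dvec I2 z (phi q)) (dvec I1 z (phi q))).
    pose proof (g22_zero _ HqU) as E22. pose proof (g12_time _ HqU) as E12. unfold g in E22, E12.
    rewrite E22. set (M := lor (dvec I1 z (phi q)) (dvec I2 z (phi q))) in *.
    pose proof (J2 I1 q Hq) as K1. pose proof (J2 I2 q Hq) as K2. simpl basis in *.
    assert (HqW : W1 (phi q)) by (apply HWW1, Hphi, Hq).
    destruct (Hv _ HqW) as [V2 V1]. rewrite V1 in K1, K2.
    set (v2 := dpar I2 v (phi q)) in *. set (s1 := dpar I1 (F2 phi) q) in *.
    set (s2 := dpar I2 (F2 phi) q) in *.
    assert (Ht : time (phi q) < 0) by (apply HVt, HqU).
    assert (Hs1 : s1 = - rC (phi q)).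
    { apply Rmult_eq_reg_l with v2; [|lra]. lra. }
    assert (HM : M < 0) by nra.
    assert (HC : 2 * rC (phi q) * M = lor (dvec I1 z (phi q)) (dvec I1 z (phi q))).
    { unfold rC. transitivity ((time (phi q) * M) * lor (dvec I1 z (phi q)) (dvec I1 z (phi q)));
        [field | rewrite E12; ring]. }
    assert (Hs2 : 0 < s2) by nra.
    split; [|split].
    - rewrite Hs1, <- HC. ring.
    - ring.
    - nra. }
  assert (HFB : normal_frame B (fun q => z (phi q)) (fun q => n (phi q)) (fun q => m (phi q))).
  { constructor; auto.
    - intros q Hq. destruct (G q Hq) as (G1 & G2 & G3). unfold detg.
      rewrite (g_sym _ I2 I1), G1, G2. nra.
    - intros q k Hq. rewrite Dc by auto. autorewrite with lor.
      rewrite !(nf_zn _ _ _ _ HF) by auto. ring.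
    - intros q k Hq. rewrite Dc by auto. autorewrite with lor.
      rewrite !(nf_zm _ _ _ _ HF) by auto. ring.
    - intros q Hq. apply (nf_nn _ _ _ _ HF); auto.
    - intros q Hq. apply (nf_mm _ _ _ _ HF); auto.
    - intros q Hq. apply (nf_nm _ _ _ _ HF); auto. }
  assert (HS : forall (N : plane -> E4) i j q, smooth4 U N ->
    (forall p k, U p -> lor (dvec k z p) (N p) = 0) -> B q ->
    sff (fun q => z (phi q)) (fun q => N (phi q)) i j q =
      - lor (dvec i (fun q => N (phi q)) q) (dvec j (fun q => z (phi q)) q)).
  { intros N i j q HN Ht Hq. rewrite (sff_dvec B _ _ _ HFB (fun q => N (phi q)) i j q); auto.
    - ring.
    - intros p k Hp. rewrite Dc by auto. autorewrite with lor. rewrite !Ht by auto. ring. }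
  apply (canonical_of_forms B _ (fun q => n (phi q)) (fun q => m (phi q)) eps); auto.
  - intros q Hq. pose proof (HBU q Hq) as HqU.
    rewrite !(HS m) by (auto; apply (nf_zm _ _ _ _ HF)).
    rewrite !Dc by auto. rewrite Hm1, Hm2 by exact HqU. autorewrite with lor.
    rewrite HVu, HVs by exact HqU. simpl. repeat split; ring.
  - intros q Hq. pose proof (HBU q Hq) as HqU.
    rewrite (HS n) by (auto; apply (nf_zn _ _ _ _ HF)).
    rewrite !Dc by auto. autorewrite with lor. simpl.
    assert (K : lor (dvec I2 n (phi q)) (dvec I2 z (phi q)) = 0).
    { rewrite (sff_dvec U z n m HF n I2 I2); auto; [|apply (nf_zn _ _ _ _ HF)].
      rewrite Hk by exact HqU. ring. }
    rewrite K. ring.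
Qed.

End Adapted.

(** * Coordinates adapted to the null lines *)

Section AdaptedCoordinates.

Variables (p : plane) (r : R) (z n m V : plane -> E4) (w : ix -> plane -> R).
Variables (a : ix -> plane -> R) (eps : R).
Let B := fun q : plane => ball p r q.
Hypothesis Hr : 0 < r.
Hypothesis HF : normal_frame B z n m.
Hypothesis Heps : eps * eps = 1.
Hypothesis HV : smooth4 B V.
Hypothesis Hw : forall i, smooth B (w i).
Hypothesis Hclosed : forall q, B q -> dpar I1 (w I2) q = dpar I2 (w I1) q.
Hypothesis HVa : forall q, B q ->
  V q = plus (scal (a I1 q) (dvec I1 z q)) (scal (a I2 q) (dvec I2 z q)).
Hypothesis HVw : forall q i, B q -> lor (V q) (dvec i z q) = w i q.
Hypothesis Haw : forall q, B q -> a I1 q * w I1 q + a I2 q * w I2 q = 0.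
Hypothesis Hm : forall q i, B q -> dvec i m q = scal (- (eps * w i q)) (V q).
Hypothesis HVt : forall q, B q -> x4 (V q) < 0.
Hypothesis Hk : forall q, B q -> exists nu c, forall i j,
  sff z n i j q = nu * g z i j q + c * (w i q * w j q).

(** The coordinates are a potential [u] of [w] and the ambient time. They are
    independent because [V] is in the kernel of [du = w] whereas its time
    component is nonzero; for the same reason the curves of constant [u] are
    tangent to [V]. *)
Lemma null_line_coordinates :
  exists (r : R) (c : plane) (W : plane -> Prop) (phi : plane -> plane),
    open W /\ W p /\ (forall q, W q -> B q) /\
    diffeomorphism (fun q : plane => ball c r q) W phi /\
    canonical_parameters (fun q : plane => ball c r q) (fun q => z (phi q)).
Proof.
  pose proof (nf_open _ _ _ _ HF) as HB. pose proof (nf_z _ _ _ _ HF) as Hz.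
  assert (HBp : B p) by (apply (ball_center p (mkposreal r Hr))).
  destruct (poincare p r w Hw Hclosed) as [u [Su Du]]. fold B in Su, Du.
  set (tz := fun q => x4 (z q)).
  assert (Stz : smooth B tz) by apply Hz.
  set (F := fun q : plane => (u q, tz q) : plane).
  assert (SF : smooth2 B F) by (split; assumption).
  assert (Dtz : forall i q, dpar i tz q = x4 (dvec i z q)) by reflexivity.
  assert (Vt : forall q, B q -> x4 (V q) = a I1 q * x4 (dvec I1 z q) + a I2 q * x4 (dvec I2 z q)).
  { intros q Hq. exact (f_equal x4 (HVa q Hq)). }
  assert (Hw0 : forall q, B q -> w I1 q = 0 -> w I2 q = 0 -> False).
  { intros q Hq W1 W2.
    assert (E : V q = zero).
    { apply (surface_frame_ext B z n m HF q _ _ Hq).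
      - intros k. rewrite lor_zero_l, HVw by exact Hq. destruct k; assumption.
      - rewrite lor_zero_l, HVa by exact Hq. autorewrite with lor.
        rewrite !(nf_zn _ _ _ _ HF) by exact Hq. ring.
      - rewrite lor_zero_l, HVa by exact Hq. autorewrite with lor.
        rewrite !(nf_zm _ _ _ _ HF) by exact Hq. ring. }
    pose proof (HVt q Hq) as T. rewrite E in T. change (0 < 0) in T. lra. }
  assert (HJ : jacobian F p <> 0).
  { unfold jacobian. change (F1 F) with u. change (F2 F) with tz.
    rewrite !Du, !Dtz by exact HBp. intros E.
    pose proof (HVt p HBp) as T. pose proof (Vt p HBp) as T'. pose proof (Haw p HBp) as A.
    apply (Hw0 p HBp).
    - apply Rmult_eq_reg_r with (x4 (V p)); [|lra]. rewrite T', Rmult_0_l.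
      transitivity (a I2 p * (w I1 p * x4 (dvec I2 z p) - w I2 p * x4 (dvec I1 z p))
        + x4 (dvec I1 z p) * (a I1 p * w I1 p + a I2 p * w I2 p)); [ring|].
      rewrite E, A. ring.
    - apply Rmult_eq_reg_r with (x4 (V p)); [|lra]. rewrite T', Rmult_0_l.
      transitivity (- a I1 p * (w I1 p * x4 (dvec I2 z p) - w I2 p * x4 (dvec I1 z p))
        + x4 (dvec I2 z p) * (a I1 p * w I1 p + a I2 p * w I2 p)); [ring|].
      rewrite E, A. ring. }
  destruct (inverse_function B F p HB SF HBp HJ)
    as (r1 & W & phi & Hr1 & HW & HWp & HWB & Sphi & Hphi & Hpsi).
  set (q0 := F p) in *. set (U := fun q : plane => ball q0 r1 q) in *.
  assert (HU : open U) by apply open_ball.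
  assert (HUB : forall q, U q -> B (phi q)) by (intros q Hq; apply HWB, Hphi, Hq).
  set (Y1 := fun i q => dpar i (F1 phi) q). set (Y2 := fun i q => dpar i (F2 phi) q).
  assert (Yw : forall i q, U q -> w I1 (phi q) * Y1 i q + w I2 (phi q) * Y2 i q = basis I1 i).
  { intros i q Hq. rewrite <- (dpar_coord I1 i q).
    rewrite <- (Du I1 (phi q)), <- (Du I2 (phi q)) by (apply HUB, Hq). symmetry.
    rewrite <- (dpar_ext i U (fun q => u (phi q)) (coord I1) q HU Hq).
    - apply (dpar_comp B U); auto.
    - intros x Hx. exact (f_equal fst (proj2 (Hphi x Hx))). }
  assert (Yt : forall i q, U q -> x4 (dvec I1 z (phi q)) * Y1 i q
      + x4 (dvec I2 z (phi q)) * Y2 i q = basis I2 i).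
  { intros i q Hq. rewrite <- (dpar_coord I2 i q), <- !Dtz. symmetry.
    rewrite <- (dpar_ext i U (fun q => tz (phi q)) (coord I2) q HU Hq).
    - apply (dpar_comp B U); auto.
    - intros x Hx. exact (f_equal snd (proj2 (Hphi x Hx))). }
  assert (Dc : forall (v : plane -> E4) i q, smooth4 B v -> U q -> dvec i (fun q => v (phi q)) q =
    plus (scal (Y1 i q) (dvec I1 v (phi q))) (scal (Y2 i q) (dvec I2 v (phi q)))).
  { intros v i q Hv Hq. apply (dvec_comp B U); auto. }
  assert (Sc : forall v, smooth4 B v -> smooth4 U (fun q => v (phi q))).
  { intros v Hv. apply (smooth4_comp B U); auto. }
  assert (Vz : forall i q, U q -> lor (V (phi q)) (dvec i (fun q => z (phi q)) q) = basis I1 i).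
  { intros i q Hq. rewrite Dc by auto. autorewrite with lor. rewrite !HVw by auto.
    rewrite <- (Yw i q Hq). ring. }
  assert (Vs : forall q, U q ->
    V (phi q) = scal (x4 (V (phi q))) (dvec I2 (fun q => z (phi q)) q)).
  { intros q Hq. pose proof (HUB q Hq) as HqB.
    pose proof (Haw _ HqB) as A. pose proof (Yw I2 q Hq) as YW. pose proof (Yt I2 q Hq) as YT.
    simpl basis in YW, YT. pose proof (Vt _ HqB) as T.
    rewrite Dc by auto. rewrite (HVa _ HqB) at 1.
    set (x := phi q) in *. set (y1 := Y1 I2 q) in *. set (y2 := Y2 I2 q) in *.
    (* [V] and the second coordinate field are both in the kernel of [w] *)
    assert (Z : a I1 x * y2 - a I2 x * y1 = 0).
    { assert (Z1 : w I1 x * (a I1 x * y2 - a I2 x * y1) = 0).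
      { transitivity (y2 * (a I1 x * w I1 x + a I2 x * w I2 x)
          - a I2 x * (w I1 x * y1 + w I2 x * y2)); [ring|]. rewrite A, YW. ring. }
      assert (Z2 : w I2 x * (a I1 x * y2 - a I2 x * y1) = 0).
      { transitivity (- y1 * (a I1 x * w I1 x + a I2 x * w I2 x)
          + a I1 x * (w I1 x * y1 + w I2 x * y2)); [ring|]. rewrite A, YW. ring. }
      apply Rmult_integral in Z1. apply Rmult_integral in Z2.
      destruct Z1 as [Z1|Z1]; [|exact Z1]. destruct Z2 as [Z2|Z2]; [|exact Z2].
      exfalso. exact (Hw0 x HqB Z1 Z2). }
    assert (A1 : a I1 x = x4 (V x) * y1).
    { rewrite T. transitivity (a I1 x * (x4 (dvec I1 z x) * y1 + x4 (dvec I2 z x) * y2));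
        [rewrite YT; ring|].
      transitivity ((a I1 x * x4 (dvec I1 z x) + a I2 x * x4 (dvec I2 z x)) * y1
        + x4 (dvec I2 z x) * (a I1 x * y2 - a I2 x * y1)); [ring|]. rewrite Z. ring. }
    assert (A2 : a I2 x = x4 (V x) * y2).
    { rewrite T. transitivity (a I2 x * (x4 (dvec I1 z x) * y1 + x4 (dvec I2 z x) * y2));
        [rewrite YT; ring|].
      transitivity ((a I1 x * x4 (dvec I1 z x) + a I2 x * x4 (dvec I2 z x)) * y2
        - x4 (dvec I1 z x) * (a I1 x * y2 - a I2 x * y1)); [ring|]. rewrite Z. ring. }
    rewrite A1, A2. set (c := x4 (V x)).
    assert (E : forall s1 s2, c * y1 * s1 + c * y2 * s2 = c * (y1 * s1 + y2 * s2))
      by (intros; ring).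
    apply E4_eq; apply E. }
  assert (G22 : forall q, U q -> g (fun q => z (phi q)) I2 I2 q = 0).
  { intros q Hq. pose proof (Vz I2 q Hq) as E. rewrite (Vs q Hq), lor_scal_l in E.
    simpl basis in E. apply Rmult_integral in E. destruct E as [E|E]; [|exact E].
    generalize (HVt _ (HUB q Hq)). lra. }
  assert (G12 : forall q, U q -> g (fun q => z (phi q)) I1 I2 q <> 0).
  { intros q Hq E0. pose proof (Vz I1 q Hq) as E. rewrite (Vs q Hq), lor_scal_l in E.
    rewrite lor_sym in E. unfold g in E0. rewrite E0 in E. simpl basis in E. lra. }
  assert (HFU : normal_frame U (fun q => z (phi q)) (fun q => n (phi q)) (fun q => m (phi q))).
  { constructor; auto.
    - intros q Hq. unfold detg. rewrite (g_sym _ I2 I1), G22 by exact Hq.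
      pose proof (G12 q Hq). intros E. apply H.
      apply Rsqr_0_uniq. unfold Rsqr. lra.
    - apply Sc, (nf_n _ _ _ _ HF).
    - apply Sc, (nf_m _ _ _ _ HF).
    - intros q k Hq. rewrite Dc by auto. autorewrite with lor.
      rewrite !(nf_zn _ _ _ _ HF) by auto. ring.
    - intros q k Hq. rewrite Dc by auto. autorewrite with lor.
      rewrite !(nf_zm _ _ _ _ HF) by auto. ring.
    - intros q Hq. apply (nf_nn _ _ _ _ HF); auto.
    - intros q Hq. apply (nf_mm _ _ _ _ HF); auto.
    - intros q Hq. apply (nf_nm _ _ _ _ HF); auto. }
  assert (Dm : forall i q, U q ->
    dvec i (fun q => m (phi q)) q = scal (- (eps * basis I1 i)) (V (phi q))).
  { intros i q Hq. rewrite Dc by (auto; apply (nf_m _ _ _ _ HF)). rewrite !Hm by auto.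
    rewrite <- (Yw i q Hq).
    assert (E : forall s, Y1 i q * (- (eps * w I1 (phi q)) * s)
        + Y2 i q * (- (eps * w I2 (phi q)) * s)
      = - (eps * (w I1 (phi q) * Y1 i q + w I2 (phi q) * Y2 i q)) * s) by (intros; ring).
    apply E4_eq; apply E. }
  destruct (adapted_canonical q0 r1 (fun q => z (phi q)) (fun q => n (phi q))
    (fun q => m (phi q)) (fun q => V (phi q)) eps Hr1 HFU Heps (Sc V HV))
    as (r2 & c & W2 & phi2 & HW2 & HW2q & HW2U & Hdiff & Hcan).
  - intros q Hq. rewrite Dm by exact Hq. simpl. rewrite Rmult_1_r. reflexivity.
  - intros q Hq. rewrite Dm by exact Hq. simpl. rewrite Rmult_0_r, Ropp_0.
    apply E4_eq; apply Rmult_0_l.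
  - intros q Hq. apply (Vz I1 q Hq).
  - intros q Hq. apply (Vz I2 q Hq).
  - exact Vs.
  - intros q Hq. apply HVt. auto.
  - intros q Hq. pose proof (HUB q Hq) as HqB.
    assert (E : sff (fun q => z (phi q)) (fun q => n (phi q)) I2 I2 q =
      - lor (dvec I2 (fun q => n (phi q)) q) (dvec I2 (fun q => z (phi q)) q)).
    { rewrite (sff_dvec U _ _ _ HFU (fun q => n (phi q)) I2 I2 q Hq); [ring| |].
      - apply Sc, (nf_n _ _ _ _ HF).
      - apply (nf_zn _ _ _ _ HFU). }
    rewrite E. rewrite !Dc by (auto; apply (nf_n _ _ _ _ HF)). autorewrite with lor.
    rewrite !(sff_dvec B z n m HF n) by
      (first [exact HqB | apply (nf_n _ _ _ _ HF) | apply (nf_zn _ _ _ _ HF)]).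
    destruct (Hk _ HqB) as (nu & cc & K). rewrite !K.
    pose proof (G22 q Hq) as Q. unfold g in Q. rewrite !Dc in Q by auto.
    autorewrite with lor in Q.
    pose proof (Yw I2 q Hq) as YW. simpl basis in YW. unfold g.
    set (x := phi q) in *. set (y1 := Y1 I2 q) in *. set (y2 := Y2 I2 q) in *.
    match type of Q with ?L = 0 =>
      transitivity (nu * L + cc * (w I1 x * y1 + w I2 x * y2) ^ 2); [ring | rewrite Q, YW; ring]
    end.
  - destruct Hdiff as (psi2 & S2 & T2 & P2 & Q2).
    exists r2, c, (fun x => W x /\ W2 (F x)), (fun q => phi (phi2 q)).
    assert (HcW : forall x, W x -> continuous F x).
    { intros x Hx. apply (smooth2_continuous B); auto. }
    assert (HoW : open (fun x => W x /\ W2 (F x))) by (apply open_preimage; auto).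
    assert (HUc : open (fun q : plane => ball c r2 q)) by apply open_ball.
    assert (Hin : forall q : plane, ball c r2 q -> U (phi2 q)) by (intros q Hq; apply HW2U, P2, Hq).
    split; [exact HoW|]. split; [split; [exact HWp | exact HW2q]|].
    split; [intros q [Hq _]; auto|].
    split; [|exact Hcan].
    exists (fun x => psi2 (F x)). split; [|split; [|split]].
    + split; [apply (smooth_comp U _ (F1 phi) phi2) | apply (smooth_comp U _ (F2 phi) phi2)];
        auto; apply Sphi.
    + assert (SF' : smooth2 (fun x => W x /\ W2 (F x)) F).
      { split; [apply (smooth_sub B _ (F1 F)) | apply (smooth_sub B _ (F2 F))];
          try (intros x [Hx _]; auto); apply SF. }
      split; [apply (smooth_comp W2 _ (F1 psi2) F) | apply (smooth_comp W2 _ (F2 psi2) F)];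
        auto; try (intros x [_ Hx]; exact Hx); apply T2.
    + intros q Hq. destruct (Hphi _ (Hin q Hq)) as [H1 H2]. rewrite H2.
      destruct (P2 q Hq) as [H3 H4]. auto.
    + intros x [Hx Hx2]. destruct (Q2 _ Hx2) as [H1 H2]. rewrite H2.
      split; [exact H1|]. apply Hpsi, Hx.
Qed.

End AdaptedCoordinates.

(** * The normal frame of the surface *)

Section Surface.

Variables (D : plane -> Prop) (z n : plane -> E4).
Hypothesis HD : open D.
Hypothesis Hz : smooth4 D z.
Hypothesis Hdet : forall p, D p -> detg z p < 0.
Hypothesis Hn : unit_normal_field D z n.

(** The second vector of the normal frame; by [cross_norm] the cross product has
    square [- detg]. *)
Definition binormal (p : plane) : E4 :=
  scal (/ sqrt (- detg z p)) (cross (dvec I1 z p) (dvec I2 z p) (n p)).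

Lemma unit_normal_dvec (p : plane) (k : ix) : D p -> lor (dvec k z p) (n p) = 0.
Proof.
  intros Hp. destruct Hn as [_ H]. destruct (H p Hp) as [Ht _].
  pose proof (Ht (basis k)) as E. rewrite lor_sym, tangent_lor in E.
  destruct k; simpl in E; lra.
Qed.

Lemma binormal_frame : normal_frame D z n binormal.
Proof.
  destruct Hn as [Sn Un].
  assert (Hp0 : forall p, D p -> 0 < - detg z p) by (intros p Hp; generalize (Hdet p Hp); lra).
  assert (Hcr : forall p, D p -> lor (cross (dvec I1 z p) (dvec I2 z p) (n p))
      (cross (dvec I1 z p) (dvec I2 z p) (n p)) = - detg z p).
  { intros p Hp. rewrite cross_norm, !unit_normal_dvec by exact Hp.
    rewrite (proj2 (Un p Hp)). unfold detg. rewrite (g_sym z I2 I1). unfold g, det3. ring. }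
  constructor; auto.
  - intros p Hp E. generalize (Hdet p Hp). lra.
  - apply smooth4_scal; auto.
    + assert (Sd : smooth D (detg z)).
      { unfold detg. apply smooth_minus; auto; apply smooth_mult; auto;
          apply smooth_lor; auto using smooth4_dvec. }
      apply smooth_inv; auto.
      * intros p Hp. generalize (sqrt_lt_R0 _ (Hp0 p Hp)). lra.
      * apply smooth_sqrt; auto using smooth_opp.
    + apply smooth4_cross; auto using smooth4_dvec.
  - intros p k Hp. apply unit_normal_dvec, Hp.
  - intros p k Hp. unfold binormal. rewrite lor_scal_r, lor_sym.
    destruct k; rewrite ?cross_orth1, ?cross_orth2; ring.
  - intros p Hp. apply (Un p Hp).
  - intros p Hp. unfold binormal. rewrite lor_scal_r, lor_scal_l, Hcr by exact Hp.
    pose proof (sqrt_lt_R0 _ (Hp0 p Hp)) as Ps.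
    rewrite <- (sqrt_sqrt (- detg z p)) at 3 by (left; auto). field. lra.
  - intros p Hp. unfold binormal. rewrite lor_scal_r, lor_sym, cross_orth3. ring.
Qed.

End Surface.

Section Forms.

Variables (D : plane -> Prop) (z n m : plane -> E4).
Hypothesis HF : normal_frame D z n m.
Hypothesis Hcol : collinear_with_H D z n.
Hypothesis Hpar : forall p i, D p -> lor (dvec i n p) (m p) = 0.
Hypothesis Hinfl : forall p, D p -> ~ inflection_point z p.
Hypothesis HK : forall p, D p ->
  gauss_curvature z p - lor (mean_curvature z p) (mean_curvature z p) = 0.

Lemma trace_normal (N : plane -> E4) (p : plane) : D p ->
  (forall k, lor (dvec k z p) (N p) = 0) ->
  2 * detg z p * lor (mean_curvature z p) (N p) = g z I2 I2 p * sff z N I1 I1 p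
  - 2 * g z I1 I2 p * sff z N I1 I2 p + g z I1 I1 p * sff z N I2 I2 p.
Proof.
  intros Hp HN. pose proof (nf_det _ _ _ _ HF p Hp) as Hd.
  rewrite mean_curvature_normal by assumption. rewrite (sff_sym D z n m HF N I2 I1) by exact Hp.
  unfold ginv. field. exact Hd.
Qed.

Lemma trace_m (p : plane) : D p -> g z I2 I2 p * sff z m I1 I1 p
  - 2 * g z I1 I2 p * sff z m I1 I2 p + g z I1 I1 p * sff z m I2 I2 p = 0.
Proof.
  intros Hp. rewrite <- trace_normal; auto.
  - destruct (Hcol p Hp) as [h ->]. rewrite lor_scal_l, (nf_nm _ _ _ _ HF) by exact Hp. ring.
  - intros k. apply (nf_zm _ _ _ _ HF), Hp.
Qed.

(** Otherwise the first normal space would be contained in the line of [n]. *)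
Lemma sff_m_nonzero (p : plane) : D p ->
  ~ (sff z m I1 I1 p = 0 /\ sff z m I1 I2 p = 0 /\ sff z m I2 I2 p = 0).
Proof.
  intros Hp (H1 & H2 & H3). apply (Hinfl p Hp). exists (n p).
  assert (Z : forall v : E4, scal 0 v = zero) by (intros v; apply E4_eq; apply Rmult_0_l).
  intros w Hw. induction Hw as [|c s w [a [b ->]] Hw [k IH]].
  - exists 0. symmetry. apply Z.
  - rewrite (sigma_eq D z n m HF p a b (lor (sigma z p a b) (n p)) 0 Hp eq_refl).
    + exists (c * lor (sigma z p a b) (n p) + k). rewrite IH. generalize (lor (sigma z p a b) (n p)).
      intros t. assert (E : forall s s', c * (t * s + 0 * s') + k * s = (c * t + k) * s)
        by (intros; ring).
      apply E4_eq; apply E.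
    + rewrite sigma_normal.
      * rewrite (sff_sym D z n m HF m I2 I1) by exact Hp. rewrite H1, H2, H3. ring.
      * intros j. apply (nf_zm _ _ _ _ HF), Hp.
Qed.

(** The two algebraic conclusions drawn from the Ricci equation, and from the
    Gauss equation with [K = H^2]. *)
Lemma forms_dependent (p : plane) : D p -> exists nu c,
  (forall i j, sff z n i j p = nu * g z i j p + c * sff z m i j p) /\
  sff z m I1 I1 p * sff z m I2 I2 p - sff z m I1 I2 p * sff z m I1 I2 p = 0.
Proof.
  intros Hp. pose proof (nf_det _ _ _ _ HF p Hp) as Hd.
  assert (Hd' : g z I1 I1 p * g z I2 I2 p - g z I1 I2 p * g z I1 I2 p <> 0).
  { unfold detg in Hd. rewrite (g_sym z I2 I1) in Hd. exact Hd. }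
  destruct (commuting_forms _ _ _ _ _ _ _ _ _ Hd' (trace_m p Hp)
    (ricci_equation D z n m HF Hpar p Hp) (sff_m_nonzero p Hp)) as (nu & c & K1 & K2 & K3).
  exists nu, c. split.
  - intros i j. pose proof (sff_sym D z n m HF n I2 I1 p Hp) as S1.
    pose proof (sff_sym D z n m HF m I2 I1 p Hp) as S2.
    destruct i, j; rewrite ?S1, ?S2, ?(g_sym z I2 I1); assumption.
  - apply (rank_one_form _ _ _ _ _ _ _ _ _ nu c Hd' (trace_m p Hp) K1 K2 K3).
    rewrite <- trace_normal by (auto; intros k; apply (nf_zn _ _ _ _ HF), Hp).
    pose proof (gauss_equation D z n m HF p Hp) as G. rewrite <- G.
    destruct (Hcol p Hp) as [h Eh]. pose proof (HK p Hp) as E. rewrite Eh in E |- *.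
    rewrite !lor_scal_l, lor_scal_r, (nf_nn _ _ _ _ HF) in E by exact Hp.
    rewrite lor_scal_l, (nf_nn _ _ _ _ HF) by exact Hp.
    replace (gauss_curvature z p) with (h * h) by lra.
    unfold detg. rewrite (g_sym z I2 I1). ring.
Qed.

End Forms.

(** The sign of the null one-form may be chosen at will. *)
Lemma null_field_opp (z m : plane -> E4) (e : ix) (eps : R) (p : plane) :
  x4 (null_field z m e eps (-1) p) = - x4 (null_field z m e eps 1 p).
Proof.
  change (x4 (null_field z m e eps (-1) p)) with
    (sharp z (null_form z m e eps (-1)) I1 p * x4 (dvec I1 z p)
     + sharp z (null_form z m e eps (-1)) I2 p * x4 (dvec I2 z p)).
  change (x4 (null_field z m e eps 1 p)) with
    (sharp z (null_form z m e eps 1) I1 p * x4 (dvec I1 z p)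
     + sharp z (null_form z m e eps 1) I2 p * x4 (dvec I2 z p)).
  unfold sharp, null_form, Rdiv. ring.
Qed.

Theorem proposition3p8 (D : plane -> Prop) (z : plane -> E4)
    (hsurf : timelike_surface D z)
    (hpar : parallel_normalized_mean_curvature D z)
    (hinfl : forall p, D p -> ~ inflection_point z p)
    (hK : forall p, D p ->
       gauss_curvature z p - lor (mean_curvature z p) (mean_curvature z p) = 0) :
  locally_admits_canonical_parameters D z.
Proof.
  destruct hsurf as ([HD _] & Hz & _ & Hlor).
  destruct hpar as (_ & _ & n & Hn & Hcol & Hpn).
  assert (Hdet : forall p, D p -> detg z p < 0) by (intros p Hp; apply detg_neg, Hlor, Hp).
  set (m := binormal z n).
  assert (HF : normal_frame D z n m) by (apply binormal_frame; auto).
  assert (Hpar : forall p i, D p -> lor (dvec i n p) (m p) = 0).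
  { intros p i Hp. pose proof (Hpn p (basis i) Hp) as E.
    apply (f_equal (fun v => lor v (m p))) in E. rewrite lor_zero_l in E.
    unfold normal_connection in E.
    rewrite (normal_part_normal z p _ (m p)) in E by (intros; apply (nf_zm _ _ _ _ HF), Hp).
    unfold sum_ix in E. autorewrite with lor in E. destruct i; simpl in E; lra. }
  pose proof (forms_dependent D z n m HF Hcol Hpar hinfl hK) as Hdep.
  pose proof (trace_m D z n m HF Hcol) as Htr.
  assert (Hrank : forall p, D p ->
    sff z m I1 I1 p * sff z m I2 I2 p - sff z m I1 I2 p * sff z m I1 I2 p = 0).
  { intros p Hp. destruct (Hdep p Hp) as (nu & c & _ & H). exact H. }
  intros p Hp.
  assert (He : exists e, sff z m e e p <> 0).
  { apply NNPP. intros Hno. apply (sff_m_nonzero D z n m HF hinfl p Hp).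
    assert (Z : forall e, sff z m e e p = 0).
    { intros e. apply NNPP. intros H. apply Hno. exists e. exact H. }
    pose proof (Hrank p Hp) as Rk. rewrite !Z in Rk.
    split; [apply Z|]. split; [|apply Z]. apply Rsqr_0_uniq. unfold Rsqr. lra. }
  destruct He as [e He].
  assert (Heps : exists eps, eps * eps = 1 /\ 0 < eps * sff z m e e p).
  { destruct (Rlt_dec 0 (sff z m e e p)); [exists 1 | exists (-1)]; lra. }
  destruct Heps as (eps & Heps & Hpos).
  set (D1 := fun q => D q /\ 0 < eps * sff z m e e q).
  assert (Sh : smooth D (fun q => eps * sff z m e e q)).
  { apply smooth_mult; auto using smooth_const. apply (smooth_sff D z n m HF). }
  assert (HD1 : open D1) by (apply open_pos; auto; intros; apply (smooth_cont D); auto).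
  assert (HD1D : forall q, D1 q -> D q) by (intros q [Hq _]; exact Hq).
  pose proof (normal_frame_sub D D1 z n m HD1 HD1D HF) as HF1.
  assert (Hkap : exists kap, kap * kap = 1 /\ x4 (null_field z m e eps kap p) < 0).
  { assert (H0 : x4 (null_field z m e eps 1 p) <> 0).
    { apply (null_field_time D1 z n m HF1); auto; try lra.
      - intros q [_ Hq]. exact Hq.
      - split; assumption. }
    destruct (Rlt_dec (x4 (null_field z m e eps 1 p)) 0) as [H|H].
    - exists 1. lra.
    - exists (-1). rewrite null_field_opp. lra. }
  destruct Hkap as (kap & Hkap & Ht).
  set (V := null_field z m e eps kap). set (w := null_form z m e eps kap).
  assert (Htr1 : forall q, D1 q -> g z I2 I2 q * sff z m I1 I1 q
    - 2 * g z I1 I2 q * sff z m I1 I2 q + g z I1 I1 q * sff z m I2 I2 q = 0) by auto.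
  assert (Hrank1 : forall q, D1 q ->
    sff z m I1 I1 q * sff z m I2 I2 q - sff z m I1 I2 q * sff z m I1 I2 q = 0) by auto.
  assert (Hpos1 : forall q, D1 q -> 0 < eps * sff z m e e q) by (intros q [_ Hq]; exact Hq).
  assert (Hpar1 : forall q i, D1 q -> lor (dvec i n q) (m q) = 0) by auto.
  assert (SV : smooth4 D1 V) by (apply (smooth_null_field D1 z n m HF1); auto).
  assert (HD2 : open (fun q => D1 q /\ 0 < - x4 (V q))).
  { apply open_pos; auto. intros q Hq. apply (smooth_cont D1); auto.
    apply smooth_opp; auto. apply SV. }
  destruct (HD2 p) as [r Hr].
  { split; [split; assumption | unfold V; lra]. }
  set (B := fun q : plane => ball p r q).
  assert (HB1 : forall q, B q -> D1 q) by (intros q Hq; apply Hr, Hq).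
  assert (HBV : forall q, B q -> x4 (V q) < 0) by (intros q Hq; destruct (Hr q Hq); lra).
  assert (HB : open B) by apply open_ball.
  destruct (null_line_coordinates p r z n m V w (sharp z w) eps)
    as (r' & c & W & phi & HW & HWp & HWB & Hdiff & Hcan); auto using cond_pos.
  - apply (normal_frame_sub D1); auto.
  - apply (smooth4_sub D1); auto.
  - intros i. apply (smooth_sub D1); auto. apply (smooth_null_form D1 z n m HF1); auto.
  - intros q Hq. apply (null_form_closed D1 z n m HF1); auto.
  - intros q i Hq. apply (null_field_dvec D1 z n m HF1); auto.
  - intros q Hq. apply (sharp_null D1 z n m HF1); auto.
  - intros q i Hq. apply (dvec_m D1 z n m HF1); auto.
  - intros q Hq. destruct (Hdep q (HD1D q (HB1 q Hq))) as (nu & k & K & _).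
    exists nu, (k * eps). intros i j. rewrite K.
    rewrite <- (null_form_square D1 z n m HF1 Hrank1 e eps kap Heps Hkap Hpos1 i j q (HB1 q Hq)).
    unfold w. ring.
  - exists (fun q : plane => ball c r' q), W, phi.
    split; [apply ball_domain|]. split; [exact HW|]. split; [exact HWp|].
    split; [intros q Hq; apply HD1D, HB1, HWB, Hq|]. split; assumption.
Qed.
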